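(* Let $u_0\in C(\Gamma(0))$ and suppose that the viscosity solution $u$ of $$\partial^\bullet u(x,t)+H(x,t,\nabla_\Gamma u(x,t))=0\ \text{ for }(x,t)\in S_T,\qquad u(x,0)=u_0(x)\ \text{ for }x\in\Gamma(0)$$ is Lipschitz continuous on $\overline{S_T}$ in the sense that $$|u(x,t)-u(y,s)|\le L_U(|x-y|+|t-s|)$$ for all $(x,t),(y,s)\in\overline{S_T}$, where $L_U>0$ is a constant independent of $(x,t)$ and $(y,s)$. Assume further that the mesh condition $$C_0\max_j h_{T^{n,i}_j}\le\varepsilon^n_i\le C_1\max_j h_{T^{n,i}_j},\qquad \tau^n\le C_2\min_{i,j}|E^{n,i}_j|$$ is satisfied for all $h$, $n$ and $i$, and denote by $u_h^n=\sum_{i=1}^Mu_i^n\chi_i(\cdot,t^n)\in V_h^n$ the finite element functions constructed from $u_0$ by $u_i^0=u_0(x_i^0)$ and $u_h^{n+1}=S_h^n(u_h^n)$, $n=0,\dots,N-1$. Then there exist $h_0>0$ and a constant $C>0$ independent of $h$ such that $$\max_{1\le i\le M,\,0\le n\le N}|u(x_i^n,t^n)-u_i^n|\le Ch^{1/2}\qquad\text{for all }h\in(0,h_0).$$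
   Context: Evolving surface (fixed throughout; constants may depend on it). $\Gamma_0\subset\mathbb{R}^3$ is a closed (compact, without boundary), connected, oriented, smooth hypersurface, $T>0$, and $\Phi:\Gamma_0\times[0,T]\to\mathbb{R}^3$ is a smooth flow map such that $\Phi(\cdot,t)$ is a diffeomorphism of $\Gamma_0$ onto a hypersurface $\Gamma(t)$, with $\Phi(X,0)=X$ and $\partial_t\Phi(X,t)=v_\Gamma(\Phi(X,t),t)$, $v_\Gamma\in C^1(\overline{S_T})$, where $S_T=\bigcup_{t\in(0,T)}\Gamma(t)\times\{t\}$ and $\overline{S_T}=\bigcup_{t\in[0,T]}\Gamma(t)\times\{t\}$. $d(\cdot,t)$ is the signed distance function to $\Gamma(t)$ increasing in the direction of the unit outward normal $\nu(\cdot,t)$, and $\pi(x,t)\in\Gamma(t)$ is the unique point with $x=\pi(x,t)+d(x,t)\nu(\pi(x,t),t)$, for $x$ in a suitable neighbourhood $N(t)$ of $\Gamma(t)$. $\nabla_\Gamma f=(I_3-\nu\otimes\nu)\nabla\tilde f$ is the tangential gradient ($\tilde f$ any smooth extension of $f$) and $\partial^\bullet f$ the material derivative, $\partial^\bullet f(\Phi(X,t),t)=\frac{d}{dt}\bigl(f(\Phi(X,t),t)\bigr)$. Hamiltonian. $H:\overline{S_T}\times\mathbb{R}^3\to\mathbb{R}$ satisfies, with positive constants $L_{H,1},L_{H,2}$, for all $(x,t),(y,s)\in\overline{S_T}$, $p,q\in\mathbb{R}^3$: $|H(x,t,p)-H(y,s,p)|\le L_{H,1}(|x-y|+|t-s|)(1+|p|)$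 and $|H(x,t,p)-H(x,t,q)|\le L_{H,2}|p-q|$. Viscosity solutions. A locally bounded upper (resp. lower) semicontinuous function $u$ on $\overline{S_T}$ is a viscosity subsolution (resp. supersolution) if $u(x,0)\le u_0(x)$ (resp. $u(x,0)\ge u_0(x)$) for all $x\in\Gamma(0)$ and, for any $\varphi\in C^1(\overline{S_T})$, whenever $u-\varphi$ takes a local maximum (resp. minimum) at $(x_0,t_0)\in\overline{S_T}$ with $t_0>0$ (so $t_0=T$ is allowed), then $\partial^\bullet\varphi(x_0,t_0)+H(x_0,t_0,\nabla_\Gamma\varphi(x_0,t_0))\le0$ (resp. $\ge0$). A viscosity solution is a function that is both a subsolution and a supersolution (it exists and is unique for $u_0\in C(\Gamma(0))$). Triangulations. For $0<h<h_*$ let $\mathcal{T}_h(t)$ be a triangulation with polyhedral surface $\Gamma_h(t)=\bigcup_{K(t)\in\mathcal{T}_h(t)}K(t)$ (flat triangles), $h=\max_{t\in[0,T]}\max_{K(t)}h_{K(t)}$, $h_{K(t)}=\operatorname{diam}K(t)$ (the $h_0$ of the claim may be taken $\le h_*$). The $M$ vertices $x_i(t)=\Phi(x_i^0,t)\in\Gamma(t)$ are moved by the flow map, with connectivity fixed in time. $h_*$ is small enough that $\Gamma_h(t)\subset N(t)$, and $\pi_h(\cdot,t)=\pi(\cdot,t)|_{\Gamma_h(t)}$ is assumed to be a homeomorphism onto $\Gamma(t)$. Regularity: there is $\gamma>0$ with $h_{K(t)}\le\gamma\rho_{K(t)}$ for all $t\in[0,T]$ and $K(t)\in\mathcal{T}_h(t)$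 (and all $h$), where $\rho_{K(t)}$ is the radius of the largest circle contained in $K(t)$. $V_h(t)$ is the space of continuous functions on $\Gamma_h(t)$, affine on each triangle, with nodal basis $\chi_i(\cdot,t)$, $\chi_i(x_j(t),t)=\delta_{ij}$. Scheme (for each $h$, with $M$, the time partition and the parameters depending on $h$). Let $0=t^0<t^1<\dots<t^N=T$, $\tau^n=t^{n+1}-t^n$, $x_i^n=x_i(t^n)$, $V_h^n=V_h(t^n)$. Let $\Upsilon_i$ be the number of triangles with common vertex $i$, and let $i_1,\dots,i_{\Upsilon_i}$ be the other vertices of these triangles, enumerated cyclically in clockwise direction (indices $j$ cyclic modulo $\Upsilon_i$). $T_j^{n,i}\in\mathcal{T}_h(t^n)$ is the triangle with vertices $i,i_j,i_{j+1}$, $h_{T_j^{n,i}}$ its diameter, and $E_j^{n,i}$ (length $|E_j^{n,i}|$) the edge joining $i$ and $i_j$. Let $d_j^{n,i}$ be the distance from vertex $i$ to the contact point on $E_j^{n,i}$ of the inscribed circle of $T_j^{n,i}$ and $d^{n,i}=\min_j d_j^{n,i}$. The volume $V^{n,i}\subset\Gamma_h(t^n)$ is the polygonal region around $i$ bounded by line segments perpendicular to the edges $E_j^{n,i}$ at distance $d^{n,i}$ from vertex $i$; i.e. $V^{n,i}\cap T_j^{n,i}$ is the quadrilateral in $T_j^{n,i}$ whose vertices are $x_i^n$, the points of $E_j^{n,i}$ and $E_{j+1}^{n,i}$ at distance $d^{n,i}$ from $x_i^n$, and the intersection of the perpendiculars to these edges (in the plane of $T_j^{n,i}$) at those points. $h_{j,L}^{n,i}$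 and $h_{j,R}^{n,i}$ are the lengths of the parts of the boundary of $V^{n,i}$ perpendicular to $E_j^{n,i}$ lying in $T_{j-1}^{n,i}$ and $T_j^{n,i}$, respectively. $|\cdot|$ of a two-dimensional set is its area, $\varepsilon_i^n>0$ are parameters, and $\nabla_{\Gamma_h}u_h|_{T}$ is the (constant) tangential gradient of $u_h$ on the flat triangle $T$. For $u_h^n=\sum_iu_i^n\chi_i(\cdot,t^n)\in V_h^n$ and $n\in\{0,\dots,N-1\}$ define $S_h^n(u_h^n)=\sum_{i=1}^M[S_h^n(u_h^n)]_i\,\chi_i(\cdot,t^{n+1})\in V_h^{n+1}$ with $$[S_h^n(u_h^n)]_i=u_i^n-\tau^n\Bigl\{\sum_{j=1}^{\Upsilon_i}\tfrac{|V^{n,i}\cap T_j^{n,i}|}{|V^{n,i}|}H\bigl(x_i^n,t^n,\nabla_{\Gamma_h}u_h^n|_{T_j^{n,i}}\bigr)-\tfrac{\varepsilon_i^n}{|V^{n,i}|}\sum_{j=1}^{\Upsilon_i}\tfrac{u_{i_j}^n-u_i^n}{|E_j^{n,i}|}(h_{j,L}^{n,i}+h_{j,R}^{n,i})\Bigr\}.$$ Constants in the mesh condition. $C_0,C_1,C_2>0$ are fixed constants depending only on $\gamma$ and $L_{H,2}$ for which the mesh condition implies monotonicity of the scheme: $u_h^n\le v_h^n$ on $\Gamma_h(t^n)$ implies $S_h^n(u_h^n)\le S_h^n(v_h^n)$ on $\Gamma_h(t^{n+1})$, for $u_h^n,v_h^n\in V_h^n$. *)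

(* Defs.v *)
From HB Require Import structures.
From mathcomp Require Import all_boot all_order all_algebra.
From mathcomp Require Import all_classical all_reals all_analysis.

Set Implicit Arguments.
Unset Strict Implicit.
Unset Printing Implicit Defensive.

Import Order.TTheory GRing.Theory Num.Theory.
Import numFieldNormedType.Exports.

Local Open Scope classical_set_scope.
Local Open Scope ring_scope.

(* The library norm on 'rV[R]_3 is the maximum norm (it induces the same
   topology); the Euclidean norm [enorm] is used for all metric quantities. *)
Notation vec R := 'rV[R]_3.

Section Euclidean.
Variable R : realType.
Implicit Types (u v x y : vec R) (A : set (vec R)).

Definition dot u v : R := \sum_(i < 3) u 0 i * v 0 i.

Definition enorm u : R := Num.sqrt (dot u u).

(* Indices are taken modulo 3. *)
Definition cross u v : vec R :=
  \row_(i < 3) (u 0 (i + 1) * v 0 (i + 2) - u 0 (i + 2) * v 0 (i + 1)).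

Definition dist_set A x : R := inf [set enorm (x - y) | y in A].

Definition ediam A : R :=
  sup [set r | exists x y, [/\ A x, A y & r = enorm (x - y)]].

Definition tri_area x y z : R := enorm (cross (y - x) (z - x)) / 2.

(* Area of the convex quadrilateral with consecutive vertices x, y, z, w. *)
Definition quad_area x y z w : R := tri_area x y z + tri_area x z w.

End Euclidean.

Section Smoothness.
Variable R : realType.

Fixpoint Ck (k : nat) (V W : normedModType R) (f : V -> W) : Prop :=
  match k with
  | 0 => continuous f
  | k'.+1 => (forall x, differentiable f x) /\
             (forall v, Ck k' (fun x => 'D_v f x))
  end.

Definition Ck_on (k : nat) (V W : normedModType R) (A : set V) (f : V -> W) :=
  exists2 g : V -> W, Ck k g & {in A, f =1 g}.

Definition smooth (V W : normedModType R) (f : V -> W) := forall k, Ck k f.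

Definition smooth_on (V W : normedModType R) (A : set V) (f : V -> W) :=
  exists2 g : V -> W, smooth g & {in A, f =1 g}.

Definition grad (f : vec R -> R) (x : vec R) : vec R :=
  \row_(i < 3) 'D_(delta_mx 0 i) f x.

End Smoothness.

Section Hypersurfaces.
Variable R : realType.
Implicit Types (G : set (vec R)) (x w : vec R).

(* Without boundary: near each of its points, G is a regular level set. *)
Definition smooth_hypersurface G :=
  forall x, G x -> exists (U : set (vec R)) (F : vec R -> R),
    [/\ open U, U x, smooth F, (forall y, U y -> grad F y != 0)
      & forall y, U y -> (G y <-> F y = 0)].

Definition tangent_vector G x w :=
  exists c : R -> vec R,
    [/\ c 0 = x, (\forall s \near (0 : R), G (c s)) & is_derive (0 : R) 1 c w].

Definition exterior G : set (vec R) :=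
  [set x | ~ G x /\ ~ bounded_set (connected_component (~` G) x)].

Definition unit_outward_normal G x (n : vec R) :=
  [/\ enorm n = 1, (forall w, tangent_vector G x w -> dot n w = 0)
    & \forall s \near (0 : R)^'+, exterior G (x + s *: n)].

(* Negative inside, positive outside. *)
Definition signed_dist G x : R :=
  if `[< exterior G x >] then dist_set G x else - dist_set G x.

Definition homeo_onto (A B : set (vec R)) (f : vec R -> vec R) :=
  [/\ set_bij A B f, {within A, continuous f}
    & exists2 g : vec R -> vec R,
        {within B, continuous g} & {in A, cancel f g}].

End Hypersurfaces.

(* The field [surf_proj] is pi(x,t), and [nhd t] is the neighbourhood N(t). *)
Record evolving_surface (R : realType) := EvolvingSurface {
  Gamma0 : set (vec R);
  Tend : R;
  flow : vec R -> R -> vec R;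
  vel : vec R * R -> vec R;
  normal : vec R -> R -> vec R;
  nhd : R -> set (vec R);
  surf_proj : vec R -> R -> vec R;
  Gamma := fun t : R => [set flow X t | X in Gamma0];
  STbar := [set z : vec R * R | 0 <= z.2 <= Tend /\ Gamma z.2 z.1];
  Gamma0_neq0 : Gamma0 !=set0;
  Gamma0_compact : compact Gamma0;
  Gamma0_connected : connected Gamma0;
  Gamma0_smooth : smooth_hypersurface Gamma0;
  Tend_gt0 : 0 < Tend;
  flow_smooth :
    smooth_on [set z : vec R * R | Gamma0 z.1 /\ 0 <= z.2 <= Tend]
      (fun z => flow z.1 z.2);
  flow_diffeo : forall t, 0 <= t <= Tend ->
    exists2 g : vec R -> vec R, smooth_on (Gamma t) g &
      forall X, Gamma0 X -> g (flow X t) = X;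
  Gamma_smooth : forall t, 0 <= t <= Tend -> smooth_hypersurface (Gamma t);
  flow0 : forall X, Gamma0 X -> flow X 0 = X;
  vel_C1 : Ck_on 1 STbar vel;
  (* one-sided at the end points of the time interval *)
  flow_vel : forall X t, Gamma0 X -> 0 <= t <= Tend ->
    (s - t)^-1 *: (flow X s - flow X t)
      @[s --> within [set` `[0, Tend]] (t^')] --> vel (flow X t, t);
  normalP : forall t x, 0 <= t <= Tend -> Gamma t x ->
    unit_outward_normal (Gamma t) x (normal x t);
  nhdP : forall t x, 0 <= t <= Tend -> Gamma t x -> nbhs x (nhd t);
  surf_projP : forall t x, 0 <= t <= Tend -> nhd t x ->
    forall y, (Gamma t y /\ x = y + signed_dist (Gamma t) x *: normal y t)
      <-> y = surf_proj x t
}.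

Section Viscosity.
Variable R : realType.
Variable S : evolving_surface R.
Implicit Types (u f : vec R * R -> R) (z : vec R * R).

(* Tangential gradient at z = (x,t), computed from an extension f to the
   ambient space. *)
Definition tan_grad f z : vec R :=
  let g := \row_(i < 3) 'D_(delta_mx 0 i, 0) f z in
  let n := normal S z.1 z.2 in g - dot n g *: n.

(* Material derivative at (flow X t, t); one-sided at t = 0 and t = Tend. *)
Definition mat_deriv f (X : vec R) (t : R) : R :=
  lim ((f (flow S X s, s) - f (flow S X t, t)) / (s - t)
         @[s --> within [set` `[0, Tend S]] (t^')]).

Definition hamiltonian (L1 L2 : R) (H : vec R * R -> vec R -> R) :=
  [/\ 0 < L1, 0 < L2,
     (forall x t y s p, STbar S (x, t) -> STbar S (y, s) ->
        `|H (x, t) p - H (y, s) p|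
          <= L1 * (enorm (x - y) + `|t - s|) * (1 + enorm p))
   & (forall x t p q, STbar S (x, t) ->
        `|H (x, t) p - H (x, t) q| <= L2 * enorm (p - q))].

Definition locally_bounded_on (A : set (vec R * R)) u :=
  forall z, A z -> exists M, \forall w \near within A (nbhs z), `|u w| <= M.

Definition usc_on (A : set (vec R * R)) u :=
  forall z, A z -> forall a, u z < a -> \forall w \near within A (nbhs z), u w < a.

Definition lsc_on (A : set (vec R * R)) u :=
  forall z, A z -> forall a, a < u z -> \forall w \near within A (nbhs z), a < u w.

(* A test function in C^1 of the closure of S_T is given by a C^1 extension
   phi to the ambient space-time, which also serves to compute its tangential
   gradient. *)
Definition viscosity_subsolution (H : vec R * R -> vec R -> R)
    (u0 : vec R -> R) u :=
  [/\ locally_bounded_on (STbar S) u, usc_on (STbar S) u,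
      (forall x, Gamma S 0 x -> u (x, 0) <= u0 x)
    & forall phi : vec R * R -> R, Ck 1 phi ->
      forall X t, Gamma0 S X -> 0 < t <= Tend S ->
      let z := (flow S X t, t) in
      (\forall w \near within (STbar S) (nbhs z), u w - phi w <= u z - phi z) ->
      mat_deriv phi X t + H z (tan_grad phi z) <= 0].

Definition viscosity_supersolution (H : vec R * R -> vec R -> R)
    (u0 : vec R -> R) u :=
  [/\ locally_bounded_on (STbar S) u, lsc_on (STbar S) u,
      (forall x, Gamma S 0 x -> u0 x <= u (x, 0))
    & forall phi : vec R * R -> R, Ck 1 phi ->
      forall X t, Gamma0 S X -> 0 < t <= Tend S ->
      let z := (flow S X t, t) in
      (\forall w \near within (STbar S) (nbhs z), u z - phi z <= u w - phi w) ->
      0 <= mat_deriv phi X t + H z (tan_grad phi z)].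

Definition viscosity_solution (H : vec R * R -> vec R -> R)
    (u0 : vec R -> R) u :=
  viscosity_subsolution H u0 u /\ viscosity_supersolution H u0 u.

End Viscosity.

(* Geometry of simplices whose vertices are picked from a family X of points. *)
Section Triangles.
Variables (R : realType) (M : nat) (X : 'I_M -> vec R).
Implicit Types (K : {set 'I_M}) (i j k : 'I_M).

Definition lin_comb (m : R) K : set (vec R) :=
  [set x | exists l : 'I_M -> R,
     [/\ forall i, i \notin K -> l i = 0, \sum_i l i = m
       & x = \sum_i l i *: X i]].

Definition aff_span K := lin_comb 1 K.

Definition direction K := lin_comb 0 K.

Definition hull K : set (vec R) :=
  [set x | exists l : 'I_M -> R,
     [/\ forall i, 0 <= l i, forall i, i \notin K -> l i = 0, \sum_i l i = 1
       & x = \sum_i l i *: X i]].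

Definition aff_indep K := forall l : 'I_M -> R,
  (forall i, i \notin K -> l i = 0) -> \sum_i l i = 0 ->
  \sum_i l i *: X i = 0 -> forall i, l i = 0.

(* Radius of the largest circle, in the plane of K, contained in K. *)
Definition inradius K : R :=
  sup [set r | 0 <= r /\ exists2 c, hull K c &
    forall y, aff_span K y -> enorm (y - c) <= r -> hull K y].

Definition affine_on K (f : vec R -> R) :=
  exists (g : vec R) (c : R), forall x, hull K x -> f x = dot g x + c.

Definition tri_grad K (f : vec R -> R) : vec R :=
  xget 0 [set g | direction K g /\
    forall x y, hull K x -> hull K y -> f x - f y = dot g (x - y)].

(* The circle of centre o through p touches the side [X i, X j] at p. *)
Definition touches (o : vec R) i j (p : vec R) :=
  hull [set i; j] p /\ dot (p - o) (X j - X i) = 0.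

(* Contact point of the inscribed circle of {i, j, k} on the side {i, j}. *)
Definition contact_point i j k : vec R :=
  xget 0 [set p | exists o q r,
    [/\ hull [set i; j; k] o,
        [/\ touches o i j p, touches o j k q & touches o k i r],
        enorm (p - o) = enorm (q - o) & enorm (p - o) = enorm (r - o)]].

Definition contact_dist i j k : R := enorm (contact_point i j k - X i).

Definition edge_len i j : R := enorm (X j - X i).

Definition edge_point (d : R) i j : vec R :=
  X i + (d / edge_len i j) *: (X j - X i).

(* Intersection, in the plane of {i, j, k}, of the perpendiculars to the edges
   {i, j} and {i, k} at distance d from X i. *)
Definition corner (d : R) i j k : vec R :=
  xget 0 [set q | [/\ aff_span [set i; j; k] q,
    dot (q - edge_point d i j) (X j - X i) = 0 &
    dot (q - edge_point d i k) (X k - X i) = 0]].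

End Triangles.

(* [star i] lists the vertices i_1, i_2, ... around the vertex i; the cyclic
   successor of k is [next (star i) k]. *)
Record discretization (R : realType) := Discretization {
  nvert : nat;
  vtx0 : 'I_nvert -> vec R;
  tris : {set {set 'I_nvert}};
  star : 'I_nvert -> seq 'I_nvert;
  nstep : nat;
  tgrid : nat -> R;
  eps : nat -> 'I_nvert -> R
}.

Section Scheme.
Variables (R : realType) (S : evolving_surface R) (D : discretization R).
Implicit Types (t : R) (n : nat) (i k : 'I_(nvert D)).

Definition vtx t i : vec R := flow S (vtx0 i) t.

Definition Gamma_h t : set (vec R) :=
  [set x | exists2 K, K \in tris D & hull (vtx t) K x].

Definition star_tri i k : {set 'I_(nvert D)} := [set i; k; next (star i) k].

(* Clockwise as seen from the tip of the outward normal at vertex i. *)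
Definition clockwise_star i :=
  [/\ uniq (star i), (2 < size (star i))%N, i \notin star i,
      (forall K, (K \in tris D) && (i \in K)
         <-> exists2 k, k \in star i & K = star_tri i k)
    & forall t k, 0 <= t <= Tend S -> k \in star i ->
        dot (normal S (vtx t i) t)
          (cross (vtx t k - vtx t i) (vtx t (next (star i) k) - vtx t i)) < 0].

Definition regular_triangulation (gamma h : R) :=
  [/\ injective (@vtx0 R D), (forall i, Gamma0 S (vtx0 i)),
      (forall K, K \in tris D -> #|K| = 3%N),
      (forall i, clockwise_star i)
    & [/\ forall t, 0 <= t <= Tend S ->
        [/\ forall K, K \in tris D -> aff_indep (vtx t) K,
            forall K K', K \in tris D -> K' \in tris D -> K != K' ->
              hull (vtx t) K `&` hull (vtx t) K' = hull (vtx t) (K :&: K')%SET,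
            Gamma_h t `<=` nhd S t
          & homeo_onto (Gamma_h t) (Gamma S t) (fun x => surf_proj S x t)],
      (forall t K, 0 <= t <= Tend S -> K \in tris D ->
         ediam (hull (vtx t) K) <= h),
      (exists t K, [/\ 0 <= t <= Tend S, K \in tris D &
         ediam (hull (vtx t) K) = h])
    & (forall t K, 0 <= t <= Tend S -> K \in tris D ->
         ediam (hull (vtx t) K) <= gamma * inradius (vtx t) K)]].

Definition time_partition :=
  [/\ tgrid D 0 = 0, tgrid D (nstep D) = Tend S
    & forall n, (n < nstep D)%N -> tgrid D n < tgrid D n.+1].

Definition admissible (gamma h : R) :=
  [/\ regular_triangulation gamma h, time_partition
    & forall n i, (n < nstep D)%N -> 0 < eps n i].

Definition fe_space t : set (vec R -> R) :=
  [set f | {within Gamma_h t, continuous f} /\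
           forall K, K \in tris D -> affine_on (vtx t) K f].

Definition nodal_basis t i : vec R -> R :=
  xget (fun=> 0) [set f | fe_space t f /\ forall j, f (vtx t j) = (j == i)%:R].

Definition tau n : R := tgrid D n.+1 - tgrid D n.

Definition vtxn n i : vec R := vtx (tgrid D n) i.

Definition tri_diam n i k : R := ediam (hull (vtxn n) (star_tri i k)).

Definition contact n i k : R := contact_dist (vtxn n) i k (next (star i) k).

Definition vol_dist n i : R := inf [set contact n i k | k in [set` star i]].

(* Area of the intersection of V^{n,i} with the triangle [star_tri i k]. *)
Definition vol_part n i k : R :=
  let d := vol_dist n i in
  let l := next (star i) k in
  quad_area (vtxn n i) (edge_point (vtxn n) d i k) (corner (vtxn n) d i k l)
    (edge_point (vtxn n) d i l).

Definition vol n i : R := \sum_(k <- star i) vol_part n i k.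

Definition hL n i k : R :=
  let d := vol_dist n i in
  enorm (corner (vtxn n) d i (prev (star i) k) k - edge_point (vtxn n) d i k).

Definition hR n i k : R :=
  let d := vol_dist n i in
  enorm (corner (vtxn n) d i k (next (star i) k) - edge_point (vtxn n) d i k).

Variable H : vec R * R -> vec R -> R.

Definition scheme_coef n (uh : vec R -> R) i : R :=
  uh (vtxn n i) - tau n *
   (\sum_(k <- star i) vol_part n i k / vol n i *
       H (vtxn n i, tgrid D n) (tri_grad (vtxn n) (star_tri i k) uh)
    - eps n i / vol n i *
      \sum_(k <- star i) (uh (vtxn n k) - uh (vtxn n i))
          / edge_len (vtxn n) i k * (hL n i k + hR n i k)).

Definition scheme n (uh : vec R -> R) : vec R -> R := fun x =>
  \sum_i scheme_coef n uh i * nodal_basis (tgrid D n.+1) i x.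

Fixpoint fe_solution (u0 : vec R -> R) n : vec R -> R :=
  match n with
  | 0 => fun x => \sum_i u0 (vtx0 i) * nodal_basis (tgrid D 0) i x
  | n'.+1 => scheme n' (fe_solution u0 n')
  end.

Definition monotone_scheme := forall n (uh vh : vec R -> R),
  (n < nstep D)%N -> fe_space (tgrid D n) uh -> fe_space (tgrid D n) vh ->
  (forall x, Gamma_h (tgrid D n) x -> uh x <= vh x) ->
  forall x, Gamma_h (tgrid D n.+1) x -> scheme n uh x <= scheme n vh x.

Definition mesh_condition (C0 C1 C2 : R) := forall n, (n < nstep D)%N ->
  (forall i,
     let hmax := \big[Num.max/0]_(k <- star i) tri_diam n i k in
     C0 * hmax <= eps n i <= C1 * hmax) /\
  (forall i k, k \in star i -> tau n <= C2 * edge_len (vtxn n) i k).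

End Scheme.

Arguments fe_solution {R} S D H u0 n.

(* The constants work for every Hamiltonian with the given Lipschitz constant
   in p and for every gamma-regular discretization of mesh size below hs. *)
Definition monotonicity_constants (R : realType) (S : evolving_surface R)
    (gamma L2 hs C0 C1 C2 : R) :=
  [/\ 0 < C0, 0 < C1, 0 < C2
    & forall (L1 : R) (H : vec R * R -> vec R -> R),
        hamiltonian S L1 L2 H ->
        forall (h : R) (D : discretization R), 0 < h < hs ->
        admissible S D gamma h -> mesh_condition S D C0 C1 C2 ->
        monotone_scheme S D H].

(* Main.v *)
(* The proof doubles the variables: one maximizes
     u(x,t) - U_i^n - A (|x - x_i^n|^2 + (t - t^n)^2) - lam (t + t^n),
   A = h^(-1/2), lam = C h^(1/2). Since u is Lipschitz, |x - x_i^n| + |t - t^n| is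
   O(h^(1/2)) at a maximum. If t > 0 and n > 0 there, the viscosity inequality for
   the quadratic test function contradicts the discrete equation as soon as C is
   large: by monotonicity, U^(n-1) may be replaced in the scheme by the same
   quadratic, and on the nodal values of a quadratic with Hessian O(A) the scheme
   is consistent up to O((1 + |p|) h^(1/2) + A h). The cases n = 0 and t = 0 follow
   from the Lipschitz continuity of u and from a discrete barrier. The opposite
   estimate is the same one for -u and the Hamiltonian -H(z,-p).
   Consistency needs that all the triangles around a vertex have comparable sizes.
   Consecutive edge directions enclose an angle bounded below; if two
   non-consecutive edges were almost parallel, two points of Gamma_h would lie on
   the same normal line, contradicting the injectivity of the projection. So the
   star has boundedly many triangles. The diffusion term is then bounded because the
   fluxes around the vertex telescope when the triangles are coplanar. *)
Require Import Defs.
From HB Require Import structures.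
From mathcomp Require Import all_boot all_order all_algebra.
From mathcomp Require Import all_classical all_reals all_analysis.
From mathcomp Require Import ring lra.
Import Order.TTheory GRing.Theory Num.Theory.
Import numFieldNormedType.Exports.
Local Open Scope classical_set_scope.
Local Open Scope ring_scope.
Set Implicit Arguments.
Unset Strict Implicit.
Unset Printing Implicit Defensive.

(** * Vector algebra *)

(** One balance dictates the exponents. At the maximum |x - x_i^n| + |t - t^n| is O(1/A), so the
    gradient p = 2A (x - x_i^n) of the penalty stays bounded although A is large. What remains is
    the O(1/A) shift of the arguments of H, the O(A h) effect of the Hessian on interpolation and
    diffusion, and A tau = O(A h) from the time step; A = h^(-1/2) makes all of them O(h^(1/2)).
    Since the vertices move, the time difference of |x - x_i(t)|^2 produces the mean velocity of the
    vertex, whereas the material derivative produces the velocity at x; the two terms cancel to the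
    right order because the velocity is Lipschitz. Much of the work is uniformity. The data provide
    a smooth invertible flow, normals and projections, but no constants; these are extracted by
    compactness, uniformly in time. Shape regularity speaks of single triangles, so every statement
    about a whole star has to be deduced. Nodal functions, gradients, contact points and corners are
    defined by choice; each needs an existence argument before it can be computed with. *)

Section VectorAlgebra.
Variable R : realType.
Implicit Types (u v w x y z e f r : vec R) (a b c : R).

Lemma dotE u v :
  dot u v = u 0 0 * v 0 0 + u 0 1 * v 0 1 + u 0 2 * v 0 2.
Proof.
rewrite /dot !big_ord_recl big_ord0 addr0 addrA.
by congr (_ * _ + _ * _ + _ * _); congr (_ _ _); apply: val_inj.
Qed.

Lemma crossE0 u v : cross u v 0 0 = u 0 1 * v 0 2 - u 0 2 * v 0 1.
Proof.
by rewrite mxE; congr (_ * _ - _ * _); congr (_ _ _); apply: val_inj.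
Qed.

Lemma crossE1 u v : cross u v 0 1 = u 0 2 * v 0 0 - u 0 0 * v 0 2.
Proof.
by rewrite mxE; congr (_ * _ - _ * _); congr (_ _ _); apply: val_inj.
Qed.

Lemma crossE2 u v : cross u v 0 2 = u 0 0 * v 0 1 - u 0 1 * v 0 0.
Proof.
by rewrite mxE; congr (_ * _ - _ * _); congr (_ _ _); apply: val_inj.
Qed.

Lemma vec3P u v :
  u 0 0 = v 0 0 -> u 0 1 = v 0 1 -> u 0 2 = v 0 2 -> u = v.
Proof.
move=> h0 h1 h2; apply/rowP => -[[|[|[|//]]] p].
- by rewrite (_ : Ordinal p = 0) //; exact: val_inj.
- by rewrite (_ : Ordinal p = 1) //; exact: val_inj.
- by rewrite (_ : Ordinal p = 2) //; exact: val_inj.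
Qed.

(** Expansion into coordinates, after which vector identities are polynomial and fall to [ring]. *)
Definition vecE := (dotE, crossE0, crossE1, crossE2, mxE).

Lemma dotC u v : dot u v = dot v u.
Proof. by rewrite !vecE; ring. Qed.

Lemma dotDl u v w : dot (u + v) w = dot u w + dot v w.
Proof. by rewrite !vecE; ring. Qed.

Lemma dotDr u v w : dot w (u + v) = dot w u + dot w v.
Proof. by rewrite !vecE; ring. Qed.

Lemma dotZl a u v : dot (a *: u) v = a * dot u v.
Proof. by rewrite !vecE; ring. Qed.

Lemma dotZr a u v : dot v (a *: u) = a * dot v u.
Proof. by rewrite !vecE; ring. Qed.

Lemma dotNl u v : dot (- u) v = - dot u v.
Proof. by rewrite !vecE; ring. Qed.

Lemma dotNr u v : dot v (- u) = - dot v u.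
Proof. by rewrite !vecE; ring. Qed.

Lemma dotBl u v w : dot (u - v) w = dot u w - dot v w.
Proof. by rewrite dotDl dotNl. Qed.

Lemma dotBr u v w : dot w (u - v) = dot w u - dot w v.
Proof. by rewrite dotDr dotNr. Qed.

Lemma dot0l u : dot 0 u = 0.
Proof. by rewrite !vecE; ring. Qed.

Lemma dot0r u : dot u 0 = 0.
Proof. by rewrite dotC dot0l. Qed.

Lemma dot_ge0 u : 0 <= dot u u.
Proof. by rewrite dotE -!expr2 !addr_ge0 // sqr_ge0. Qed.

Lemma dot_eq0 u : (dot u u == 0) = (u == 0).
Proof.
apply/idP/idP => [|/eqP ->]; last by rewrite dot0l.
rewrite dotE -!expr2 => e.
have /andP[/eqP e0 /andP[/eqP e1 /eqP e2]] :
    [&& u 0 0 ^+ 2 == 0, u 0 1 ^+ 2 == 0 & u 0 2 ^+ 2 == 0].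
  move: e; rewrite !paddr_eq0 ?addr_ge0 ?sqr_ge0 //.
  by move=> /andP[/andP[-> ->] ->].
by apply/eqP/vec3P; rewrite mxE; apply/eqP; rewrite -sqrf_eq0; apply/eqP.
Qed.

Lemma enorm_ge0 u : 0 <= enorm u.
Proof. exact: sqrtr_ge0. Qed.

Lemma enorm2 u : enorm u ^+ 2 = dot u u.
Proof. by rewrite /enorm sqr_sqrtr ?dot_ge0. Qed.

Lemma enorm_eq0 u : (enorm u == 0) = (u == 0).
Proof. by rewrite -sqrf_eq0 enorm2 dot_eq0. Qed.

Lemma enorm_gt0 u : (0 < enorm u) = (u != 0).
Proof. by rewrite lt_neqAle enorm_ge0 andbT eq_sym enorm_eq0. Qed.

Lemma enorm0 : enorm (0 : vec R) = 0.
Proof. by apply/eqP; rewrite enorm_eq0. Qed.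

Lemma enormZ a u : enorm (a *: u) = `|a| * enorm u.
Proof.
by rewrite /enorm dotZl dotZr mulrA -expr2 sqrtrM ?sqr_ge0 // sqrtr_sqr.
Qed.

Lemma enormN u : enorm (- u) = enorm u.
Proof. by rewrite /enorm dotNl dotNr opprK. Qed.

Lemma enormBC u v : enorm (u - v) = enorm (v - u).
Proof. by rewrite -enormN opprB. Qed.

Lemma lagrange u v :
  dot (cross u v) (cross u v) + dot u v ^+ 2 = dot u u * dot v v.
Proof. by rewrite !vecE; ring. Qed.

Lemma enorm_le u a : 0 <= a -> dot u u <= a ^+ 2 -> enorm u <= a.
Proof. by move=> a0; rewrite -enorm2 ler_sqr ?nnegrE ?enorm_ge0. Qed.

Lemma cauchy_schwarz u v : `|dot u v| <= enorm u * enorm v.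
Proof.
rewrite -ler_sqr ?nnegrE ?mulr_ge0 ?enorm_ge0 // real_normK ?num_real //.
by rewrite exprMn !enorm2 -lagrange lerDr dot_ge0.
Qed.

Lemma enorm_cross_le u v : enorm (cross u v) <= enorm u * enorm v.
Proof.
apply: enorm_le; first by rewrite mulr_ge0 ?enorm_ge0.
by rewrite exprMn !enorm2 -lagrange lerDl sqr_ge0.
Qed.

Lemma enormD u v : enorm (u + v) <= enorm u + enorm v.
Proof.
apply: enorm_le; first by rewrite addr_ge0 ?enorm_ge0.
rewrite sqrrD !enorm2 dotDl !dotDr (dotC v u).
have := le_trans (ler_norm _) (cauchy_schwarz u v); lra.
Qed.

Lemma enormB u v : enorm (u - v) <= enorm u + enorm v.
Proof. by rewrite -(enormN v) enormD. Qed.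

Lemma enorm_dist3 u v w : enorm (u - w) <= enorm (u - v) + enorm (v - w).
Proof. by rewrite (_ : u - w = (u - v) + (v - w)) ?enormD// addrA subrK. Qed.

Lemma cross_dotl u v : dot (cross u v) u = 0.
Proof. by rewrite !vecE; ring. Qed.

Lemma cross_dotr u v : dot (cross u v) v = 0.
Proof. by rewrite !vecE; ring. Qed.

Lemma crossC u v : cross u v = - cross v u.
Proof. by apply: vec3P; rewrite !vecE; ring. Qed.

Lemma crossZl a u v : cross (a *: u) v = a *: cross u v.
Proof. by apply: vec3P; rewrite !vecE; ring. Qed.

Lemma crossZr a u v : cross u (a *: v) = a *: cross u v.
Proof. by apply: vec3P; rewrite !vecE; ring. Qed.

Lemma crossDl u v w : cross (u + v) w = cross u w + cross v w.
Proof. by apply: vec3P; rewrite !vecE; ring. Qed.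

Lemma crossBl u v w : cross (u - v) w = cross u w - cross v w.
Proof. by apply: vec3P; rewrite !vecE; ring. Qed.

Lemma crossBr u v w : cross w (u - v) = cross w u - cross w v.
Proof. by apply: vec3P; rewrite !vecE; ring. Qed.

Lemma cross_crossl u v w :
  cross (cross u v) w = dot u w *: v - dot v w *: u.
Proof. by apply: vec3P; rewrite !vecE; ring. Qed.

Lemma cross_crossr u v w :
  cross w (cross u v) = dot v w *: u - dot u w *: v.
Proof. by apply: vec3P; rewrite !vecE; ring. Qed.

Lemma triple_le u v w : `|dot (cross u v) w| <= enorm u * enorm v * enorm w.
Proof.
apply: le_trans (cauchy_schwarz _ _) _.
by rewrite ler_wpM2r ?enorm_ge0 // enorm_cross_le.
Qed.

(** With N = [cross e f], the vectors f x N, - e x N and N are |N|^2 times the dual basis of e, f,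
    N. The estimates in the plane of a triangle rest on this formula. *)
Lemma frame_expansion e f r :
  dot (cross e f) (cross e f) *: r = dot r (cross e f) *: cross e f
    + (dot r e *: cross f (cross e f) - dot r f *: cross e (cross e f)).
Proof. by apply: vec3P; rewrite !vecE; ring. Qed.

(** The vectors dual to e and f lie in their plane, because a double cross product is a combination
    of e and f. The vector w serves as gradient of an affine function with prescribed increments
    along two edges. *)
Lemma span_expansion e f a b : cross e f != 0 -> exists w,
  [/\ exists a' b', w = a' *: e + b' *: f, dot w e = a & dot w f = b].
Proof.
move=> N0; set q := dot (cross e f) (cross e f).
have q0 : q != 0 by rewrite dot_eq0.
exists (q^-1 *: (a *: cross f (cross e f) - b *: cross e (cross e f))).
split; last 2 first.
- have /(congr1 (fun k : R => q^-1 * k)) :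
    dot (a *: cross f (cross e f) - b *: cross e (cross e f)) e = q * a.
    by rewrite /q !vecE; ring.
  by rewrite mulrA mulVf // mul1r -dotZl.
- have /(congr1 (fun k : R => q^-1 * k)) :
    dot (a *: cross f (cross e f) - b *: cross e (cross e f)) f = q * b.
    by rewrite /q !vecE; ring.
  by rewrite mulrA mulVf // mul1r -dotZl.
rewrite !cross_crossr.
exists (q^-1 * (a * dot f f - b * dot f e)), (q^-1 * (b * dot e e - a * dot e f)).
by apply: vec3P; rewrite !mxE; ring.
Qed.

Lemma norm_le_enorm u : `|u| <= enorm u.
Proof.
rewrite (_ : `|u| = mx_norm u) // mx_normrE; apply: bigmax_le; first exact: enorm_ge0.
move=> [i j] _ /=; rewrite -ler_sqr ?nnegrE ?enorm_ge0 //.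
rewrite real_normK ?num_real // enorm2 /dot (ord1 i) (bigD1 j) //= -expr2 lerDl.
by apply: sumr_ge0 => k _; rewrite -expr2 sqr_ge0.
Qed.

Lemma coord_le_norm u i : `|u 0 i| <= `|u|.
Proof.
by rewrite [leRHS](_ : _ = mx_norm u) // mx_normrE
   (le_bigmax _ (fun ij : 'I_1 * 'I_3 => `|u ij.1 ij.2|) (0, i)).
Qed.

Lemma enorm_le_norm u : enorm u <= 2 * `|u|.
Proof.
apply: enorm_le; first by rewrite mulr_ge0.
rewrite dotE.
have h i : u 0 i * u 0 i <= `|u| ^+ 2.
  rewrite -expr2 -real_normK ?num_real // ler_sqr ?nnegrE //.
  exact: coord_le_norm.
have := h 0; have := h 1; have := h 2; have := sqr_ge0 `|u|; nra.
Qed.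

End VectorAlgebra.

(** * Taylor estimates *)

(** Finitely many neighbourhoods cover K and the largest of their constants works everywhere; this
    is why the local hypothesis must hold for every C above its threshold. *)
Lemma compact_uniform_constant (R : realType) (X : topologicalType) (K : set X)
    (P : R -> X -> Prop) : compact K ->
  (forall x, K x -> exists C0, \forall x' \near x, forall C, C0 <= C -> P C x') ->
  exists2 C, 0 < C & forall x, K x -> P C x.
Proof.
move=> /compact_near_coveringP cK loc.
have near_pinfty (C0 : R) : \forall C \near +oo, C0 <= C.
  by exists C0; split => [|C /ltW//]; rewrite num_real.
have : \forall C \near +oo, 0 < C /\ K `<=` P C.
  apply: filterS2 (cK _ (pinfty_nbhs R) P _ _) (near_pinfty 1) => [C h1 h2|x Kx].
    by split=> //; exact: lt_le_trans h2.
  have [C0 near_x] := loc x Kx.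
  exists ([set x' | forall C, C0 <= C -> P C x'], [set C | C0 <= C]) => /=.
    by split; [exact: near_x|exact: near_pinfty].
  by move=> -[x' C] /= [h1 h2]; exact: h1.
by move=> /filter_ex[C [C0 h]]; exists C.
Qed.

(** Finite dimension in the form needed to control all directional derivatives by finitely many; it
    covers both space and space-time. *)
Definition finite_frame (R : realType) (V : normedModType R) :=
  exists (I : finType) (e : I -> V) (c : V -> I -> R),
    (forall v, v = \sum_i c v i *: e i) /\ (forall v i, `|c v i| <= `|v|).

Lemma finite_frame_vec (R : realType) : finite_frame (vec R).
Proof.
exists 'I_3, (delta_mx 0), (fun (v : vec R) i => v 0 i); split; first exact: row_sum_delta.
exact: coord_le_norm.
Qed.

Lemma finite_frame_spacetime (R : realType) :
  finite_frame (vec R * R)%type.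
Proof.
pose e (i : 'I_3 + 'I_1) : vec R * R :=
  if i is inl k then (delta_mx 0 k, 0) else (0, 1).
pose c (v : vec R * R) (i : 'I_3 + 'I_1) := if i is inl k then v.1 0 k else v.2.
exists ('I_3 + 'I_1)%type, e, c; split=> [[v t]|v [k|k]].
- rewrite big_sumType big_ord1 /=; apply/pair_equal_spec; split.
    by rewrite [v in LHS]row_sum_delta (raddf_sum fst) /= scaler0 addr0.
  rewrite (raddf_sum snd) /= big1 ?add0r; first by rewrite [RHS]mulr1.
  by move=> i _; exact: mulr0.
- by rewrite prod_normE le_max coord_le_norm.
- by rewrite prod_normE le_max lexx orbT.
Qed.

Section Calculus.
Variables (R : realType) (V : normedModType R).
Hypothesis frameV : finite_frame V.
Implicit Types (f : V -> R) (x y z v : V) (K : set V).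

Lemma line_is_derive f y v : (forall x, differentiable f x) -> forall s : R,
  is_derive s 1 (fun r => f (y + r *: v)) ('D_v f (y + s *: v)).
Proof.
move=> df s.
have e : (fun h : R => h^-1 *: (((fun r => f (y + r *: v)) \o shift s) (h *: (1 : R)) -
    f (y + s *: v))) = (fun h => h^-1 *: ((f \o shift (y + s *: v)) (h *: v) - f (y + s *: v))).
  apply/funext => h /=; congr (_ *: (f _ - _)).
  by rewrite [_ *: 1]mulr1 scalerDl addrCA.
apply: DeriveDef; last by rewrite /derive e.
by rewrite /derivable e; exact: diff_derivable.
Qed.

Lemma mean_value f x y : (forall x, differentiable f x) ->
  exists2 s : R, 0 <= s <= 1 & f x - f y = 'D_(x - y) f (y + s *: (x - y)).
Proof.
move=> df; have h := line_is_derive y (x - y) df.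
have [|s] := MVT_segment (f := fun r => f (y + r *: (x - y))) ler01 (fun s _ => h s).
  apply: continuous_subspaceT => s; apply: differentiable_continuous.
  by apply/derivable1_diffP; have [] := h s.
rewrite in_itv /= => s01; rewrite scale1r scale0r addr0 (addrC y (x - y)) subrK subr0 mulr1 => e.
by exists s.
Qed.

Lemma segment_ball x y z (r s : R) : 0 <= s <= 1 ->
  `|x - z| < r -> `|y - z| < r -> `|y + s *: (x - y) - z| < r.
Proof.
move=> /andP[s0 s1] hx hy.
have -> : y + s *: (x - y) - z = (1 - s) *: (y - z) + s *: (x - z).
  rewrite scalerBl scale1r -[RHS]addrA (addrC (- _)) -scalerBr.
  by rewrite opprB addrA subrK addrAC.
apply: le_lt_trans (ler_normD _ _) _.
rewrite !normrZ !ger0_norm ?subr_ge0 //.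
have [->|sn0] := eqVneq s 0; first by rewrite subr0 mul1r mul0r addr0.
have sgt : 0 < s by rewrite lt_neqAle eq_sym sn0.
rewrite (_ : r = (1 - s) * r + s * r); last by rewrite -mulrDl subrK mul1r.
by apply: ler_ltD; rewrite ?ler_wpM2l ?ltr_pM2l ?subr_ge0 // ltW.
Qed.

Lemma derive_frame_le f (I : finType) (e : I -> V) (c : V -> I -> R) x v :
  (forall v, v = \sum_i c v i *: e i) -> (forall v i, `|c v i| <= `|v|) ->
  differentiable f x -> 'D_v f x = \sum_i c v i * 'D_(e i) f x.
Proof.
move=> ec cle df; rewrite deriveE // {1}(ec v) linear_sum.
by apply: eq_bigr => i _; rewrite linearZ /= deriveE.
Qed.

(** [Ck] asserts continuity of each directional derivative separately. Bounds in the finitely many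
    frame directions, combined linearly, give one bound for all v. *)
Lemma C1_local_bound f x0 : Ck 1 f ->
  exists2 C, 0 <= C & \forall x \near x0, forall v, `|'D_v f x| <= C * `|v|.
Proof.
move=> [df cf]; have [I [e [c [ec cle]]]] := frameV.
exists (\sum_i (`|'D_(e i) f x0| + 1)).
  by apply: sumr_ge0 => i _; rewrite addr_ge0.
have : \forall x \near x0, forall i, `|'D_(e i) f x| <= `|'D_(e i) f x0| + 1.
  apply: filter_forall => i.
  have /cvgr_norm_le : 'D_(e i) f x @[x --> x0] --> 'D_(e i) f x0 by exact: cf.
  by apply; rewrite ltrDl.
apply: filterS => x hx v; rewrite (derive_frame_le v ec cle (df x)).
apply: le_trans (ler_norm_sum _ _ _) _; rewrite mulr_suml.
by apply: ler_sum => i _; rewrite normrM mulrC ler_pM.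
Qed.

Lemma C1_local_lipschitz f x0 : Ck 1 f -> exists2 C, 0 <= C &
  \forall r \near 0^'+, forall x y, `|x - x0| < r -> `|y - x0| < r ->
    `|f x - f y| <= C * `|x - y|.
Proof.
move=> Cf; have [C C0 /nbhs_ballP[r /= r0 hr]] := C1_local_bound x0 Cf.
exists C => //; near=> r' => x y hx hy; have [s s01 ->] := mean_value x y Cf.1.
apply: hr; rewrite -ball_normE /= distrC; apply: (@lt_trans _ _ r').
  exact: segment_ball.
by near: r'; exact: nbhs_right_lt.
Unshelve. all: by end_near. Qed.

Lemma compact_bounded f K : compact K -> continuous f ->
  exists2 C, 0 < C & forall x, K x -> `|f x| <= C.
Proof.
move=> cK cf; apply: (@compact_uniform_constant R) => // x Kx.
exists (`|f x| + 1).
have /cvgr_norm_le /(_ (`|f x| + 1)) : f y @[y --> x] --> f x by exact: cf.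
by rewrite ltrDl ltr01 => /(_ isT); apply: filterS => y h C /(le_trans h).
Qed.

(** K need not be convex, so the mean value theorem is applied only inside a small ball around a
    point of K. For x near its centre and y outside the ball, |x - y| is at least r/2 and the bound
    on |f| suffices. *)
Lemma C1_lipschitz f K : compact K -> Ck 1 f ->
  exists2 C, 0 < C & forall x y, K x -> K y -> `|f x - f y| <= C * `|x - y|.
Proof.
move=> cK Cf; have cf : continuous f by move=> x; exact/differentiable_continuous/Cf.1.
have [M M0 fM] := compact_bounded cK cf.
suff [C C0 h] : exists2 C, 0 < C &
    forall x, K x -> (K x -> forall y, K y -> `|f x - f y| <= C * `|x - y|).
  by exists C => // x y Kx; exact: h.
apply: (@compact_uniform_constant R) => // x0 Kx0.
have [C C0 near_r] := C1_local_lipschitz x0 Cf.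
have [r [r0 hr]] := filter_ex (filterI (nbhs_right_gt 0) near_r).
exists (C + (M + M) / (r / 2)).
have : ball x0 (r / 2) `<=` [set x | forall C', C + (M + M) / (r / 2) <= C' ->
    K x -> forall y, K y -> `|f x - f y| <= C' * `|x - y|]; last first.
  by move=> h; apply: filterS h _; apply: nbhsx_ballx; rewrite divr_gt0.
rewrite -ball_normE; move=> x xr C' leC' Kx y Ky.
have MC : 0 <= (M + M) / (r / 2) by rewrite !divr_ge0 ?addr_ge0 // ltW.
have [yr|yr] := ltP `|x0 - y| r.
  have xr' : `|x - x0| < r.
    by rewrite distrC; apply: lt_trans (xr : `|x0 - x| < _) _; rewrite ltr_pdivrMr // ltr_pMr // ltr1n.
  rewrite distrC in yr; apply: le_trans (hr x y xr' yr) _.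
  by rewrite ler_wpM2r //; apply: le_trans leC'; rewrite lerDl.
apply: (@le_trans _ _ (M + M)).
  by apply: le_trans (ler_normB _ _) _; rewrite lerD ?fM.
apply: (@le_trans _ _ ((M + M) / (r / 2) * `|x - y|)).
  have MM : 0 <= M + M by rewrite addr_ge0 // ltW.
  rewrite -mulrA; apply: ler_peMr => //; rewrite mulrC ler_pdivlMr ?divr_gt0 // mul1r.
  move: xr => /= xr.
  have := ler_distD x x0 y; lra.
by rewrite ler_wpM2r //; apply: le_trans leC'; rewrite lerDr.
Qed.

(** The derivative is taken at a third point z and the factor |x - y| is kept, so that one linear
    map approximates all secants near z. Close to z this is the mean value theorem with a Lipschitz
    bound for the derivative; for distant points the Lipschitz constant of f and the bound of the
    derivative at z are enough. *)
Lemma C2_taylor f K : compact K -> Ck 2 f ->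
  exists2 C, 0 < C & forall x y z, K x -> K y -> K z ->
    `|f x - f y - 'D_(x - y) f z| <= C * `|x - y| * (`|x - z| + `|y - z|).
Proof.
move=> cK Cf; have C1f : Ck 1 f.
  by split; [exact: Cf.1 | move=> v x; exact/differentiable_continuous/(Cf.2 v).1].
have [L L0 lipf] := C1_lipschitz cK C1f.
suff [C C0 h] : exists2 C, 0 < C & forall z, K z -> (forall x y, K x -> K y ->
    `|f x - f y - 'D_(x - y) f z| <= C * `|x - y| * (`|x - z| + `|y - z|)).
  by exists C => // x y z Kx Ky Kz; exact: h.
apply: (@compact_uniform_constant R) => // z0 Kz0.
have [B B0 hB] := C1_local_bound z0 C1f.
have [C C0 hC] : exists2 C, 0 <= C & \forall r \near 0^'+, forall x y,
    `|x - z0| < r -> `|y - z0| < r ->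
    forall v, `|'D_v f x - 'D_v f y| <= C * `|v| * `|x - y|.
  have [I [e [c [ec cle]]]] := frameV.
  have /choice[Ci hCi] : forall i, exists C, 0 <= C /\ \forall r \near 0^'+,
      forall x y, `|x - z0| < r -> `|y - z0| < r ->
      `|'D_(e i) f x - 'D_(e i) f y| <= C * `|x - y|.
    by move=> i; have [C C0 h] := C1_local_lipschitz z0 (Cf.2 (e i)); exists C.
  exists (\sum_i Ci i); first by apply: sumr_ge0 => i _; case: (hCi i).
  have : \forall r \near 0^'+, forall i,
      forall x y, `|x - z0| < r -> `|y - z0| < r ->
      `|'D_(e i) f x - 'D_(e i) f y| <= Ci i * `|x - y|.
    by apply: filter_forall => i; case: (hCi i).
  apply: filterS => r hr x y xr yr v.
  rewrite !(derive_frame_le v ec cle (C1f.1 _)) -sumrB.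
  apply: le_trans (ler_norm_sum _ _ _) _; rewrite !mulr_suml.
  apply: ler_sum => i _; rewrite -mulrBr normrM mulrAC [leRHS]mulrC.
  by rewrite ler_pM ?hr.
have [r [r0 hr]] := filter_ex (filterI (nbhs_right_gt 0) hC).
exists (C + (L + B) / (r / 2)).
have nball : \forall z \near z0, ball z0 (r / 2) z.
  by apply: nbhsx_ballx; rewrite divr_gt0.
apply: filterS2 nball hB => z zr hBz C' leC' x y Kx Ky.
have LB : 0 <= (L + B) / (r / 2) by rewrite !divr_ge0 ?addr_ge0 // ltW.
have zr' : ball z0 r z.
  by apply: le_ball zr; rewrite ler_pdivrMr // ler_peMr ?ltW // ltr1n.
move: zr; rewrite -ball_normE /= => zr.
have [/andP[xr yr]|far] := boolP ((`|x - z0| < r) && (`|y - z0| < r)).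
  have [s s01 ->] := mean_value x y Cf.1.
  apply: (@le_trans _ _ (C * `|x - y| * `|y + s *: (x - y) - z|)).
    apply: hr; first exact: segment_ball.
    by move: zr'; rewrite -ball_normE /= distrC.
  apply: ler_pM => //; first by rewrite mulr_ge0.
    by rewrite ler_wpM2r //; apply: le_trans leC'; rewrite lerDl.
  have -> : y + s *: (x - y) - z = (1 - s) *: (y - z) + s *: (x - z).
    rewrite scalerBl scale1r -[RHS]addrA (addrC (- _)) -scalerBr.
    by rewrite opprB addrA subrK addrAC.
  apply: le_trans (ler_normD _ _) _; case/andP: s01 => s0 s1.
  rewrite !normrZ !ger0_norm ?subr_ge0 // addrC.
  by apply: lerD; rewrite ler_piMl // gerBl.
apply: (@le_trans _ _ ((L + B) * `|x - y|)).
  by apply: le_trans (ler_normB _ _) _; rewrite mulrDl lerD ?lipf.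
have rle : r / 2 <= `|x - z| + `|y - z|.
  move: far; rewrite negb_and -!leNgt => /orP[far|far].
    by have := ler_distD z x z0; rewrite (distrC z z0); have := normr_ge0 (y - z); lra.
  by have := ler_distD z y z0; rewrite (distrC z z0); have := normr_ge0 (x - z); lra.
apply: (@le_trans _ _ ((L + B) / (r / 2) * `|x - y| * (`|x - z| + `|y - z|))).
  have LB0 : 0 <= (L + B) * `|x - y| by rewrite mulr_ge0 // addr_ge0 // ltW.
  rewrite [(L + B) / _ * _]mulrAC -[leRHS]mulrA; apply: ler_peMr; first by [].
  by rewrite mulrC ler_pdivlMr ?divr_gt0 // mul1r.
rewrite ler_wpM2r ?addr_ge0 // ler_wpM2r //.
by apply: le_trans leC'; rewrite lerDr.
Qed.

End Calculus.

Lemma Ck_coord (R : realType) (V : normedModType R) k (g : V -> vec R) (i : 'I_3) :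
  Ck k g -> Ck k (fun z => g z 0 i : R).
Proof.
elim: k g => [|k IH] g /=.
  move=> cg x; exact: (continuous_comp (cg x) (@coord_continuous _ _ _ 0 i (g x))).
move=> [dg Cg]; split=> [x|v].
  exact: (differentiable_comp (dg x) (differentiable_coord (g x) 0 i)).
rewrite (_ : (fun _ => _) = (fun x => ('D_v g x) 0 i)); first exact: IH.
by apply/funext => x; rewrite derive_mx ?mxE //; exact: diff_derivable.
Qed.

Lemma derive_coord (R : realType) (V : normedModType R) (g : V -> vec R) (i : 'I_3) x v :
  differentiable g x -> 'D_v (fun z => g z 0 i : R) x = ('D_v g x) 0 i.
Proof. by move=> dg; rewrite derive_mx ?mxE //; exact: diff_derivable. Qed.

Lemma enorm_le_coord (R : realType) (w : vec R) (a : R) : 0 <= a ->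
  (forall i, `|w 0 i| <= a) -> enorm w <= 2 * a.
Proof.
move=> a0 h; apply: le_trans (enorm_le_norm w) _; rewrite ler_wpM2l //.
rewrite (_ : `|w| = mx_norm w) // mx_normrE; apply: bigmax_le => // -[i j] _ /=.
by rewrite (ord1 i).
Qed.

Lemma pos_le_sum (R : realType) (C : 'I_3 -> R) : (forall i, 0 < C i) ->
  0 < \sum_i C i /\ forall i, C i <= \sum_j C j.
Proof.
move=> C0; have h i : C i <= \sum_j C j.
  by rewrite (bigD1 i) //= lerDl sumr_ge0 // => j _; exact: ltW.
by split=> //; exact: lt_le_trans (C0 0) (h 0).
Qed.

Section VectorValued.
Variables (R : realType) (V : normedModType R).
Hypothesis frameV : finite_frame V.
Implicit Types (g : V -> vec R) (K : set V).

Lemma C1_vec_lipschitz g K : compact K -> Ck 1 g ->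
  exists2 C, 0 < C & forall x y, K x -> K y -> enorm (g x - g y) <= C * `|x - y|.
Proof.
move=> cK Cg.
have /choice[C hC] : forall i : 'I_3, exists C, 0 < C /\
    forall x y, K x -> K y -> `|g x 0 i - g y 0 i| <= C * `|x - y|.
  by move=> i; have [C C0 h] := C1_lipschitz frameV cK (Ck_coord i Cg); exists C.
have [S0 leS] := pos_le_sum (fun i => (hC i).1).
exists (2 * \sum_i C i); first by rewrite mulr_gt0.
move=> x y Kx Ky; rewrite -mulrA; apply: enorm_le_coord.
  by rewrite mulr_ge0 // ltW.
move=> i; rewrite !mxE; apply: le_trans ((hC i).2 x y Kx Ky) _.
by rewrite ler_wpM2r.
Qed.

Lemma C2_vec_taylor g K : compact K -> Ck 2 g ->
  exists2 C, 0 < C & forall x y z, K x -> K y -> K z ->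
    enorm (g x - g y - 'D_(x - y) g z) <= C * `|x - y| * (`|x - z| + `|y - z|).
Proof.
move=> cK Cg.
have /choice[C hC] : forall i : 'I_3, exists C, 0 < C /\
    forall x y z, K x -> K y -> K z -> `|g x 0 i - g y 0 i - ('D_(x - y) g z) 0 i|
      <= C * `|x - y| * (`|x - z| + `|y - z|).
  move=> i; have [C C0 h] := C2_taylor frameV cK (Ck_coord i Cg); exists C; split=> // x y z.
  by rewrite -derive_coord; [exact: h | exact: Cg.1].
have [S0 leS] := pos_le_sum (fun i => (hC i).1).
exists (2 * \sum_i C i); first by rewrite mulr_gt0.
move=> x y z Kx Ky Kz; rewrite -!mulrA; apply: enorm_le_coord.
  by rewrite !mulr_ge0 ?addr_ge0 // ltW.
move=> i; have -> : (g x - g y - 'D_(x - y) g z) 0 i =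
    g x 0 i - g y 0 i - ('D_(x - y) g z) 0 i by rewrite !mxE.
apply: le_trans ((hC i).2 x y z Kx Ky Kz) _; rewrite -mulrA.
by rewrite ler_wpM2r ?mulr_ge0 ?addr_ge0.
Qed.

Lemma C2_vec_derive_lipschitz g K v : compact K -> Ck 2 g ->
  exists2 C, 0 < C & forall x y, K x -> K y ->
    enorm ('D_v g x - 'D_v g y) <= C * `|x - y|.
Proof. by move=> cK Cg; apply: C1_vec_lipschitz => //; exact: Cg.2. Qed.

End VectorValued.

Lemma is_derive_curve (R : realType) (V W : normedModType R) (F : V -> W)
    (c : R -> V) (w : V) : differentiable F (c 0) -> is_derive (0 : R) 1 c w ->
  is_derive (0 : R) 1 (F \o c) ('D_w F (c 0)).
Proof.
move=> dF dc; have cd : differentiable c 0 by apply/derivable1_diffP; case: dc.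
have d : differentiable (F \o c) 0 by exact: differentiable_comp.
apply: DeriveDef; first exact: diff_derivable.
rewrite deriveE // diff_comp //= deriveE //; congr ('d F _ _).
by rewrite -deriveE //; case: dc.
Qed.

Lemma is_derive_slice (R : realType) (V : normedModType R)
    (c : R -> V) (w : V) (s : R) : is_derive (0 : R) 1 c w ->
  is_derive (0 : R) 1 (fun r => (c r, s)) (w, 0).
Proof.
move=> dc; have cd : differentiable c 0 by apply/derivable1_diffP; case: dc.
have d : differentiable (fun r => (c r, s)) (0 : R) by exact: differentiable_pair.
apply: DeriveDef; first exact: diff_derivable.
rewrite deriveE // diff_pair //; congr pair; last by rewrite diff_cst.
by rewrite -deriveE //; case: dc.
Qed.

Lemma compact_box (R : realType) (z : vec R) :
  compact [set v : vec R | forall i, `[z 0 i - 1, z 0 i + 1]%classic (v 0 i)].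
Proof.
exact: (@rV_compact R 3 (fun i => `[z 0 i - 1, z 0 i + 1]%classic)
  (fun i => @segment_compact _ _ _)).
Qed.

Lemma derive_grad (R : realType) (F : vec R -> R) z v :
  differentiable F z -> 'D_v F z = dot v (grad F z).
Proof.
move=> dF; rewrite deriveE // {1}(row_sum_delta v) linear_sum /dot.
by apply: eq_bigr => i _; rewrite linearZ /= mxE -deriveE.
Qed.

(* The intermediate value theorem in the normal direction corrects the straight
   line z + s w to a curve in the level set. *)
Lemma level_set_tangent (R : realType) (F : vec R -> R) (G U : set (vec R)) z w :
  open U -> U z -> Ck 2 F -> grad F z != 0 ->
  (forall y, U y -> (G y <-> F y = 0)) -> G z ->
  dot w (grad F z) = 0 -> tangent_vector G z w.
Proof.
move=> oU Uz CF; set n := grad F z => n0 GF Gz wn.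
have Fz : F z = 0 by apply/GF.
have [C C0 hC] := C2_taylor (@finite_frame_vec R) (@compact_box R z) CF.
pose q := dot n n; have q0 : 0 < q by rewrite lt_neqAle eq_sym dot_eq0 n0 dot_ge0.
(* For |r| = k s^2 the linear term r q dominates the Taylor error C |s w + r n|^2, so F changes sign
   between the two ends. The bound m^-1 on |s| keeps the points in the box and the correction r n
   below |s|. *)
pose k := 2 * C * (`|w| + 1) ^+ 2 / q.
have k0 : 0 < k.
  by rewrite divr_gt0 // mulr_gt0 ?mulr_gt0 // exprn_gt0 // ltr_pwDr.
pose m := Num.max (k * `|n|) (`|w| + 1).
have m0 : 0 < m by rewrite lt_max [X in _ || X]ltr_pwDr ?orbT.
have root s : exists r, `|s| <= m^-1 -> `|r| <= k * s ^+ 2 /\ F (z + s *: w + r *: n) = 0.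
  have [sm|_] := leP `|s| m^-1; last by exists 0.
  have sm1 : `|s| * m <= 1 by rewrite -ler_pdivlMr // mul1r.
  have sw : `|s| * (`|w| + 1) <= 1.
    by apply: le_trans sm1; rewrite ler_wpM2l // le_max lexx orbT.
  have sn : `|s| * (k * `|n|) <= 1.
    by apply: le_trans sm1; rewrite ler_wpM2l // le_max lexx.
  pose b := k * s ^+ 2; have b0 : 0 <= b by rewrite mulr_ge0 ?sqr_ge0 // ltW.
  have est r : `|r| = b -> `|F (z + s *: w + r *: n) - r * q| <= b * q.
    move=> rb; pose v := s *: w + r *: n.
    have vs : `|v| <= `|s| * (`|w| + 1).
      apply: le_trans (ler_normD _ _) _; rewrite !normrZ mulrDr lerD2l mulr1 rb /b.
      rewrite (_ : k * s ^+ 2 * `|n| = `|s| * (`|s| * (k * `|n|))); first by rewrite ler_piMr.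
      by rewrite -[s ^+ 2]real_normK ?num_real //; ring.
    have v1 := le_trans vs sw.
    have Kz : [set v0 : vec R | forall i, `[z 0 i - 1, z 0 i + 1]%classic (v0 0 i)] z.
      by move=> i /=; rewrite in_itv /= gerBl lerDl ler01.
    have Kv : [set v0 : vec R | forall i, `[z 0 i - 1, z 0 i + 1]%classic (v0 0 i)] (z + v).
      move=> i /=; rewrite in_itv /= mxE.
      have := le_trans (coord_le_norm v i) v1; rewrite ler_norml => /andP[h1 h2].
      by rewrite lerD2l h1 lerD2l h2.
    have := hC (z + v) z z Kv Kz Kz.
    rewrite Fz subr0 [z + v - z]addrC addKr subrr normr0 addr0.
    rewrite (derive_grad v (CF.1 z)) -/n [dot v n]dotDl !dotZl wn mulr0 add0r -/q addrA => h.
    apply: le_trans h _.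
    have -> : b * q = 2 * C * (`|s| * (`|w| + 1)) ^+ 2.
      rewrite /b /k exprMn real_normK ?num_real //.
      by field; rewrite gt_eqF.
    rewrite -mulrA -expr2.
    have : `|v| ^+ 2 <= (`|s| * (`|w| + 1)) ^+ 2.
      by rewrite ler_sqr ?nnegrE // mulr_ge0 // addr_ge0.
    have := sqr_ge0 (`|s| * (`|w| + 1)).
    by move: (`|v| ^+ 2) ((`|s| * _) ^+ 2) => A B B0 AB; nra.
  have [|||r] := @IVT _ (fun r => F (z + s *: w + r *: n)) (- b) b 0.
  - by lra.
  - apply: continuous_subspaceT => r; apply: differentiable_continuous.
    apply/derivable1_diffP.
    by have [] := line_is_derive (z + s *: w) n CF.1 r.
  - have e1 := est b (ger0_norm b0).
    have e2 := est (- b); rewrite normrN (ger0_norm b0) in e2; have {}e2 := e2 erefl.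
    move: e1 e2; rewrite !ler_norml mulNr => /andP[h1 _] /andP[_ h2].
    rewrite ge_min le_max; apply/andP; split; apply/orP; [left|right]; lra.
  - by rewrite in_itv /= -ler_norml => h1 h2; exists r.
have [r hr] := choice root.
have m'0 : 0 < m^-1 by rewrite invr_gt0.
have r00 : r 0 = 0.
  have [|h _] := hr 0; first by rewrite normr0 ltW.
  by apply/eqP; rewrite -normr_le0; apply: le_trans h _; rewrite expr0n mulr0.
pose c s := z + s *: w + r s *: n.
have cs0 : c 0 = z by rewrite /c r00 !scale0r !addr0.
have dc : is_derive (0 : R) 1 c w.
  have lim : (fun h : R => h^-1 *: ((c \o shift 0) (h *: (1 : R)) - c 0)) @ 0^' --> w.
    apply/cvgrPdist_le => e e0; near=> h.
    have h0 : h != 0 by near: h; exact: nbhs_dnbhs_neq.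
    have hm : `|h| <= m^-1 by near: h; exact: dnbhs0_le.
    have -> : w - h^-1 *: ((c \o shift 0) (h *: (1 : R)) - c 0) = - (h^-1 * r h) *: n.
      rewrite /= addr0 [h *: 1]mulr1 cs0 /c -[z + _ + _]addrA [z + _]addrC addrK.
      by rewrite scalerDr !scalerA mulVf // scale1r opprD addrA subrr sub0r scaleNr.
    have [rh _] := hr h hm.
    rewrite normrZ normrN normrM normfV.
    apply: (@le_trans _ _ (k * `|h| * `|n|)).
      rewrite ler_wpM2r // mulrC ler_pdivrMr ?normr_gt0 //.
      by rewrite -mulrA -expr2 real_normK ?num_real.
    rewrite mulrAC mulrC -ler_pdivlMr; last by rewrite mulr_gt0 ?normr_gt0.
    near: h; apply: dnbhs0_le; rewrite divr_gt0 // mulr_gt0 // normr_gt0 //.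
  by apply: DeriveDef; [apply/cvg_ex; exists w | exact/cvg_lim].
exists c; split=> //.
have cc : {for 0, continuous c}.
  by apply/differentiable_continuous/derivable1_diffP; case: dc.
have nU : \forall s \near (0 : R), U (c s).
  by apply: cc; rewrite cs0; exact: open_nbhs_nbhs.
near=> s.
have Us : U (c s) by near: s.
have sm : `|s| <= m^-1.
  near: s; exists m^-1 => //= y; rewrite /ball_ /= sub0r normrN; exact: ltW.
by apply/GF => //; case: (hr s sm).
Unshelve. all: by end_near. Qed.

(** * Geometry of the evolving surface *)

Section Surface.
Variables (R : realType) (S : evolving_surface R).
Local Notation T := (Tend S).
Implicit Types (X Y Z x y z w : vec R) (t s : R).

Let cyl : set (vec R * R) := [set z | Gamma0 S z.1 /\ 0 <= z.2 <= T].

Lemma cylinder_compact : compact cyl.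
Proof.
rewrite (_ : cyl = Gamma0 S `*` `[0, T]%classic); last first.
  by apply/seteqP; split=> -[x t] /=; rewrite in_itv.
by apply: compact_setX; [exact: Gamma0_compact | exact: segment_compact].
Qed.

Lemma flow_extension : exists2 F : vec R * R -> vec R, smooth F &
  forall X t, Gamma0 S X -> 0 <= t <= T -> flow S X t = F (X, t).
Proof.
have [F sF FE] := flow_smooth S; exists F => // X t GX tT.
by apply: (FE (X, t)); rewrite inE.
Qed.

Lemma norm_spacetime X Y t s :
  `|(X, t) - (Y, s)| <= enorm (X - Y) + `|t - s|.
Proof.
rewrite prod_normE ge_max /=; apply/andP; split.
  by apply: le_trans (norm_le_enorm _) _; rewrite lerDl.
by rewrite lerDr enorm_ge0.
Qed.

Lemma flow_lipschitz : exists2 C, 0 < C & forall X Y t s,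
  Gamma0 S X -> Gamma0 S Y -> 0 <= t <= T -> 0 <= s <= T ->
  enorm (flow S X t - flow S Y s) <= C * (enorm (X - Y) + `|t - s|).
Proof.
have [F sF FE] := flow_extension.
have [C C0 hC] := C1_vec_lipschitz (@finite_frame_spacetime R) cylinder_compact (sF 1%N).
exists C => // X Y t s GX GY tT sT; rewrite !FE //.
apply: le_trans (hC _ _ _ _) _; rewrite // ler_pM2l //.
exact: norm_spacetime.
Qed.

Lemma flow_in_Gamma X t : Gamma0 S X -> Gamma S t (flow S X t).
Proof. by move=> GX; exists X. Qed.

Lemma Gamma_compact t : 0 <= t <= T -> compact (Gamma S t).
Proof.
move=> tT; have [F sF FE] := flow_extension.
rewrite (_ : Gamma S t = (fun X => F (X, t)) @` Gamma0 S); last first.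
  by apply/seteqP; split=> x [X GX <-]; exists X => //; rewrite FE.
apply: continuous_compact; last exact: Gamma0_compact.
apply: continuous_subspaceT => X.
apply: (@continuous_comp _ _ _ (fun X => (X, t)) F).
  by apply/differentiable_continuous; exact: differentiable_pair.
exact: (sF 0%N).
Qed.

Lemma flow_inverse_lipschitz t : 0 <= t <= T -> exists2 L, 0 < L &
  forall X Y, Gamma0 S X -> Gamma0 S Y ->
    enorm (X - Y) <= L * enorm (flow S X t - flow S Y t).
Proof.
move=> tT; have [g [G sG gG] gK] := flow_diffeo tT.
have [L L0 hL] := C1_vec_lipschitz (@finite_frame_vec R) (Gamma_compact tT) (sG 1%N).
have GK X : Gamma0 S X -> G (flow S X t) = X.
  by move=> GX; rewrite -gG ?gK // inE; exact: flow_in_Gamma.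
exists L => // X Y GX GY; rewrite -{1}(GK X) // -{1}(GK Y) //.
apply: le_trans (hL _ _ (flow_in_Gamma t GX) (flow_in_Gamma t GY)) _.
by rewrite ler_pM2l // norm_le_enorm.
Qed.

(** [flow_diffeo] gives an inverse for each t with no uniformity in t. For t near t0 the difference
    of two trajectories changes from its value at t0 by at most |X - Y| / (2 L), L being the inverse
    constant at t0, so the constant 2 L persists; compactness of [0, T] finishes. *)
Lemma flow_expansive : exists2 C, 0 < C & forall X Y t,
  Gamma0 S X -> Gamma0 S Y -> 0 <= t <= T ->
  enorm (X - Y) <= C * enorm (flow S X t - flow S Y t).
Proof.
have [F sF FE] := flow_extension.
have [C C0 hC] := C2_vec_taylor (@finite_frame_spacetime R) cylinder_compact (sF 2%N).
have [B B0 hB] := flow_lipschitz.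
suff [K K0 hK] : exists2 K, 0 < K & forall t, `[0, T]%classic t -> (0 <= t <= T ->
    forall X Y, Gamma0 S X -> Gamma0 S Y ->
    enorm (X - Y) <= K * enorm (flow S X t - flow S Y t)).
  by exists K => // X Y t GX GY tT; apply: hK => //=; rewrite in_itv.
apply: (@compact_uniform_constant R); first exact: segment_compact.
move=> t0; rewrite /= in_itv /= => t0T.
have [L L0 hL] := flow_inverse_lipschitz t0T; exists (2 * L).
pose rho := (8 * C * L)^-1.
have rho0 : 0 < rho by rewrite invr_gt0 !mulr_gt0.
have near_t : \forall t \near t0, `|t - t0| < rho /\ `|t - t0| < rho / (4 * L * B).
  have nt (e : R) : 0 < e -> \forall t \near t0, `|t - t0| < e.
    by move=> e0; exists e => //= t; rewrite /ball_ /= distrC.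
  by apply: filterS2 (nt _ rho0) (nt (rho / (4 * L * B)) _) => //; rewrite divr_gt0 // !mulr_gt0.
apply: filterS near_t => t [t1 t2] K leK tT X Y GX GY.
apply: (@le_trans _ _ (2 * L * enorm (flow S X t - flow S Y t))); last first.
  by rewrite ler_wpM2r ?enorm_ge0.
set e := enorm (X - Y); have e0 : 0 <= e := enorm_ge0 _.
set a := flow S X t - flow S Y t; pose a0 := flow S X t0 - flow S Y t0.
have La0 : e <= L * enorm a0 by exact: hL.
suff da : L * enorm (a - a0) <= e / 2.
  have : L * enorm a0 <= L * enorm a + L * enorm (a - a0).
    rewrite -mulrDr ler_pM2l // enormBC.
    by have := enormD a (a0 - a); rewrite addrC subrK.
  lra.
(* Distant points: the motion of both trajectories, at most 2 B |t - t0|, is small compared with rho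
   < |X - Y|. *)
have [erho|erho] := lerP e rho; last first.
  have : enorm (a - a0) <= B * `|t - t0| + B * `|t - t0|.
    have -> : a - a0 = (flow S X t - flow S X t0) - (flow S Y t - flow S Y t0).
      by apply: vec3P; rewrite /a /a0 !mxE; ring.
    apply: le_trans (enormB _ _) _; apply: lerD.
      by have := hB X X t t0 GX GX tT t0T; rewrite subrr enorm0 add0r.
    by have := hB Y Y t t0 GY GY tT t0T; rewrite subrr enorm0 add0r.
  move=> h; have : L * (4 * B * `|t - t0|) <= rho.
    rewrite (_ : _ * _ = `|t - t0| * (4 * L * B)); last by ring.
    by rewrite -ler_pdivlMr ?mulr_gt0 // ltW.
  have := ler_wpM2l (ltW L0) h; lra.
(* Close points: both differences are expanded with the same derivative [D] at (Y, t0), and the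
   errors are |X - Y| times quantities of size rho. *)
have cXt : cyl (X, t) by []. have cYt : cyl (Y, t) by [].
have cXt0 : cyl (X, t0) by []. have cYt0 : cyl (Y, t0) by [].
have h1 := hC _ _ _ cXt cYt cYt0; have h2 := hC _ _ _ cXt0 cYt0 cYt0.
have pe (x y : vec R) (r : R) : (x, r) - (y, r) = (x - y, 0).
  by apply/pair_equal_spec; split; rewrite //= subrr.
rewrite !pe in h1; rewrite !pe subrr normr0 addr0 in h2.
rewrite -!FE // -/a -/a0 in h1 h2.
have n1 : `|(X - Y, 0 : R)| <= e.
  by rewrite -(pe X Y 0); apply: le_trans (norm_spacetime _ _ _ _) _; rewrite subrr normr0 addr0.
have n2 : `|(X, t) - (Y, t0)| <= e + `|t - t0| by exact: norm_spacetime.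
have n3 : `|(Y, t) - (Y, t0)| <= `|t - t0|.
  by apply: le_trans (norm_spacetime _ _ _ _) _; rewrite subrr enorm0 add0r.
set D := 'D_ _ F _ in h1 h2.
have h3 : enorm (a - a0) <= C * e * (e + `|t - t0| + `|t - t0|) + C * e * e.
  apply: (@le_trans _ _ (enorm (a - D) + enorm (a0 - D))).
    by rewrite (enormBC a0); exact: enorm_dist3.
  apply: lerD.
    apply: le_trans h1 _; apply: ler_pM; rewrite ?mulr_ge0 ?addr_ge0 ?(ltW C0) ?ler_pM2l //.
    by rewrite lerD.
  apply: le_trans h2 _; apply: ler_pM; rewrite ?mulr_ge0 ?(ltW C0) ?ler_pM2l //.
apply: (@le_trans _ _ (L * (C * e * (4 * rho)))).
  rewrite ler_pM2l //; apply: le_trans h3 _.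
  rewrite -mulrDr ler_wpM2l ?mulr_ge0 ?(ltW C0) //; lra.
have -> // : L * (C * e * (4 * rho)) = e / 2.
by rewrite /rho; field; rewrite !gt_eqF.
Qed.

End Surface.

Lemma C1_vec_bound (R : realType) (V : normedModType R) (g : V -> vec R) (K : set V) :
  finite_frame V -> compact K -> Ck 1 g -> exists2 C, 0 < C &
  forall z v, K z -> enorm ('D_v g z) <= C * `|v|.
Proof.
move=> frameV cK Cg.
have /choice[C hC] : forall i : 'I_3, exists C, 0 < C /\
    forall z, K z -> forall v, `|('D_v g z) 0 i| <= C * `|v|.
  move=> i; suff [C C0 h] : exists2 C, 0 < C &
      forall z, K z -> forall v, `|('D_v g z) 0 i| <= C * `|v| by exists C.
  apply: (@compact_uniform_constant R) => // z0 Kz0.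
  have [C C0 h] := C1_local_bound frameV z0 (Ck_coord i Cg).
  exists C; apply: filterS h => z hz C' leC v.
  rewrite -derive_coord; last exact: Cg.1.
  by apply: le_trans (hz v) _; rewrite ler_wpM2r.
have [S0 leS] := pos_le_sum (fun i => (hC i).1).
exists (2 * \sum_i C i); first by rewrite mulr_gt0.
move=> z v Kz; rewrite -mulrA; apply: enorm_le_coord.
  by rewrite mulr_ge0 // ltW.
by move=> i; apply: le_trans ((hC i).2 z Kz v) _; rewrite ler_wpM2r.
Qed.

(** * Tangent vectors and normals *)

Section SurfaceNormal.
Variables (R : realType) (S : evolving_surface R).
Local Notation T := (Tend S).
Implicit Types (X Y Z x y z w : vec R) (t s : R).

(* Near a point the defect is taken along the gradient of a defining function;
   far from it the estimate holds trivially, with w = 0. *)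
Lemma tangent_approximation : exists2 C, 0 < C & forall X Y Z,
  Gamma0 S X -> Gamma0 S Y -> Gamma0 S Z ->
  exists w, tangent_vector (Gamma0 S) Z w /\
    enorm (X - Y - w) <= C * enorm (X - Y) * (enorm (X - Z) + enorm (Y - Z)).
Proof.
suff [K K0 hK] : exists2 K, 0 < K & forall Z, Gamma0 S Z -> (Gamma0 S Z ->
    forall X Y, Gamma0 S X -> Gamma0 S Y -> exists w, tangent_vector (Gamma0 S) Z w /\
    enorm (X - Y - w) <= K * enorm (X - Y) * (enorm (X - Z) + enorm (Y - Z))).
  by exists K => // X Y Z GX GY GZ; exact: hK.
apply: (@compact_uniform_constant R); first exact: Gamma0_compact.
move=> Z0 GZ0; have [U [F [oU UZ0 sF gF UF]]] := Gamma0_smooth GZ0.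
have [C C0 hC] := C2_taylor (@finite_frame_vec R) (@Gamma0_compact _ S) (sF 2%N).
have g0 := gF _ UZ0; set n0 := grad F Z0 in g0.
(* One nonzero coordinate of the gradient stays away from 0 near Z0, which bounds the whole gradient
   from below. *)
have [i0 ni0] := rV0Pn _ g0.
have en0 : 0 < `|n0 0 i0| by rewrite normr_gt0.
have [r r0 rU] : exists2 r, 0 < r & forall x, enorm (x - Z0) < r -> U x.
  have /nbhs_ballP[r /= r0 h] := open_nbhs_nbhs (conj oU UZ0).
  exists r => // x hx; apply: h; rewrite -ball_normE /= distrC.
  exact: le_lt_trans (norm_le_enorm _) hx.
have nU : \forall Z \near Z0, U Z by exact: open_nbhs_nbhs.
have nr : \forall Z \near Z0, enorm (Z - Z0) < r / 2.
  apply/nbhs_ballP; exists (r / 4) => /=; first by rewrite divr_gt0.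
  move=> Z; rewrite -ball_normE /= distrC => h.
  by apply: le_lt_trans (enorm_le_norm _) _; lra.
have ng : \forall Z \near Z0, `|n0 0 i0| / 2 < `|'D_(delta_mx 0 i0) F Z|.
  have cD : 'D_(delta_mx 0 i0) F Z @[Z --> Z0] --> 'D_(delta_mx 0 i0) F Z0.
    exact: (sF 1%N).2.
  by apply: cvgr_norm_gt cD _ _; rewrite /n0 mxE in en0 *; lra.
exists (C / (`|n0 0 i0| / 2) + 2 / r); near=> Z => K leK GZ X Y GX GY.
have UZ : U Z by near: Z.
have Zr : enorm (Z - Z0) < r / 2 by near: Z.
have gZ : `|n0 0 i0| / 2 < `|grad F Z|.
  apply: (@lt_le_trans _ _ `|'D_(delta_mx 0 i0) F Z|); first by near: Z.
  by have := coord_le_norm (grad F Z) i0; rewrite mxE.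
have nn0 : 0 < `|n0 0 i0| / 2 by lra.
have K1 : C / (`|n0 0 i0| / 2) <= K by apply: le_trans leK; rewrite lerDl divr_ge0 // ltW.
have K2 : 2 / r <= K by apply: le_trans leK; rewrite lerDr !divr_ge0 // ltW.
set d := enorm (X - Y) * (enorm (X - Z) + enorm (Y - Z)).
have d0 : 0 <= d by rewrite mulr_ge0 ?addr_ge0 ?enorm_ge0.
rewrite -[_ * (_ + _)]mulrA.
have [/andP[Xr Yr]|far] := boolP ((enorm (X - Z0) < r) && (enorm (Y - Z0) < r)); last first.
  exists 0; split.
    exists (cst Z); split=> //; first by near=> x.
    exact: is_derive_cst.
  rewrite subr0 -/d.
  have h : r / 2 <= enorm (X - Z) + enorm (Y - Z).
    move: far; rewrite negb_and -!leNgt => /orP[far|far].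
      by have := enorm_dist3 X Z Z0; have := enorm_ge0 (Y - Z); lra.
    by have := enorm_dist3 Y Z Z0; have := enorm_ge0 (X - Z); lra.
  apply: (@le_trans _ _ (2 / r * d)); last by rewrite ler_wpM2r.
  rewrite /d mulrCA ler_peMr ?enorm_ge0 // mulrAC ler_pdivlMr // mul1r mulrC.
  by rewrite -ler_pdivrMr.
pose n := grad F Z; pose q := dot n n.
have n_neq0 : n != 0 by rewrite -normr_gt0; exact: lt_trans gZ.
have q0 : 0 < q by rewrite lt_neqAle eq_sym dot_eq0 n_neq0 dot_ge0.
(* F vanishes at X and at Y, so the product of X - Y with the gradient is a Taylor remainder. *)
exists (X - Y - (dot (X - Y) n / q) *: n); split.
  apply: (level_set_tangent oU UZ (sF 2%N) n_neq0 UF GZ).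
  by rewrite -/n [LHS]dotBl dotZl -/q divfK ?subrr // gt_eqF.
have -> : X - Y - (X - Y - (dot (X - Y) n / q) *: n) = (dot (X - Y) n / q) *: n.
  by rewrite opprB addrC subrK.
have FX : F X = 0 by apply/UF => //; exact: rU.
have FY : F Y = 0 by apply/UF => //; exact: rU.
have := hC X Y Z GX GY GZ.
rewrite FX FY subrr sub0r normrN (derive_grad (X - Y) ((sF 2%N).1 Z)) -/n => h.
have en : `|n0 0 i0| / 2 < enorm n := lt_le_trans gZ (norm_le_enorm _).
have en_gt0 : 0 < enorm n := lt_trans nn0 en.
rewrite enormZ normrM normfV (gtr0_norm q0) -[q]enorm2 expr2 invfM.
rewrite !mulrA divfK ?gt_eqF // ler_pdivrMr //.
apply: le_trans h _; rewrite -/d.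
apply: (@le_trans _ _ (C * d)).
  rewrite -mulrA ler_pM2l //; apply: ler_pM; rewrite ?addr_ge0 ?norm_le_enorm //.
  by rewrite lerD // norm_le_enorm.
rewrite [leRHS](_ : _ = K * enorm n * d); last by rewrite /d; ring.
rewrite ler_wpM2r //.
apply: (@le_trans _ _ (K * (`|n0 0 i0| / 2))); first by rewrite -ler_pdivrMr.
rewrite ler_wpM2l ?(ltW en) //; apply: le_trans K1; rewrite divr_ge0 // ltW //.
Unshelve. all: by end_near. Qed.

Lemma derive_sub (V W : normedModType R) (F : V -> W) (z u v : V) :
  differentiable F z -> 'D_(u - v) F z = 'D_u F z - 'D_v F z.
Proof. by move=> dF; rewrite !deriveE // linearB. Qed.

Lemma tangent_push F Z w s : smooth F ->
  (forall X t, Gamma0 S X -> 0 <= t <= T -> flow S X t = F (X, t)) ->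
  Gamma0 S Z -> 0 <= s <= T -> tangent_vector (Gamma0 S) Z w ->
  tangent_vector (Gamma S s) (flow S Z s) ('D_(w, 0) F (Z, s)).
Proof.
move=> sF FE GZ sT [c [c0 Gc dc]].
exists (F \o (fun r => (c r, s))); split.
- by rewrite /= c0 FE.
- by apply: filterS Gc => r Gr; exists (c r) => //; rewrite FE.
- have := is_derive_slice s dc; set k := (fun r => _) => dk.
  have kE : (Z, s) = k 0 by rewrite /k c0.
  by rewrite kE; apply: is_derive_curve dk; rewrite -kE; exact: (sF 1%N).1.
Qed.

(** A secant is tangent up to second order. Pulled back to [Gamma0], X - Y is close to a tangent
    vector w at Z; the derivative of the flow at (Z, s) maps w to a vector orthogonal to the normal,
    and X - Y to x - y up to a Taylor remainder. The times t and s differ because the doubled points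
    live at different times. *)
Lemma normal_estimate : exists2 C, 0 < C & forall t s x y z,
  0 <= t <= T -> 0 <= s <= T -> Gamma S t x -> Gamma S t y -> Gamma S s z ->
  `|dot (normal S z s) (x - y)|
     <= C * enorm (x - y) * (enorm (x - z) + enorm (y - z) + `|t - s|).
Proof.
have [F sF FE] := flow_extension S.
have cyl := @cylinder_compact R S.
have [C1 C10 hC1] := C2_vec_taylor (@finite_frame_spacetime R) cyl (sF 2%N).
have [B B0 hB] := C1_vec_bound (@finite_frame_spacetime R) cyl (sF 1%N).
have [L L0 hL] := flow_lipschitz S.
have [C2 C20 hC2] := tangent_approximation.
have [C3 C30 hC3] := flow_expansive S.
exists ((C1 + B * C2) * C3 * (C3 * (1 + 2 * L) + 2)).
  by rewrite !mulr_gt0 // !addr_gt0 // mulr_gt0 // addr_gt0 // mulr_gt0.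
move=> t s _ _ _ tT sT [X GX <-] [Y GY <-] [Z GZ <-].
set nu := normal S _ s; set e := enorm (X - Y).
set a := flow S X t - flow S Y t.
have [nu1 nuT _] := Defs.normalP sT (flow_in_Gamma s GZ).
rewrite -/nu in nu1 nuT.
have [w [tw hw]] := hC2 X Y Z GX GY GZ.
have nuw := nuT _ (tangent_push sF FE GZ sT tw).
have pe (x y : vec R) (r : R) : (x, r) - (y, r) = (x - y, 0).
  by apply/pair_equal_spec; split; rewrite //= subrr.
have dist0 W : Gamma0 S W -> enorm (W - Z) <=
    C3 * (enorm (flow S W t - flow S Z s) + L * `|t - s|).
  move=> GW; apply: le_trans (hC3 W Z s GW GZ sT) _; rewrite ler_pM2l //.
  apply: le_trans (enorm_dist3 _ (flow S W t) _) _; rewrite addrC lerD2l.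
  have := hL W W s t GW GW sT tT.
  by rewrite subrr enorm0 add0r distrC.
have h1 : enorm (a - 'D_(X - Y, 0) F (Z, s)) <=
    C1 * e * (enorm (X - Z) + enorm (Y - Z) + 2 * `|t - s|).
  have := hC1 (X, t) (Y, t) (Z, s); rewrite pe /a !FE // => h.
  apply: le_trans (h _ _ _) _; try by [].
  have n1 : `|(X - Y, 0 : R)| <= e.
    rewrite -(pe X Y t); apply: le_trans (norm_spacetime _ _ _ _) _.
    by rewrite subrr normr0 addr0.
  apply: ler_pM; rewrite ?mulr_ge0 ?addr_ge0 ?(ltW C10) ?ler_pM2l //.
  have := norm_spacetime X Z t s; have := norm_spacetime Y Z t s; lra.
have h2 : enorm ('D_(X - Y, 0) F (Z, s) - 'D_(w, 0) F (Z, s)) <=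
    B * (C2 * e * (enorm (X - Z) + enorm (Y - Z))).
  rewrite -derive_sub; last exact: (sF 1%N).1.
  rewrite pe; apply: le_trans (hB _ _ _) _; first by [].
  rewrite ler_pM2l //; apply: le_trans hw.
  rewrite -(pe (X - Y) w 0); apply: le_trans (norm_spacetime _ _ _ _) _.
  by rewrite subrr normr0 addr0.
have h3 : `|dot nu a| <= (C1 + B * C2) * e * (enorm (X - Z) + enorm (Y - Z) + 2 * `|t - s|).
  have -> : dot nu a = dot nu ((a - 'D_(X - Y, 0) F (Z, s)) +
      ('D_(X - Y, 0) F (Z, s) - 'D_(w, 0) F (Z, s))).
    by rewrite addrA subrK [RHS]dotBr nuw subr0.
  apply: le_trans (cauchy_schwarz _ _) _; rewrite nu1 mul1r.
  apply: le_trans (enormD _ _) _; apply: le_trans (lerD h1 h2) _.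
  rewrite -subr_ge0 (_ : _ - _ = B * C2 * e * (2 * `|t - s|)); last by ring.
  have e0 : 0 <= e := enorm_ge0 _.
  by rewrite !mulr_ge0 ?(ltW B0) ?(ltW C20).
have h4 : e <= C3 * enorm a by exact: hC3.
apply: le_trans h3 _.
have BC : 0 < C1 + B * C2 by rewrite addr_gt0 // mulr_gt0.
rewrite -!mulrA ler_pM2l // [leRHS]mulrA [leRHS]mulrCA !mulrA -mulrA.
rewrite [leRHS](_ : _ = (C3 * enorm a) * ((C3 * (1 + 2 * L) + 2) *
  (enorm (flow S X t - flow S Z s) + enorm (flow S Y t - flow S Z s) + `|t - s|))); last by ring.
apply: ler_pM => //; first exact: enorm_ge0.
  by rewrite !addr_ge0 ?enorm_ge0 // mulr_ge0.
have := dist0 X GX; have := dist0 Y GY.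
set p := enorm (flow S X t - _); set q := enorm (flow S Y t - _).
move=> hY hX; apply: le_trans (lerD (lerD hX hY) (lexx _)) _.
rewrite -subr_ge0 (_ : _ - _ = C3 * `|t - s| + 2 * (C3 * L * (p + q)) + 2 * (p + q)); last by ring.
have p0 : 0 <= p := enorm_ge0 _. have q0 : 0 <= q := enorm_ge0 _.
by rewrite !addr_ge0 ?mulr_ge0 ?addr_ge0 ?(ltW C30) ?(ltW L0).
Qed.

End SurfaceNormal.

Lemma cvg_coord (R : realType) (I : Type) (F : set_system I) (FF : Filter F)
    (f : I -> vec R) (u : vec R) i : f @ F --> u -> f x 0 i @[x --> F] --> u 0 i.
Proof.
move=> fu; apply: (@cvg_comp _ _ _ f (fun N : vec R => N 0 i) F (nbhs u) _ fu).
exact: (@coord_continuous _ _ _ 0 i u).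
Qed.

Lemma cvg_dot (R : realType) (I : Type) (F : set_system I) (FF : Filter F)
    (f g : I -> vec R) (u v : vec R) :
  f @ F --> u -> g @ F --> v -> dot (f x) (g x) @[x --> F] --> dot u v.
Proof.
move=> fu gv; rewrite dotE; under eq_fun do rewrite dotE.
by apply: cvgD; [apply: cvgD |]; apply: cvgM; exact: cvg_coord.
Qed.

(** * Quadratic test functions *)

Section QuadraticTests.
Variable R : realType.
Implicit Types (a : vec R) (A b c : R) (z v : vec R * R).

(** The penalty of the doubling argument as a function of one point, the other being frozen at (a,
    b); the slope c becomes lam. *)
Definition quadratic A a b c z : R :=
  A * dot (z.1 - a) (z.1 - a) + A * (z.2 - b) ^+ 2 + c * z.2.

Let dfst i z : differentiable (fun z : vec R * R => z.1 0 i : R) z.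
Proof.
apply: (@differentiable_comp _ _ _ _ (fst : vec R * R -> vec R) (fun x => x 0 i)).
  by apply: linear_differentiable => y; exact: cvg_fst.
exact: differentiable_coord.
Qed.

Let dsnd z : differentiable (snd : vec R * R -> R) z.
Proof. by apply: linear_differentiable => y; exact: cvg_snd. Qed.

Lemma quadratic_differentiable A a b c z : differentiable (quadratic A a b c) z.
Proof.
rewrite (_ : quadratic A a b c = fun z =>
  A * ((z.1 0 0 - a 0 0) * (z.1 0 0 - a 0 0) + (z.1 0 1 - a 0 1) * (z.1 0 1 - a 0 1)
     + (z.1 0 2 - a 0 2) * (z.1 0 2 - a 0 2)) + A * ((z.2 - b) * (z.2 - b)) + c * z.2);
  last by apply/funext => z'; rewrite /quadratic dotE !mxE.
by repeat first [apply: differentiableD | apply: differentiableM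
  | apply: differentiableB | exact: dfst | exact: dsnd | exact: differentiable_cst].
Qed.

Lemma quadratic_derive A a b c z v : 'D_v (quadratic A a b c) z =
  2 * A * dot (z.1 - a) v.1 + 2 * A * (z.2 - b) * v.2 + c * v.2.
Proof.
set L := RHS; pose Q := A * dot v.1 v.1 + A * v.2 ^+ 2.
apply/cvg_lim => //.
have cL : (fun h : R => L + h * Q) @ 0^' --> L.
  rewrite -[X in _ --> X]addr0 -[X in _ --> _ + X](mul0r Q).
  apply: cvgD; first exact: cvg_cst.
  apply: cvgM; last exact: cvg_cst.
  exact: nbhs_dnbhs.
apply: cvg_trans cL; apply: near_eq_cvg; near=> h.
have h0 : h != 0 by near: h; exact: nbhs_dnbhs_neq.
rewrite /= /quadratic /L /Q /GRing.scale /= !dotE !mxE /GRing.scale /=.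
by field.
Unshelve. all: by end_near. Qed.

Lemma quadratic_C1 A a b c : Ck 1 (quadratic A a b c).
Proof.
split=> [z|v]; first exact: quadratic_differentiable.
rewrite (_ : (fun _ => _) = fun z : vec R * R =>
  2 * A * ((z.1 0 0 - a 0 0) * v.1 0 0 + (z.1 0 1 - a 0 1) * v.1 0 1
     + (z.1 0 2 - a 0 2) * v.1 0 2) + 2 * A * (z.2 - b) * v.2 + c * v.2); last first.
  by apply/funext => z'; rewrite quadratic_derive dotE !mxE.
move=> z; apply: differentiable_continuous.
by repeat first [apply: differentiableD | apply: differentiableM
  | apply: differentiableB | exact: dfst | exact: dsnd | exact: differentiable_cst].
Qed.

End QuadraticTests.

(** * Velocity of the flow and material derivative *)

Section Velocity.
Variables (R : realType) (S : evolving_surface R).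
Local Notation T := (Tend S).
Implicit Types (X Y Z x y z w : vec R) (t s : R).

(** Makes limits along this filter unique, also at t = 0 and t = T, where the difference quotients
    are one-sided. *)
Lemma time_filter_proper t : 0 <= t <= T ->
  ProperFilter (within [set` `[0, T]] t^').
Proof.
move=> /andP[t0 tT]; apply: Build_ProperFilter_ex => P.
rewrite /within /= /dnbhs /within /= => /nbhs_ballP[r /= r0 h].
have T0 := Tend_gt0 S; have r2 : 0 < r / 2 by rewrite divr_gt0.
have [tlt|tge] := ltP t T.
- exists (Num.min T (t + r / 2)).
  have lt_s : t < Num.min T (t + r / 2) by rewrite lt_min tlt ltrDl.
  apply: h; rewrite ?gt_eqF //; last first.
    by rewrite /= in_itv /= ge_min lexx (le_trans t0 (ltW lt_s)).
  rewrite -ball_normE /= distrC gtr0_norm ?subr_gt0 // ltrBlDl.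
  by rewrite gt_min ltrD2l; apply/orP; right; lra.
- exists (Num.max 0 (t - r / 2)).
  have lt_s : Num.max 0 (t - r / 2) < t by rewrite gt_max (lt_le_trans T0 tge) /=; lra.
  apply: h; rewrite ?lt_eqF //; last first.
    by rewrite /= in_itv /= le_max lexx /= (le_trans (ltW lt_s) tT).
  rewrite -ball_normE /= gtr0_norm ?subr_gt0 // ltrBlDl -ltrBlDr.
  by rewrite lt_max; apply/orP; right; lra.
Qed.

(** Uniqueness of the limit in [flow_vel] identifies [vel] with the time derivative of the smooth
    extension of the flow, to which the Taylor estimates apply. [flow_expansive] turns the Lipschitz
    bound in X into one in the moving points. *)
Lemma flow_velocity : exists2 C, 0 < C &
  [/\ forall X t s, Gamma0 S X -> 0 <= t <= T -> 0 <= s <= T ->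
        enorm (flow S X s - flow S X t - (s - t) *: vel S (flow S X t, t))
          <= C * `|s - t| ^+ 2,
      forall X Y t s, Gamma0 S X -> Gamma0 S Y -> 0 <= t <= T -> 0 <= s <= T ->
        enorm (vel S (flow S X t, t) - vel S (flow S Y s, s))
          <= C * (enorm (flow S X t - flow S Y s) + `|t - s|)
    & forall X t, Gamma0 S X -> 0 <= t <= T -> enorm (vel S (flow S X t, t)) <= C].
Proof.
have [F sF FE] := flow_extension S.
have cyl := @cylinder_compact R S.
have [C C0 hC] := C2_vec_taylor (@finite_frame_spacetime R) cyl (sF 2%N).
have [B B0 hB] := C1_vec_bound (@finite_frame_spacetime R) cyl (sF 1%N).
have [L L0 hL] := C2_vec_derive_lipschitz (@finite_frame_spacetime R) (0, 1) cyl (sF 2%N).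
have [M M0 hM] := flow_expansive S.
have [N N0 hN] := flow_lipschitz S.
have n01 : `|(0, 1) : vec R * R| = 1.
  by rewrite prod_normE /= normr0 normr1; apply/max_idPr.
have taylor X t s : Gamma0 S X -> 0 <= t <= T -> 0 <= s <= T ->
    enorm (flow S X s - flow S X t - (s - t) *: 'D_(0, 1) F (X, t)) <= C * `|s - t| ^+ 2.
  move=> GX tT sT; have := hC (X, s) (X, t) (X, t).
  have -> : (X, s) - (X, t) = (s - t) *: ((0, 1) : vec R * R).
    by apply/pair_equal_spec; split; rewrite /= ?subrr ?scaler0 // [RHS]mulr1.
  rewrite subrr normr0 addr0 normrZ n01 mulr1 !FE // deriveE; last exact: (sF 1%N).1.
  rewrite linearZ -deriveE; last exact: (sF 1%N).1.
  by rewrite -mulrA -expr2; apply.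
have velE X t : Gamma0 S X -> 0 <= t <= T -> vel S (flow S X t, t) = 'D_(0, 1) F (X, t).
  move=> GX tT; have PF := time_filter_proper tT.
  apply: (cvg_unique _ (flow_vel GX tT)); first exact: norm_hausdorff.
  rewrite /=; apply/cvgrPdist_le => e e0.
  rewrite /prop_near1 /within /= /dnbhs /within /=.
  apply/nbhs_ballP; exists (e / C) => /=; first by rewrite divr_gt0.
  move=> s; rewrite -ball_normE /= distrC => hs st.
  rewrite in_itv /= => sT; have st0 : s - t != 0 by rewrite subr_eq0.
  apply: le_trans (norm_le_enorm _) _; rewrite enormBC.
  rewrite -['D_ _ F _](scalerK st0) -scalerBr enormZ normfV mulrC ler_pdivrMr ?normr_gt0 //.
  apply: le_trans (taylor X t s GX tT sT) _; rewrite expr2 mulrA.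
  by rewrite ler_wpM2r // mulrC -ler_pdivlMr // ltW.
exists (C + L * M * (1 + N) + L + B).
  by rewrite !addr_gt0 // ?mulr_gt0 // addr_gt0.
have CLB : [/\ 0 <= C, 0 <= L, 0 <= B, 0 <= M & 0 <= N] by rewrite !ltW.
case: CLB => C0' L0' B0' M0' N0'.
have LMN : 0 <= L * M * (1 + N) by rewrite !mulr_ge0 // addr_ge0.
split.
- move=> X t s GX tT sT; rewrite velE //; apply: le_trans (taylor X t s GX tT sT) _.
  by rewrite ler_wpM2r ?sqr_ge0 //; lra.
- move=> X Y t s GX GY tT sT; rewrite !velE //.
  apply: le_trans (hL (X, t) (Y, s) _ _) _; [by []|by []|].
  apply: (@le_trans _ _ (L * (enorm (X - Y) + `|t - s|))).
    by rewrite ler_pM2l //; exact: norm_spacetime.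
  have h1 : enorm (X - Y) <= M * ((1 + N) * (enorm (flow S X t - flow S Y s) + `|t - s|)).
    apply: le_trans (hM X Y t GX GY tT) _; rewrite ler_pM2l //.
    apply: le_trans (enorm_dist3 _ (flow S Y s) _) _.
    have := hN Y Y s t GY GY sT tT; rewrite subrr enorm0 add0r distrC => h.
    have := mulr_ge0 N0' (enorm_ge0 (flow S X t - flow S Y s)).
    have := normr_ge0 (t - s); lra.
  move: h1; set d := enorm _ + `|t - s| => h1.
  have d0 : 0 <= d by rewrite addr_ge0 ?enorm_ge0.
  have d1 : `|t - s| <= d by rewrite lerDr enorm_ge0.
  apply: (@le_trans _ _ (L * (M * ((1 + N) * d) + d))); first by rewrite ler_pM2l // lerD.
  rewrite -subr_ge0 (_ : _ - _ = C * d + B * d); last by ring.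
  by rewrite addr_ge0 // mulr_ge0.
- move=> X t GX tT; rewrite velE //; apply: le_trans (hB (X, t) (0, 1) _) _; first by [].
  by rewrite n01 mulr1; lra.
Qed.

(** The quotient of a difference of squares factors into the quotient of the flow times a sum, so
    [flow_vel] and continuity give the limit. *)
Lemma mat_deriv_quadratic A a b c X t : Gamma0 S X -> 0 <= t <= T ->
  mat_deriv S (quadratic A a b c) X t =
  2 * A * dot (flow S X t - a) (vel S (flow S X t, t)) + 2 * A * (t - b) + c.
Proof.
move=> GX tT; have PF := time_filter_proper tT.
have [N N0 hN] := flow_lipschitz S.
apply/cvg_lim => //.
have st : s @[s --> within [set` `[0, T]] t^'] --> t.
  by apply: cvg_trans (cvg_within _) _; exact: nbhs_dnbhs.
have xst : flow S X s @[s --> within [set` `[0, T]] t^'] --> flow S X t.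
  apply/cvgrPdist_le => e e0.
  rewrite /prop_near1 /within /= /dnbhs /within /=.
  apply/nbhs_ballP; exists (e / N) => /=; first by rewrite divr_gt0.
  move=> s; rewrite -ball_normE /= => hs _; rewrite in_itv /= => sT.
  apply: le_trans (norm_le_enorm _) _; apply: le_trans (hN X X t s GX GX tT sT) _.
  by rewrite subrr enorm0 add0r mulrC -ler_pdivlMr // ltW.
pose q s := (s - t)^-1 *: (flow S X s - flow S X t).
have lim : A * dot (q s) (flow S X s + flow S X t - 2 *: a) + A * (s + t - 2 * b) + c
    @[s --> within [set` `[0, T]] t^'] -->
    A * dot (vel S (flow S X t, t)) (flow S X t + flow S X t - 2 *: a)
      + A * (t + t - 2 * b) + c.
  apply: cvgD; last exact: cvg_cst.
  apply: cvgD; apply: cvgM; try exact: cvg_cst.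
  - apply: cvg_dot; first exact: flow_vel.
    by apply: cvgB; [apply: cvgD => //; exact: cvg_cst | exact: cvg_cst].
  - by apply: cvgB; [apply: cvgD => //; exact: cvg_cst | exact: cvg_cst].
have -> : 2 * A * dot (flow S X t - a) (vel S (flow S X t, t)) + 2 * A * (t - b) + c =
    A * dot (vel S (flow S X t, t)) (flow S X t + flow S X t - 2 *: a)
      + A * (t + t - 2 * b) + c.
  by rewrite !dotE !mxE; ring.
apply: cvg_trans lim; apply: near_eq_cvg.
have hne : (within [set` `[0, T]] t^') [set s | s != t].
  have sn : t^' [set s | s != t] := withinT _ (nbhs_filter t).
  by apply: (filterS _ sn) => s sn' _.
apply: filterS hne => s /= sneq.
have st0 : s - t != 0 by rewrite subr_eq0.
by rewrite /quadratic /q /= !dotE !mxE; field.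
Qed.

Lemma tan_grad_quadratic A a b c z t :
  let nu := normal S z t in let p := (2 * A) *: (z - a) in
  tan_grad S (quadratic A a b c) (z, t) = p - dot nu p *: nu.
Proof.
move=> nu p; rewrite /tan_grad -/nu.
have -> : \row_i 'D_(delta_mx 0 i, 0) (quadratic A a b c) (z, t) = p => //.
apply/rowP => i; rewrite !mxE quadratic_derive /= !mulr0 !addr0; congr (_ * _).
rewrite /dot (bigD1 i) //= big1 ?addr0 => [|j ji]; first by rewrite !mxE !eqxx mulr1.
by rewrite [delta_mx _ _ _ _]mxE eqxx (negPf ji) mulr0.
Qed.

End Velocity.

(** * Nearest-point projection *)

Section Tubular.
Variables (R : realType) (S : evolving_surface R).
Local Notation T := (Tend S).
Implicit Types (X Y Z x y z w : vec R) (t s : R).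

(** The signed distance has the distance as its absolute value and the normal has length 1, so the
    foot point in [surf_projP] realizes the distance to the surface. *)
Lemma surf_proj_nearest t x : 0 <= t <= T -> nhd S t x ->
  let y := surf_proj S x t in
  [/\ Gamma S t y, exists r, x = y + r *: normal S y t
    & forall z, Gamma S t z -> enorm (x - y) <= enorm (x - z)].
Proof.
move=> tT nx y; have [_ /(_ erefl)[Gy xE]] := surf_projP tT nx y.
split=> //; first by exists (signed_dist (Gamma S t) x).
move=> z Gz; have [n1 _ _] := Defs.normalP tT Gy.
rewrite {1}xE [y + _]addrC addrK enormZ n1 mulr1.
set E := [set enorm (x - y) | y in Gamma S t].
have le_z : inf E <= enorm (x - z).
  by apply: ge_inf; [exists 0 => _ [w _ <-]; exact: enorm_ge0 | exists z].
have ge0 : 0 <= inf E.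
  by apply: lb_le_inf; [exists (enorm (x - z)), z | move=> _ [w _ <-]; exact: enorm_ge0].
have dE : dist_set (Gamma S t) x = inf E by [].
move: (inf E) le_z ge0 dE => i le_z ge0 dE.
by rewrite /signed_dist dE; case: ifP => _; rewrite ?normrN ger0_norm.
Qed.

(* Points at distance less than the reach have a single nearest point; hence no
   information about the sign of the distance is needed. *)
Lemma surf_proj_unique : exists2 r0, 0 < r0 & forall t x y r,
  0 <= t <= T -> nhd S t x -> Gamma S t y -> x = y + r *: normal S y t ->
  `|r| <= r0 -> surf_proj S x t = y.
Proof.
have [C C0 hC] := normal_estimate S.
(* If y' is a nearest point and d = y' - y, then |x - y'|^2 <= r^2 expands to |d|^2 <= 2 r nu.d. By
   the normal estimate the right side is at most 2 C |d|^2 / (4 C) = |d|^2 / 2, whence d = 0. *)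
exists ((4 * C)^-1); first by rewrite invr_gt0 mulr_gt0.
move=> t x y r tT nx Gy xE rle.
have [Gy' _ hy'] := surf_proj_nearest tT nx.
set y' := surf_proj S x t in Gy' hy' *.
have [n1 _ _] := Defs.normalP tT Gy.
set nu := normal S y t in xE n1.
have e0 := enorm_ge0 (y' - y).
have h1 : `|dot nu (y' - y)| <= C * enorm (y' - y) ^+ 2.
  have := hC t t y' y y tT tT Gy' Gy Gy.
  by rewrite !subrr enorm0 normr0 !addr0 -mulrA -expr2.
have h2 : enorm (x - y') ^+ 2 <= r ^+ 2.
  have : enorm (x - y') <= `|r|.
    apply: le_trans (hy' y Gy) _.
    by rewrite xE [y + _]addrC addrK enormZ n1 mulr1.
  by rewrite -[r ^+ 2]real_normK ?num_real // ler_sqr ?nnegrE ?enorm_ge0.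
have h3 : enorm (x - y') ^+ 2 = r ^+ 2 - 2 * r * dot nu (y' - y) + enorm (y' - y) ^+ 2.
  have -> : x - y' = r *: nu - (y' - y) by rewrite xE opprB addrCA addrA.
  have nn : dot nu nu = 1 by rewrite -enorm2 n1 expr1n.
  rewrite !enorm2; move: (y' - y) => d.
  transitivity (r ^+ 2 * dot nu nu - 2 * r * dot nu d + dot d d); last by rewrite nn mulr1.
  by rewrite !dotE !mxE; ring.
have h4 : 2 * r * dot nu (y' - y) <= 2^-1 * enorm (y' - y) ^+ 2.
  apply: le_trans (ler_norm _) _; rewrite normrM normrM normr_nat.
  apply: (@le_trans _ _ (2 * (4 * C)^-1 * (C * enorm (y' - y) ^+ 2))).
    by apply: ler_pM => //; rewrite ?mulr_ge0 // ler_pM2l.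
  rewrite [leLHS](_ : _ = 2^-1 * enorm (y' - y) ^+ 2) //.
  by field; rewrite gt_eqF.
have : enorm (y' - y) ^+ 2 <= 0 by lra.
by rewrite exprn_even_le0 //= enorm_eq0 subr_eq0 => /eqP.
Qed.

Lemma STbar_compact : compact (STbar S).
Proof.
have [F sF FE] := flow_extension S.
rewrite (_ : STbar S = (fun z : vec R * R => (F z, z.2)) @`
    [set z : vec R * R | Gamma0 S z.1 /\ 0 <= z.2 <= T]); last first.
  apply/seteqP; split=> -[x t].
    by move=> [/= tT [X GX <-]]; exists (X, t) => //=; rewrite FE.
  by move=> [[X s] /= [GX sT] [<- <-]]; split=> //=; exists X => //; rewrite FE.
apply: continuous_compact; last exact: cylinder_compact.
apply: continuous_subspaceT => p; apply: differentiable_continuous.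
apply: differentiable_pair; first exact: (sF 1%N).1.
by apply: linear_differentiable => y; exact: cvg_snd.
Qed.

Lemma STbar_flow x t : STbar S (x, t) ->
  0 <= t <= T /\ exists2 X, Gamma0 S X & flow S X t = x.
Proof. by move=> [/= tT [X GX <-]]; split=> //; exists X. Qed.

Lemma flow_STbar X t : Gamma0 S X -> 0 <= t <= T -> STbar S (flow S X t, t).
Proof. by move=> GX tT; split=> //=; exists X. Qed.

End Tubular.

(** * Triangles *)

Section Frames.
Variable R : realType.
Implicit Types (e f p q r n nu w : vec R) (a b c d D k A : R).

Lemma dot_normalized e : 0 < enorm e ->
  dot ((enorm e)^-1 *: e) ((enorm e)^-1 *: e) = 1.
Proof. by move=> e0; rewrite dotZl dotZr -enorm2; field; rewrite gt_eqF. Qed.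

Lemma enorm_normalized e : 0 < enorm e -> enorm ((enorm e)^-1 *: e) = 1.
Proof. by move=> e0; rewrite enormZ ger0_norm ?invr_ge0 ?mulVf ?gt_eqF // ltW. Qed.

(** The constant k expresses shape regularity, |e x f| >= k D^2 with D bounding the edges. Each of
    the two terms left in [frame_expansion] has length at most a D^2 |N|; dividing by |N|^2 >= k D^2
    |N| leaves 2 a / k. *)
Lemma frame_bound e f q a D k : 0 < k -> 0 < D ->
  k * D ^+ 2 <= enorm (cross e f) -> enorm e <= D -> enorm f <= D ->
  dot q (cross e f) = 0 -> `|dot q e| <= a * D -> `|dot q f| <= a * D ->
  enorm q <= 2 / k * a.
Proof.
move=> k0 D0 kD eD fD qN qe qf; set N := cross e f in kD qN *.
have N0 : 0 < enorm N by apply: lt_le_trans kD; rewrite mulr_gt0 ?exprn_gt0.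
have a0 : 0 <= a by rewrite -(pmulr_lge0 _ D0); exact: le_trans (normr_ge0 _) qe.
have h : enorm N ^+ 2 * enorm q <= 2 * a * D ^+ 2 * enorm N.
  rewrite -[enorm N ^+ 2]ger0_norm ?sqr_ge0 // -enormZ enorm2 frame_expansion -/N.
  rewrite qN scale0r add0r; apply: le_trans (enormB _ _) _; rewrite !enormZ.
  have h1 : enorm (cross f N) <= D * enorm N.
    by apply: le_trans (enorm_cross_le _ _) _; rewrite ler_wpM2r ?enorm_ge0.
  have h2 : enorm (cross e N) <= D * enorm N.
    by apply: le_trans (enorm_cross_le _ _) _; rewrite ler_wpM2r ?enorm_ge0.
  rewrite (_ : 2 * a * D ^+ 2 * enorm N = a * D * (D * enorm N) + a * D * (D * enorm N)); last by ring.
  by apply: lerD; apply: ler_pM; rewrite ?enorm_ge0.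
have {h} : enorm N * enorm q <= 2 * a * D ^+ 2.
  by rewrite -(ler_pM2r N0) mulrAC -expr2.
move=> h; have : k * D ^+ 2 * enorm q <= 2 * a * D ^+ 2.
  by apply: le_trans h; rewrite ler_wpM2r ?enorm_ge0.
rewrite mulrAC ler_pM2r ?exprn_gt0 // => h'.
by rewrite mulrAC ler_pdivlMr // mulrC.
Qed.

(** The component of nu in the plane of e and f is at most 2 de / k by [frame_bound]. With s = nu.n,
    the squared distance from nu to the nearer of n and - n is 2 - 2 |s| <= 2 (1 - s^2), twice the
    square of that component. *)
Lemma frame_normal e f nu D k de : 0 < k -> 0 < D -> 0 <= de ->
  k * D ^+ 2 <= enorm (cross e f) -> enorm e <= D -> enorm f <= D ->
  enorm nu = 1 -> `|dot nu e| <= de * D -> `|dot nu f| <= de * D ->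
  let n := (enorm (cross e f))^-1 *: cross e f in
  (0 <= dot nu n -> enorm (nu - n) <= 4 / k * de) /\
  (dot nu n <= 0 -> enorm (nu + n) <= 4 / k * de).
Proof.
move=> k0 D0 de0 kD eD fD nu1 nue nuf n; set N := cross e f in kD n *.
have N0 : 0 < enorm N by apply: lt_le_trans kD; rewrite mulr_gt0 ?exprn_gt0.
have nn : dot n n = 1 := dot_normalized N0.
have nN : N = enorm N *: n by rewrite scalerA mulfV ?gt_eqF ?scale1r.
have ne : dot n e = 0 by rewrite dotZl cross_dotl mulr0.
have nf : dot n f = 0 by rewrite dotZl cross_dotr mulr0.
clearbody n; pose s := dot nu n; pose nut := nu - s *: n.
have nutn : dot nut n = 0 by rewrite dotBl dotZl nn mulr1 subrr.
have ht : enorm nut <= 2 / k * de.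
  apply: (frame_bound (e := e) (f := f) (D := D)) => //.
  - by rewrite -/N nN dotZr nutn mulr0.
  - by rewrite dotBl dotZl ne mulr0 subr0.
  - by rewrite dotBl dotZl nf mulr0 subr0.
have nut2 : enorm nut ^+ 2 = 1 - s ^+ 2.
  have -> : 1 = dot nu nu by rewrite -enorm2 nu1 expr1n.
  by rewrite enorm2 /nut dotBl !dotBr !dotZl !dotZr nn (dotC n nu) -/s; ring.
have s1 : s ^+ 2 <= 1 by rewrite -subr_ge0 -nut2 sqr_ge0.
have step v : dot v v <= 2 * enorm nut ^+ 2 -> enorm v <= 4 / k * de.
  move=> h; apply: le_trans (_ : 2 * enorm nut <= _); last by have := ht; lra.
  apply: enorm_le; first by rewrite mulr_ge0 ?enorm_ge0.
  by apply: le_trans h _; rewrite exprMn; have := sqr_ge0 (enorm nut); lra.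
have nunu : dot nu nu = 1 by rewrite -enorm2 nu1 expr1n.
rewrite -/s; split=> s0; apply: step; rewrite nut2.
- by rewrite dotBl !dotBr nn nunu (dotC n nu) -/s; nra.
- by rewrite dotDl !dotDr nn nunu (dotC n nu) -/s; nra.
Qed.

(* q is the gradient, on the triangle spanned by e and f, of the interpolant of a
   quadratic with gradient p and Hessian 2A. *)
Lemma frame_gradient e f nu D k de p q A : 0 < k -> 0 < D -> 0 <= de ->
  k * D ^+ 2 <= enorm (cross e f) -> enorm e <= D -> enorm f <= D ->
  enorm nu = 1 -> `|dot nu e| <= de * D -> `|dot nu f| <= de * D ->
  de <= k / 8 -> de <= 1 ->
  dot q (cross e f) = 0 ->
  dot q e = dot p e + A * dot e e -> dot q f = dot p f + A * dot f f ->
  enorm (q - (p - dot nu p *: nu)) <=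
    (4 / k + 16 / k ^+ 2) * (enorm p * de + `|A| * D).
Proof.
move=> k0 D0 de0 kD eD fD nu1 nue nuf dek de1 qN qe qf.
set a := enorm p * de + `|A| * D.
have p0 := enorm_ge0 p; have A0 := normr_ge0 A.
have a0 : 0 <= a by rewrite addr_ge0 // mulr_ge0 // ltW.
set r := q - _; set N := cross e f in kD qN *.
have N0 : 0 < enorm N by apply: lt_le_trans kD; rewrite mulr_gt0 ?exprn_gt0.
pose n := (enorm N)^-1 *: N.
have nn : dot n n = 1 := dot_normalized N0.
have n1 : enorm n = 1 := enorm_normalized N0.
have nN : N = enorm N *: n by rewrite scalerA mulfV ?gt_eqF ?scale1r.
have qn : dot q n = 0 by rewrite dotZr qN mulr0.
have [h1 h2] := frame_normal k0 D0 de0 kD eD fD nu1 nue nuf.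
rewrite -/N -/n in h1 h2; clearbody n.
have quad v : enorm v <= D -> `|A * dot v v| <= `|A| * D * D.
  move=> vD; rewrite normrM -mulrA ler_wpM2l // -enorm2 ger0_norm ?sqr_ge0 // expr2.
  by rewrite ler_pM ?enorm_ge0.
(* Along an edge v the first-order parts cancel: r.v = (nu.p) (nu.v) + A |v|^2. *)
have rv v : enorm v <= D -> `|dot nu v| <= de * D -> dot q v = dot p v + A * dot v v ->
    `|dot r v| <= a * D.
  move=> vD nv qv; rewrite /r dotBl dotBl dotZl qv.
  rewrite (_ : _ - _ = dot nu p * dot nu v + A * dot v v); last by ring.
  apply: le_trans (ler_normD _ _) _; rewrite mulrDl lerD ?quad // normrM -mulrA.
  by apply: ler_pM => //; apply: le_trans (cauchy_schwarz _ _) _; rewrite nu1 mul1r.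
have qv v : enorm v <= D -> dot q v = dot p v + A * dot v v ->
    `|dot q v| <= (enorm p + `|A| * D) * D.
  move=> vD ->; apply: le_trans (ler_normD _ _) _; rewrite mulrDl lerD ?quad //.
  by apply: le_trans (cauchy_schwarz _ _) _; rewrite ler_wpM2l.
have hq : enorm q <= 2 / k * (enorm p + `|A| * D).
  by apply: (frame_bound k0 D0 kD) => //; exact: qv.
have hrt : enorm (r - dot r n *: n) <= 2 / k * a.
  have dn v : dot N v = 0 -> dot (r - dot r n *: n) v = dot r v.
    move=> Nv; have : enorm N * dot n v = 0 by rewrite -dotZl -nN.
    by move/eqP; rewrite mulf_eq0 gt_eqF //= => /eqP nv; rewrite dotBl dotZl nv mulr0 subr0.
  apply: (frame_bound k0 D0 kD) => //.
  - by rewrite -/N nN dotZr dotBl dotZl nn mulr1 subrr mulr0.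
  - by rewrite dn ?cross_dotl //; exact: rv.
  - by rewrite dn ?cross_dotr //; exact: rv.
(* Component of r along a unit normal m of the triangle: r and q have the same product with nu, and
   q.m = 0, so r.m = (q - r).(nu - m). The part containing r is at most |r| / 2 and is absorbed at
   the end. *)
have key m : enorm (nu - m) <= 4 / k * de -> dot q m = 0 ->
    `|dot r m| <= 8 / k ^+ 2 * a + 2^-1 * enorm r.
  move=> hm qm.
  have ru : dot r nu = dot q nu.
    rewrite /r dotBl (dotC (p - _)) dotBr dotZr -[dot nu nu]enorm2 nu1 expr1n mulr1.
    by rewrite subrr subr0.
  rewrite (_ : dot r m = dot q (nu - m) - dot r (nu - m)); last first.
    by rewrite !dotBr ru qm; ring.
  apply: le_trans (ler_normB _ _) _; apply: lerD.
    apply: le_trans (cauchy_schwarz _ _) _.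
    apply: (@le_trans _ _ (2 / k * (enorm p + `|A| * D) * (4 / k * de))).
      by apply: ler_pM; rewrite ?enorm_ge0.
    rewrite (_ : 2 / k * _ * _ = 8 / k ^+ 2 * ((enorm p + `|A| * D) * de)); last first.
      by field; rewrite gt_eqF.
    rewrite ler_pM2l ?divr_gt0 ?exprn_gt0 // mulrDl lerD2l.
    by rewrite ler_piMr // mulr_ge0 // ltW.
  apply: le_trans (cauchy_schwarz _ _) _; rewrite mulrC ler_wpM2r ?enorm_ge0 //.
  apply: le_trans hm _; rewrite mulrAC ler_pdivrMr // mulrC; lra.
have hrn : `|dot r n| <= 8 / k ^+ 2 * a + 2^-1 * enorm r.
  have [s0|s0] := leP 0 (dot nu n); first exact: key (h1 s0) qn.
  rewrite -normrN -dotNr; apply: key; last by rewrite dotNr qn oppr0.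
  by rewrite opprK; exact: h2 (ltW s0).
have : enorm r <= 2 / k * a + (8 / k ^+ 2 * a + 2^-1 * enorm r).
  rewrite -{1}(subrK (dot r n *: n) r); apply: le_trans (enormD _ _) _.
  by apply: lerD => //; rewrite enormZ n1 mulr1.
rewrite (_ : (4 / k + 16 / k ^+ 2) * a = 2 * (2 / k * a) + 2 * (8 / k ^+ 2 * a)); last by ring.
by move: (2 / k * a) (8 / k ^+ 2 * a) (enorm r) => x y z; lra.
Qed.

(** t is the tangent of half the angle between the unit vectors a and b. By the last identity, t (a
    + b) is a - b turned by a right angle in their plane; this makes the fluxes around a vertex
    telescope. *)
Lemma half_tan (a b : vec R) : enorm a = 1 -> enorm b = 1 -> cross a b != 0 ->
  let t := enorm (cross a b) / (1 + dot a b) in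
  [/\ 0 < 1 + dot a b, 0 < t, enorm (a - b) <= 2 * t
    & t *: (a + b) = cross ((enorm (cross a b))^-1 *: cross a b) (a - b)].
Proof.
move=> a1 b1 N0 t; set N := cross a b in N0 t *; set c := dot a b in t *.
have NN : 0 < enorm N by rewrite enorm_gt0.
have aa : dot a a = 1 by rewrite -enorm2 a1 expr1n.
have bb : dot b b = 1 by rewrite -enorm2 b1 expr1n.
have Nc : enorm N ^+ 2 = (1 - c) * (1 + c).
  by rewrite enorm2; have := lagrange a b; rewrite -/N -/c aa bb => h; lra.
have c1 : `|c| <= 1 by have := cauchy_schwarz a b; rewrite a1 b1 mulr1.
have pc : 0 < 1 + c.
  have : 0 <= 1 + c by move: c1; rewrite ler_norml; lra.
  rewrite le_eqVlt => /orP[/eqP e|//].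
  by move: Nc; rewrite -e mulr0 => /eqP; rewrite sqrf_eq0 gt_eqF.
have t0 : 0 < t by rewrite divr_gt0.
have tt : t * enorm N = 1 - c.
  by rewrite mulrAC -expr2 Nc mulfK // gt_eqF.
split=> //.
  apply: enorm_le; first by rewrite mulr_ge0 // ltW.
  rewrite dotBl !dotBr aa bb (dotC b a) -/c.
  have tc : t * (1 + c) = enorm N by rewrite divfK // gt_eqF.
  have : t ^+ 2 * (1 + c) = 1 - c by rewrite expr2 -mulrA tc.
  move: c1; rewrite ler_norml => /andP[h1 h2]; have := sqr_ge0 t.
  rewrite exprMn; move: (t ^+ 2) => y; nra.
rewrite crossZl cross_crossl !dotBr aa bb -/c (dotC b a) -/c.
have -> : (1 - c) *: b - (c - 1) *: a = (1 - c) *: (a + b).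
  by rewrite scalerDr addrC -[c - 1]opprB scaleNr opprK.
by rewrite scalerA -tt mulrCA mulVf ?mulr1 // gt_eqF.
Qed.

End Frames.

Section TriangleGeometry.
Variables (R : realType) (M : nat) (X : 'I_M -> vec R).
Implicit Types (i j k : 'I_M) (K : {set 'I_M}) (x y : vec R) (a b c : R).

Lemma sum_support3 (V : nmodType) (F : 'I_M -> V) i j k :
  i != j -> j != k -> i != k ->
  (forall m, m \notin [set i; j; k]%SET -> F m = 0) ->
  \sum_m F m = F i + F j + F k.
Proof.
move=> ij jk ik F0; rewrite (bigD1 i) //= (bigD1 j) ?(eq_sym j) //=.
rewrite (bigD1 k) ?(eq_sym k) ?ik ?jk //= big1 ?addr0 ?addrA // => m.
by rewrite -andbA => /and3P[mi mj mk]; apply: F0; rewrite !inE !negb_or mi mj mk.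
Qed.

Lemma lin_combP (m : R) i j k x : i != j -> j != k -> i != k ->
  lin_comb X m [set i; j; k] x <->
  exists b c, x = m *: X i + b *: (X j - X i) + c *: (X k - X i).
Proof.
move=> ij jk ik; split=> [[l [l0 lm ->]]|[b [c ->]]].
  have F0 p : p \notin [set i; j; k]%SET -> l p *: X p = 0 by move=> /l0 ->; rewrite scale0r.
  move: lm; rewrite !(sum_support3 ij jk ik) // => <-.
  by exists (l j), (l k); apply: vec3P; rewrite !mxE; ring.
pose l p := if p == i then m - b - c else if p == j then b else if p == k then c else 0.
have li : l i = m - b - c by rewrite /l eqxx.
have lj : l j = b by rewrite /l eq_sym (negPf ij) eqxx.
have lk : l k = c by rewrite /l eq_sym (negPf ik) eq_sym (negPf jk) eqxx.
have l0 p : p \notin [set i; j; k]%SET -> l p = 0.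
  by rewrite !inE !negb_or /l => /andP[/andP[/negPf -> /negPf ->] /negPf ->].
exists l; split=> //.
  by rewrite (sum_support3 ij jk ik) // li lj lk; ring.
rewrite (sum_support3 ij jk ik); last by move=> p /l0 ->; rewrite scale0r.
by rewrite li lj lk; apply: vec3P; rewrite !mxE; ring.
Qed.

Lemma hull3P i j k x : i != j -> j != k -> i != k ->
  hull X [set i; j; k] x <->
  exists b c, [/\ 0 <= b, 0 <= c, b + c <= 1
    & x = X i + b *: (X j - X i) + c *: (X k - X i)].
Proof.
move=> ij jk ik; split=> [[l [lge l0 lm ->]]|[b [c [b0 c0 bc ->]]]].
  have F0 p : p \notin [set i; j; k]%SET -> l p *: X p = 0 by move=> /l0 ->; rewrite scale0r.
  move: lm; rewrite !(sum_support3 ij jk ik) // => lm.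
  exists (l j), (l k); split=> //; first by have := lge i; lra.
  have -> : l i = 1 - l j - l k by rewrite -lm; ring.
  by apply: vec3P; rewrite !mxE; ring.
pose l p := if p == i then 1 - b - c else if p == j then b else if p == k then c else 0.
have li : l i = 1 - b - c by rewrite /l eqxx.
have lj : l j = b by rewrite /l eq_sym (negPf ij) eqxx.
have lk : l k = c by rewrite /l eq_sym (negPf ik) eq_sym (negPf jk) eqxx.
have l0 p : p \notin [set i; j; k]%SET -> l p = 0.
  by rewrite !inE !negb_or /l => /andP[/andP[/negPf -> /negPf ->] /negPf ->].
exists l; split=> //.
- by move=> p; rewrite /l; case: ifP => _; [lra|case: ifP => _ //; case: ifP].
- by rewrite (sum_support3 ij jk ik) // li lj lk; ring.
rewrite (sum_support3 ij jk ik); last by move=> p /l0 ->; rewrite scale0r.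
by rewrite li lj lk; apply: vec3P; rewrite !mxE; ring.
Qed.

Lemma hull_vertex K i : i \in K -> hull X K (X i).
Proof.
move=> iK; exists (fun m => (m == i)%:R); split.
- by move=> m; rewrite ler0n.
- by move=> m mK; case: eqP => // e; rewrite e iK in mK.
- by rewrite (bigD1 i) //= eqxx big1 ?addr0 // => m /negPf ->.
- rewrite (bigD1 i) //= eqxx scale1r big1 ?addr0 // => m /negPf ->.
  by rewrite scale0r.
Qed.

Lemma indep_cross i j k : i != j -> j != k -> i != k ->
  aff_indep X [set i; j; k] -> cross (X j - X i) (X k - X i) != 0.
Proof.
move=> ij jk ik ind; set e := X j - X i; set f := X k - X i.
have zero b c : b *: e + c *: f = 0 -> b = 0 /\ c = 0.
  move=> bc.
  pose l p := if p == i then - b - c else if p == j then b else if p == k then c else 0.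
  have li : l i = - b - c by rewrite /l eqxx.
  have lj : l j = b by rewrite /l eq_sym (negPf ij) eqxx.
  have lk : l k = c by rewrite /l eq_sym (negPf ik) eq_sym (negPf jk) eqxx.
  have l0 p : p \notin [set i; j; k]%SET -> l p = 0.
    by rewrite !inE !negb_or /l => /andP[/andP[/negPf -> /negPf ->] /negPf ->].
  have := ind l l0; rewrite !(sum_support3 ij jk ik) ?li ?lj ?lk //; last first.
    by move=> p /l0 ->; rewrite scale0r.
  move=> h; suff h0 : forall m, l m = 0 by rewrite -lj -lk !h0.
  by apply: h; [ring | rewrite -bc; apply: vec3P; rewrite /e /f !mxE; ring].
apply/eqP => N0.
have : dot f f *: e + (- dot e f) *: f = 0.
  have := cross_crossl e f f; rewrite N0.
  have -> : cross 0 f = 0 by apply: vec3P; rewrite !vecE; ring.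
  by move=> h; rewrite scaleNr -[LHS]opprB -h oppr0.
move=> /zero[/eqP]; rewrite dot_eq0 => /eqP f0 _.
have : 0 *: e + 1 *: f = 0 by rewrite f0 scaler0 scale0r addr0.
by move=> /zero[_ /eqP]; rewrite oner_eq0.
Qed.

(** [ediam] is a supremum, which bounds its elements only after the set of distances is shown to be
    bounded. *)
Lemma hull_bounded K x y : hull X K x -> hull X K y -> enorm (x - y) <= ediam (hull X K).
Proof.
move=> hx hy; apply: ub_le_sup; last by exists x, y.
have bound z : hull X K z -> enorm z <= \sum_m enorm (X m).
  move=> [l [l0 _ l1 ->]].
  have : forall s : seq 'I_M, enorm (\sum_(m <- s) l m *: X m) <= \sum_(m <- s) l m * enorm (X m).
    elim=> [|m s IH]; first by rewrite !big_nil enorm0.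
    rewrite !big_cons; apply: le_trans (enormD _ _) _.
    by rewrite enormZ ger0_norm // lerD2l.
  move=> /(_ (index_enum _)) h; apply: le_trans h _.
  apply: ler_sum => m _; rewrite ler_piMl ?enorm_ge0 // -l1 (bigD1 m) //= lerDl.
  exact: sumr_ge0.
exists (\sum_m enorm (X m) + \sum_m enorm (X m)) => _ [z [w [hz hw ->]]].
by apply: le_trans (enormB _ _) _; rewrite lerD ?bound.
Qed.

Lemma edge_le_ediam K i j : i \in K -> j \in K -> enorm (X j - X i) <= ediam (hull X K).
Proof. by move=> iK jK; apply: hull_bounded; exact: hull_vertex. Qed.

(* If the disc of centre o and radius r lies in the triangle, then an orthonormal
   frame scaled by r consists of combinations of the edges with coefficients at
   most 1; comparing areas bounds the area of the triangle from below. *)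
Lemma inradius_le i j k : i != j -> j != k -> i != k ->
  aff_indep X [set i; j; k] ->
  inradius X [set i; j; k] <= Num.sqrt (2 * enorm (cross (X j - X i) (X k - X i))).
Proof.
move=> ij jk ik ind; have N0 := indep_cross ij jk ik ind.
set e := X j - X i in N0 *; set f := X k - X i in N0 *.
set N := cross e f in N0 *; have NN : 0 < enorm N by rewrite enorm_gt0.
have e0 : 0 < enorm e.
  rewrite enorm_gt0; apply: contraNneq N0 => e0; rewrite /N e0.
  by apply/eqP/vec3P; rewrite !vecE; ring.
pose w1 := (enorm e)^-1 *: e.
pose w2 := (enorm (cross N e))^-1 *: cross N e.
have NNe : enorm (cross N e) = enorm N * enorm e.
  apply/eqP; rewrite -(eqrXn2 (n := 2)) ?enorm_ge0 ?mulr_ge0 ?enorm_ge0 // exprMn !enorm2.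
  by have := lagrange N e; rewrite cross_dotl expr0n addr0 => ->.
have w1n : enorm w1 = 1 by exact: enorm_normalized.
have w2n : enorm w2 = 1 by apply: enorm_normalized; rewrite NNe mulr_gt0.
have w12 : dot w1 w2 = 0 by rewrite dotZl dotZr (dotC e) cross_dotr !mulr0.
have w12n : enorm (cross w1 w2) = 1.
  apply/eqP; rewrite -sqrp_eq1 ?enorm_ge0 // enorm2.
  by have := lagrange w1 w2; rewrite w12 expr0n addr0 -!enorm2 w1n w2n !expr1n mulr1 => ->.
have w1s : exists b c, w1 = b *: e + c *: f.
  by exists (enorm e)^-1, 0; rewrite scale0r addr0.
have w2s : exists b c, w2 = b *: e + c *: f.
  exists (- ((enorm (cross N e))^-1 * dot f e)), ((enorm (cross N e))^-1 * dot e e).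
  by rewrite /w2 cross_crossl; apply: vec3P; rewrite !mxE; ring.
apply: ge_sup.
  exists 0; split=> //; exists (X i); first by apply: hull_vertex; rewrite !inE eqxx.
  move=> y _; rewrite le_eqVlt ltNge enorm_ge0 orbF enorm_eq0 subr_eq0 => /eqP ->.
  by apply: hull_vertex; rewrite !inE eqxx.
move=> r [r0 [q hq hr]].
have /(hull3P q ij jk ik)[b0 [c0 [b00 c00 bc0 qE]]] := hq.
have coefs w : enorm w = 1 -> (exists b c, w = b *: e + c *: f) -> exists b c,
    [/\ - 1 <= b <= 1, - 1 <= c <= 1 & r *: w = b *: e + c *: f].
  move=> w1' [b [c wE]]; have : hull X [set i; j; k] (q + r *: w).
    apply: hr; last by rewrite [q + _]addrC addrK enormZ w1' mulr1 ger0_norm.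
    apply/(lin_combP 1 _ ij jk ik); exists (b0 + r * b), (c0 + r * c).
    by rewrite qE wE -/e -/f; apply: vec3P; rewrite !mxE; ring.
  move=> /(hull3P _ ij jk ik)[b1 [c1 [b10 c10 bc1]]]; rewrite qE -/e -/f => h.
  exists (b1 - b0), (c1 - c0); split.
  - by apply/andP; move: b00 b10 c00 c10 bc0 bc1; clear; split; lra.
  - by apply/andP; move: b00 b10 c00 c10 bc0 bc1; clear; split; lra.
  have -> : r *: w = X i + b0 *: e + c0 *: f + r *: w - (X i + b0 *: e + c0 *: f).
    by rewrite [_ + r *: w]addrC addrK.
  by rewrite h; apply: vec3P; rewrite !mxE; ring.
have [b1 [c1 [/andP[b11 b12] /andP[c11 c12] E1]]] := coefs w1 w1n w1s.
have [b2 [c2 [/andP[b21 b22] /andP[c21 c22] E2]]] := coefs w2 w2n w2s.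
have : cross (r *: w1) (r *: w2) = (b1 * c2 - b2 * c1) *: N.
  by rewrite E1 E2; apply: vec3P; rewrite !vecE; ring.
rewrite crossZl crossZr scalerA => /(congr1 (@enorm R)); rewrite !enormZ w12n mulr1.
rewrite -expr2 ger0_norm ?sqr_ge0 // => h.
rewrite -(ger0_norm r0) -sqrtr_sqr ler_sqrt ?mulr_ge0 ?enorm_ge0 // h ler_pM2r //.
rewrite ler_norml; apply/andP; move: b11 b12 c11 c12 b21 b22 c21 c22; clear; split; nra.
Qed.

Lemma shape_regular i j k g : i != j -> j != k -> i != k ->
  aff_indep X [set i; j; k] -> 0 < g ->
  ediam (hull X [set i; j; k]) <= g * inradius X [set i; j; k] ->
  (2 * g ^+ 2)^-1 * ediam (hull X [set i; j; k]) ^+ 2 <=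
    enorm (cross (X j - X i) (X k - X i)).
Proof.
move=> ij jk ik ind g0 h; have := inradius_le ij jk ik ind.
set N := enorm _; have N0 : 0 <= N by exact: enorm_ge0.
move=> h2; have D0 : 0 <= ediam (hull X [set i; j; k]).
  by apply: le_trans (enorm_ge0 _) (@edge_le_ediam _ i i _ _); rewrite !inE eqxx.
have {}h : ediam (hull X [set i; j; k]) <= g * Num.sqrt (2 * N).
  by apply: le_trans h _; rewrite ler_pM2l.
rewrite ler_pdivrMl ?mulr_gt0 ?exprn_gt0 //.
have -> : 2 * g ^+ 2 * N = (g * Num.sqrt (2 * N)) ^+ 2.
  by rewrite exprMn sqr_sqrtr ?mulr_ge0 //; ring.
by rewrite ler_sqr ?nnegrE // (le_trans D0).
Qed.

End TriangleGeometry.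

(** * Inscribed circles and corners of the finite volumes *)

Section ContactAndCorner.
Variables (R : realType) (M : nat) (X : 'I_M -> vec R).
Implicit Types (i j k : 'I_M) (p q r x y w : vec R) (a b c d : R).

Lemma hull2P i j x : i != j -> hull X [set i; j] x <->
  exists b, 0 <= b <= 1 /\ x = X i + b *: (X j - X i).
Proof.
move=> ij; have sum2 (V : nmodType) (F : 'I_M -> V) :
    (forall m, m \notin [set i; j]%SET -> F m = 0) -> \sum_m F m = F i + F j.
  move=> F0; rewrite (bigD1 i) //= (bigD1 j) ?(eq_sym j) //= big1 ?addr0 // => m.
  by move=> /andP[mi mj]; apply: F0; rewrite !inE !negb_or mi mj.
split=> [[l [lge l0 lm ->]]|[b [/andP[b0 b1] ->]]].
  have F0 m : m \notin [set i; j]%SET -> l m *: X m = 0 by move=> /l0 ->; rewrite scale0r.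
  move: lm; rewrite !sum2 // => lm.
  exists (l j); split; first by have := lge i; have := lge j; lra.
  have -> : l i = 1 - l j by rewrite -lm; ring.
  by apply: vec3P; rewrite !mxE; ring.
pose l m := if m == i then 1 - b else if m == j then b else 0.
have li : l i = 1 - b by rewrite /l eqxx.
have lj : l j = b by rewrite /l eq_sym (negPf ij) eqxx.
have l0 m : m \notin [set i; j]%SET -> l m = 0.
  by rewrite !inE !negb_or /l => /andP[/negPf -> /negPf ->].
exists l; split=> //.
- by move=> p; rewrite /l; case: ifP => _; [lra|case: ifP].
- by rewrite sum2 // li lj; ring.
rewrite sum2; last by move=> p /l0 ->; rewrite scale0r.
by rewrite li lj; apply: vec3P; rewrite !mxE; ring.
Qed.

Lemma touches_lengths (o : vec R) i j p : i != j -> touches X o i j p ->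
  [/\ enorm (p - X i) + enorm (p - X j) = enorm (X j - X i),
      enorm (o - X i) ^+ 2 = enorm (p - o) ^+ 2 + enorm (p - X i) ^+ 2
    & enorm (o - X j) ^+ 2 = enorm (p - o) ^+ 2 + enorm (p - X j) ^+ 2].
Proof.
move=> ij [/(hull2P _ ij)[b [/andP[b0 b1] pE]] perp].
have e1 : p - X i = b *: (X j - X i) by rewrite pE [_ + b *: _]addrC addrK.
have e2 : p - X j = - ((1 - b) *: (X j - X i)).
  by rewrite pE; apply: vec3P; rewrite !mxE; ring.
split.
- by rewrite e1 e2 enormN !enormZ !ger0_norm ?subr_ge0 // -mulrDl addrC subrK mul1r.
- have -> : o - X i = (p - X i) - (p - o) by apply: vec3P; rewrite !mxE; ring.
  rewrite !enorm2 e1; move: perp; move: (p - o) (X j - X i) => u v uv.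
  transitivity (dot u u + dot (b *: v) (b *: v) - 2 * b * dot u v); last by rewrite uv mulr0 subr0.
  by rewrite !dotE !mxE; ring.
- have -> : o - X j = (p - X j) - (p - o) by apply: vec3P; rewrite !mxE; ring.
  rewrite !enorm2 e2; move: perp; move: (p - o) (X j - X i) => u v uv.
  transitivity (dot u u + dot (- ((1 - b) *: v)) (- ((1 - b) *: v)) + 2 * (1 - b) * dot u v);
    last by rewrite uv mulr0 addr0.
  by rewrite !dotE !mxE; ring.
Qed.

(** The incentre weights the vertices by the opposite sides a, b, c, and the tangent segments are
    half sums such as (b + c - a) / 2. Existence is what makes [contact_point], a choice with
    default 0, satisfy its specification. *)
Lemma contact_point_exists i j k : i != j -> j != k -> i != k ->
  cross (X j - X i) (X k - X i) != 0 ->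
  exists p o q r, [/\ hull X [set i; j; k] o,
    [/\ touches X o i j p, touches X o j k q & touches X o k i r],
    enorm (p - o) = enorm (q - o) & enorm (p - o) = enorm (r - o)].
Proof.
move=> ij jk ik N0; set e := X j - X i in N0 *; set f := X k - X i in N0 *.
have kj : X k - X j = f - e by rewrite /e /f; apply: vec3P; rewrite !mxE; ring.
have jE : X j = X i + e by rewrite /e addrC subrK.
have kE : X k = X i + f by rewrite /f addrC subrK.
have eE : X j - X i = e by []. have fE : X k - X i = f by [].
clearbody e f.
have N00 (u v : vec R) : u = 0 -> cross u v = 0.
  by move=> ->; apply: vec3P; rewrite !vecE; ring.
pose a := enorm (f - e); pose b := enorm f; pose c := enorm e.
have c0 : 0 < c.
  by rewrite enorm_gt0; apply: contraNneq N0 => e0; rewrite N00.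
have b0 : 0 < b.
  by rewrite enorm_gt0; apply: contraNneq N0 => f0; rewrite crossC N00 ?oppr0.
have a0 : 0 < a.
  rewrite enorm_gt0; apply: contraNneq N0 => fe0.
  have -> : cross e f = - cross (f - e) e by apply: vec3P; rewrite !vecE; ring.
  by rewrite N00 ?oppr0.
have ta : a <= b + c by exact: enormB.
have tb : b <= a + c by have := enormD (f - e) e; rewrite subrK.
have tc : c <= a + b.
  by have := enormB f (f - e); rewrite opprB addrC subrK addrC.
have E : dot e e = c ^+ 2 by rewrite enorm2.
have F : dot f f = b ^+ 2 by rewrite enorm2.
have G : dot e f = (b ^+ 2 + c ^+ 2 - a ^+ 2) / 2.
  have : a ^+ 2 = dot f f - 2 * dot e f + dot e e.
    by rewrite enorm2 dotBl !dotBr (dotC f e); ring.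
  by rewrite E F => ->; field.
pose s := a + b + c; have s0 : 0 < s by rewrite !addr_gt0.
have lin (u : vec R) al be : u = al *: e + be *: f ->
    [/\ dot u e = al * c ^+ 2 + be * ((b ^+ 2 + c ^+ 2 - a ^+ 2) / 2),
        dot u f = al * ((b ^+ 2 + c ^+ 2 - a ^+ 2) / 2) + be * b ^+ 2
      & dot u u = al ^+ 2 * c ^+ 2 + 2 * al * be * ((b ^+ 2 + c ^+ 2 - a ^+ 2) / 2)
          + be ^+ 2 * b ^+ 2].
  move=> ->; rewrite -G -E -F.
  by split; rewrite !dotE !mxE; ring.
clearbody a b c.
pose o := X i + (b / s) *: e + (c / s) *: f.
pose p := X i + ((b + c - a) / 2 / c) *: e.
pose q := X j + ((a + c - b) / 2 / a) *: (X k - X j).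
pose r := X k + ((a + b - c) / 2 / b) *: (X i - X k).
have po : p - o = ((b + c - a) / 2 / c - b / s) *: e + (- (c / s)) *: f.
  by rewrite /p /o; apply: vec3P; rewrite !mxE; ring.
have qo : q - o = (1 - (a + c - b) / 2 / a - b / s) *: e + ((a + c - b) / 2 / a - c / s) *: f.
  rewrite /q /o kj jE; move: (X i) => y.
  by apply: vec3P; rewrite !mxE; ring.
have ro : r - o = (- (b / s)) *: e + (1 - (a + b - c) / 2 / b - c / s) *: f.
  have -> : r = X i + f + ((a + b - c) / 2 / b) *: (- f) by rewrite /r kE; apply: vec3P; rewrite !mxE; ring.
  rewrite /o; move: (X i) => y.
  by apply: vec3P; rewrite !mxE; ring.
have [p1 p2 p3] := lin _ _ _ po; have [q1 q2 q3] := lin _ _ _ qo.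
have [r1 r2 r3] := lin _ _ _ ro.
have nz : [/\ a != 0, b != 0, c != 0 & s != 0] by rewrite !gt_eqF.
case: nz => a_n0 b_n0 c_n0 s_n0.
have abc_n0 : a + b + c != 0 by exact: s_n0.
exists p, o, q, r; split.
- apply/(hull3P X _ ij jk ik); exists (b / s), (c / s).
  split; [by rewrite divr_ge0 ?(ltW b0) ?(ltW s0)|by rewrite divr_ge0 ?(ltW c0) ?(ltW s0)| |by rewrite eE fE].
  by rewrite -mulrDl ler_pdivrMr // mul1r /s; move: a0; clear; lra.
- split; split.
  + apply/(hull2P _ ij); exists ((b + c - a) / 2 / c); split; last by rewrite eE.
    by rewrite ler_pdivrMr // mul1r !divr_ge0 ?(ltW c0) //=; move: ta tb tc; clear; lra.
  + by rewrite eE p1 /s; field; rewrite c_n0 abc_n0.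
  + apply/(hull2P _ jk); exists ((a + c - b) / 2 / a); split=> //.
    by rewrite ler_pdivrMr // mul1r !divr_ge0 ?(ltW a0) //=; move: ta tb tc; clear; lra.
  + by rewrite kj dotBr q1 q2 /s; field; rewrite a_n0 abc_n0.
  + have ki : k != i by rewrite eq_sym.
    apply/(hull2P _ ki); exists ((a + b - c) / 2 / b); split; last by [].
    by rewrite ler_pdivrMr // mul1r !divr_ge0 ?(ltW b0) //=; move: ta tb tc; clear; lra.
  + have fN : X i - X k = - f by rewrite -fE opprB.
    by rewrite fN dotNr r2 /s; field; rewrite b_n0 abc_n0.
- by rewrite /enorm p3 q3 /s; congr Num.sqrt; field; rewrite a_n0 c_n0 abc_n0.
- by rewrite /enorm p3 r3 /s; congr Num.sqrt; field; rewrite b_n0 c_n0 abc_n0.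
Qed.

(** Whatever contact points were chosen, Pythagoras makes the two tangent segments at each vertex
    equal, and the three side lengths then determine them. *)
Lemma contact_dist_val i j k : i != j -> j != k -> i != k ->
  cross (X j - X i) (X k - X i) != 0 ->
  contact_dist X i j k =
    (enorm (X j - X i) + enorm (X k - X i) - enorm (X k - X j)) / 2.
Proof.
move=> ij jk ik N0; have ki : k != i by rewrite eq_sym.
have := xgetPex 0 (contact_point_exists ij jk ik N0); rewrite /contact_dist.
rewrite -/(contact_point X i j k); move: (contact_point X i j k) => p [z [q [r]]].
move=> [_ [/(touches_lengths ij)[p1 p2 p3] /(touches_lengths jk)[q1 q2 q3]]].
move=> /(touches_lengths ki)[r1 r2 r3] pq pr.
rewrite -pq in q2 q3; rewrite -pr in r2 r3.
have sq x y : enorm x ^+ 2 = enorm y ^+ 2 -> enorm x = enorm y.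
  by move=> /eqP; rewrite eqrXn2 ?enorm_ge0 // => /eqP.
have e1 : enorm (p - X i) = enorm (r - X i) by apply: sq; move: p2 p3 q2 q3 r2 r3; clear; lra.
have e2 : enorm (p - X j) = enorm (q - X j) by apply: sq; move: p2 p3 q2 q3 r2 r3; clear; lra.
have e3 : enorm (q - X k) = enorm (r - X k) by apply: sq; move: p2 p3 q2 q3 r2 r3; clear; lra.
rewrite -(enormBC (X i) (X k)) -p1 -r1 -q1; move: e1 e2 e3; clear; lra.
Qed.

(** With b, c the sides at i, a the opposite one and g = [dot e f], (b + c - a)(b + c + a) = 2 (b c
    + g) and (b c + g)(b c - g) = |e x f|^2 >= (kap D^2)^2. Bounding b c - g by 2 D^2 and the
    perimeter by 3 D gives the factor kap^2 / 6. *)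
Lemma contact_dist_ge i j k D kap : i != j -> j != k -> i != k -> 0 < kap -> 0 < D ->
  kap * D ^+ 2 <= enorm (cross (X j - X i) (X k - X i)) ->
  enorm (X j - X i) <= D -> enorm (X k - X i) <= D -> enorm (X k - X j) <= D ->
  kap ^+ 2 / 6 * D <= contact_dist X i j k.
Proof.
move=> ij jk ik kap0 D0 kD cD bD aD.
have N0 : 0 < enorm (cross (X j - X i) (X k - X i)).
  by apply: lt_le_trans kD; rewrite mulr_gt0 ?exprn_gt0.
rewrite contact_dist_val -?enorm_gt0 //.
have kj : X k - X j = (X k - X i) - (X j - X i) by apply: vec3P; rewrite !mxE; ring.
rewrite kj in aD *; move: (X j - X i) (X k - X i) => e f in N0 kD cD bD aD *.
have := lagrange e f; rewrite -!enorm2 => lag.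
have a2 : enorm (f - e) ^+ 2 = enorm f ^+ 2 - 2 * dot e f + enorm e ^+ 2.
  by rewrite !enorm2 dotBl !dotBr (dotC f e); ring.
have := cauchy_schwarz e f; have := enorm_cross_le e f.
have := enorm_ge0 e; have := enorm_ge0 f; have := enorm_ge0 (f - e).
have : (kap * D ^+ 2) ^+ 2 <= enorm (cross e f) ^+ 2.
  by rewrite ler_sqr ?nnegrE ?enorm_ge0 // mulr_ge0 ?sqr_ge0 // ltW.
move: N0 lag a2 aD bD cD; move: (enorm (cross e f)) (enorm (f - e)) (enorm f) (enorm e) (dot e f).
move=> N a b c g N0 lag a2 aD bD cD kN a0 b0 c0 Nbc; rewrite ler_norml => /andP[g1 g2].
have h1 : (kap * D ^+ 2) ^+ 2 <= (c * b + g) * (2 * D ^+ 2).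
  have e1 : (c * b + g) * (c * b - g) = N ^+ 2 by rewrite (_ : N ^+ 2 = c ^+ 2 * b ^+ 2 - g ^+ 2); [ring|lra].
  apply: (le_trans kN); rewrite -e1 ler_wpM2l //; first by lra.
  have : c * b <= D * D by rewrite ler_pM.
  by rewrite expr2; lra.
have h2 : kap ^+ 2 * D ^+ 2 <= 2 * (c * b + g).
  rewrite -(ler_pM2r (exprn_gt0 2 D0)); apply: le_trans (_ : _ <= (c * b + g) * (2 * D ^+ 2)) _; last by lra.
  by rewrite [leLHS](_ : _ = (kap * D ^+ 2) ^+ 2) //; ring.
have h3 : (c + b - a) * (c + b + a) = 2 * (c * b + g).
  by rewrite -subr_sqr a2; ring.
have h4 : kap ^+ 2 * D ^+ 2 <= (c + b - a) * (3 * D).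
  have h5 : a <= c + b.
    rewrite -ler_sqr ?nnegrE ?addr_ge0 // -subr_ge0 subr_sqr h3 mulr_ge0 //; lra.
  by apply: le_trans h2 _; rewrite -h3; apply: ler_wpM2l; lra.
have : kap ^+ 2 * D <= (c + b - a) * 3.
  by rewrite -(ler_pM2r D0) -[leLHS]mulrA -expr2 -[leRHS]mulrA.
lra.
Qed.

(** The corner lies on the bisector, at X i + d / (1 + a.b) (a + b), so the quadrilateral consists
    of two right triangles with legs d and d t, t being the tangent of half the angle. *)
Lemma kite i j k d : i != j -> j != k -> i != k ->
  cross (X j - X i) (X k - X i) != 0 ->
  let a := (enorm (X j - X i))^-1 *: (X j - X i) in
  let b := (enorm (X k - X i))^-1 *: (X k - X i) in
  let t := enorm (cross a b) / (1 + dot a b) in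
  [/\ [/\ enorm a = 1, enorm b = 1 & cross a b != 0],
      quad_area (X i) (edge_point X d i j) (corner X d i j k) (edge_point X d i k)
        = d ^+ 2 * t,
      enorm (corner X d i j k - edge_point X d i j) = `|d| * t
    & enorm (corner X d i j k - edge_point X d i k) = `|d| * t].
Proof.
move=> ij jk ik N0 a b t; set e := X j - X i in N0 a t *; set f := X k - X i in N0 b t *.
have N00 (u v : vec R) : u = 0 -> cross u v = 0.
  by move=> ->; apply: vec3P; rewrite !vecE; ring.
have e0 : 0 < enorm e.
  by rewrite enorm_gt0; apply: contraNneq N0 => e0; rewrite N00.
have f0 : 0 < enorm f.
  by rewrite enorm_gt0; apply: contraNneq N0 => f0; rewrite crossC N00 ?oppr0.
have a1 : enorm a = 1 by exact: enorm_normalized.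
have b1 : enorm b = 1 by exact: enorm_normalized.
have ab0 : cross a b != 0.
  by rewrite crossZl crossZr !scaler_eq0 !invr_eq0 !gt_eqF.
have [pc t0 _ _] := half_tan a1 b1 ab0; rewrite -/t in t0.
set c := dot a b in pc t0 *.
have ea : e = enorm e *: a by rewrite scalerA mulfV ?gt_eqF ?scale1r.
have fb : f = enorm f *: b by rewrite scalerA mulfV ?gt_eqF ?scale1r.
have Pj : edge_point X d i j = X i + d *: a by rewrite /edge_point /edge_len -/e -scalerA.
have Pk : edge_point X d i k = X i + d *: b by rewrite /edge_point /edge_len -/f -scalerA.
have eE : X j - X i = e by []. have fE : X k - X i = f by [].
have aE : (enorm e)^-1 *: e = a by []. have bE : (enorm f)^-1 *: f = b by [].
clearbody a b; clearbody e f.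
have aa : dot a a = 1 by rewrite -enorm2 a1 expr1n.
have bb : dot b b = 1 by rewrite -enorm2 b1 expr1n.
have spec (q : vec R) : (dot (q - edge_point X d i j) e = 0) * (dot (q - edge_point X d i k) f = 0) ->
    dot (q - X i) a = d /\ dot (q - X i) b = d.
  move=> [h1 h2]; split.
    move: h1; rewrite Pj ea dotZr => /eqP; rewrite mulf_eq0 gt_eqF //= opprD addrA.
    by rewrite (dotBl (q - X i)) dotZl aa mulr1 subr_eq0 => /eqP.
  move: h2; rewrite Pk fb dotZr => /eqP; rewrite mulf_eq0 gt_eqF //= opprD addrA.
  by rewrite (dotBl (q - X i)) dotZl bb mulr1 subr_eq0 => /eqP.
have ex : exists q, [/\ aff_span X [set i; j; k] q,
    dot (q - edge_point X d i j) (X j - X i) = 0 &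
    dot (q - edge_point X d i k) (X k - X i) = 0].
  exists (X i + (d / (1 + c)) *: (a + b)); split.
  - apply/(lin_combP X 1 _ ij jk ik); exists (d / (1 + c) * (enorm e)^-1), (d / (1 + c) * (enorm f)^-1).
    by rewrite scale1r eE fE -!(scalerA (d / (1 + c))) aE bE -addrA -scalerDr.
  - rewrite eE Pj opprD addrACA subrr add0r ea dotZr dotBl !dotZl dotDl aa (dotC b) -/c.
    by field; rewrite gt_eqF.
  - rewrite fE Pk opprD addrACA subrr add0r fb dotZr dotBl !dotZl dotDl bb -/c.
    by field; rewrite gt_eqF.
(* [corner] is a choice; in the plane of the triangle the two orthogonality conditions determine the
   point. *)
have qE : corner X d i j k = X i + (d / (1 + c)) *: (a + b).
  have [/(lin_combP X 1 _ ij jk ik)[u [v qE]] q1 q2] := xgetPex 0 ex.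
  rewrite -/(corner X d i j k) eE in qE q1 *; rewrite -/(corner X d i j k) fE in q2; rewrite scale1r fE in qE.
  have [qa qb] := spec _ (q1, q2).
  set w := corner X d i j k - X i - (d / (1 + c)) *: (a + b).
  have wa : dot w a = 0.
    by rewrite /w dotBl qa dotZl dotDl aa (dotC b) -/c divfK ?subrr ?gt_eqF.
  have wb : dot w b = 0.
    by rewrite /w dotBl qb dotZl dotDl bb -/c [c + 1]addrC divfK ?subrr ?gt_eqF.
  have wN : dot w (cross a b) = 0.
    have -> : w = (u * enorm e - d / (1 + c)) *: a + (v * enorm f - d / (1 + c)) *: b.
      rewrite /w qE {1}ea {1}fb; by apply: vec3P; rewrite !mxE; ring.
    by rewrite dotDl !dotZl (dotC a) (dotC b) cross_dotl cross_dotr !mulr0 addr0.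
  have := frame_expansion a b w; rewrite wa wb wN !scale0r subrr addr0 => /eqP.
  rewrite scaler_eq0 dot_eq0 (negPf ab0) /= /w => /eqP w0.
  by rewrite -[LHS](subrK (X i)) -[X in X + _](subrK ((d / (1 + c)) *: (a + b))) w0 add0r addrC.
have norm2 (u v : vec R) : dot u u = 1 -> dot v v = 1 -> dot u v = c ->
    enorm (cross a b) = enorm (cross u v) ->
    enorm ((d / (1 + c)) *: (u + v) - d *: u) = `|d| * t.
  move=> uu vv uv Nuv.
  have -> : (d / (1 + c)) *: (u + v) - d *: u = (d / (1 + c)) *: (v - c *: u).
    by apply: vec3P; rewrite !mxE; field; rewrite gt_eqF.
  rewrite enormZ normrM normfV (gtr0_norm pc) /t -/c -mulrA [_^-1 * _]mulrC Nuv.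
  congr (_ * (_ / _)); apply/eqP; rewrite -(eqrXn2 (n := 2)) ?enorm_ge0 // !enorm2.
  have := lagrange u v; rewrite uu vv uv dotBl !dotBr !dotZl !dotZr uu vv uv (dotC v u) uv => h.
  by apply/eqP; lra.
have area (u v : vec R) : enorm (cross u v) = enorm (cross a b) ->
  enorm (cross (d *: u) ((d / (1 + c)) *: (u + v))) = d ^+ 2 * t.
  move=> uv; have -> : cross (d *: u) ((d / (1 + c)) *: (u + v)) = (d ^+ 2 / (1 + c)) *: cross u v.
    by apply: vec3P; rewrite !vecE; field; rewrite gt_eqF.
  rewrite enormZ ger0_norm ?divr_ge0 ?sqr_ge0 ?(ltW pc) // uv /t -/c; ring.
have Nba : enorm (cross b a) = enorm (cross a b) by rewrite crossC enormN.
split=> //.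
- rewrite /quad_area /tri_area qE Pj Pk.
  rewrite ![X i + _]addrC !addrK area // crossC enormN (addrC a b) area //.
  by field.
- by rewrite qE Pj opprD addrACA subrr add0r; exact: norm2.
- rewrite qE Pk opprD addrACA subrr add0r (addrC a b); apply: norm2 => //.
  by rewrite dotC.
Qed.

End ContactAndCorner.

(** * Vertex stars *)

Section Pigeonhole.
Variable R : realType.

(** Pigeonhole on a grid of mesh c / 4 in the cube [-1, 1]^3: points in a common cell differ by at
    most c / 4 in each coordinate, hence by at most c / 2 in Euclidean norm. *)
Lemma separated_bounded (c : R) : 0 < c -> exists N : nat,
  forall (I : eqType) (s : seq I) (u : I -> vec R), uniq s ->
  (forall k, k \in s -> enorm (u k) <= 1) ->
  (forall k l, k \in s -> l \in s -> k != l -> c <= enorm (u k - u l)) ->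
  (size s <= N)%N.
Proof.
move=> c0; pose K := 4 / c; have K0 : 0 < K by rewrite divr_gt0.
pose B := (Num.truncn (2 * K)).+1.
exists #|{ffun 'I_3 -> 'I_B}| => I s u us u1 sep.
have coord_range k i : k \in s -> 0 <= (u k 0 i + 1) * K <= 2 * K.
  move=> ks; have := le_trans (coord_le_norm (u k) i) (le_trans (norm_le_enorm _) (u1 k ks)).
  rewrite ler_norml => /andP[h1 h2]; apply/andP; split.
    by rewrite mulr_ge0 ?(ltW K0) //; lra.
  by rewrite ler_pM2r //; lra.
pose cell k : {ffun 'I_3 -> 'I_B} := [ffun i => inord (Num.truncn ((u k 0 i + 1) * K))].
have cell_inj : {in s &, injective cell}.
  move=> k l ks ls /ffunP e; apply/eqP/negPn/negP => /(sep k l ks ls).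
  apply/negP; rewrite -ltNge.
  have close i : `|(u k - u l) 0 i| <= c / 4.
    have := e i; rewrite !ffunE => /(congr1 (@nat_of_ord B)).
    have lt_trunc m : m \in s -> (Num.truncn ((u m 0 i + 1) * K)%R < B)%N.
      by move=> ms; rewrite ltnS le_truncn //; case/andP: (coord_range m i ms).
    rewrite !inordK ?lt_trunc // => et.
    have /andP[k0 _] := coord_range k i ks; have /andP[l0 _] := coord_range l i ls.
    have /andP[h1 h2] := truncn_itv k0; have /andP[h3 h4] := truncn_itv l0.
    rewrite et in h1 h2; rewrite -natr1 in h2 h4; rewrite !mxE.
    have -> : c / 4 = K^-1 by rewrite invf_div.
    rewrite -(ler_pM2r K0) mulVf ?gt_eqF // -{1}(gtr0_norm K0) -normrM ler_norml.
    by apply/andP; split; move: h1 h2 h3 h4; move: (_ %:R) => m *; lra.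
  apply: (@le_lt_trans _ _ (2 * (c / 4))); last by lra.
  by apply: enorm_le_coord close; rewrite divr_ge0 // ltW.
rewrite -(size_map cell) -(card_uniqP _); first exact: max_card.
by rewrite map_inj_in_uniq.
Qed.

End Pigeonhole.

Section StarGeometry.
Variables (R : realType) (S : evolving_surface R).
Local Notation T := (Tend S).
Variable gamma : R.
Hypothesis gamma_gt0 : 0 < gamma.

Definition shape_constant : R := (2 * gamma ^+ 2)^-1.
Local Notation kap := shape_constant.

Lemma shape_constant_gt0 : 0 < kap.
Proof. by rewrite invr_gt0 mulr_gt0 // exprn_gt0. Qed.

Section FixedMesh.
Variables (D : discretization R) (h : R).
Hypothesis reg : regular_triangulation S D gamma h.
Implicit Types (i k l : 'I_(nvert D)) (t : R).

Definition star_diam t i k : R := ediam (hull (@vtx R S D t) (star_tri i k)).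

Lemma star_triP i k : k \in star i ->
  [/\ star_tri i k \in tris D, i != k, k != next (star i) k & i != next (star i) k].
Proof.
move=> ks; have [_ _ card3 cw _] := reg.
have [us sz inot triP _] := cw i.
have nk : next (star i) k \in star i by rewrite mem_next.
have /andP[kt _] : (star_tri i k \in tris D) && (i \in star_tri i k).
  by apply/triP; exists k.
have ik : i != k by apply: contraNneq inot => e; rewrite {1}e.
have ink : i != next (star i) k by apply: contraNneq inot => e; rewrite {1}e.
split=> //; apply/eqP => e; have := card3 _ kt.
by rewrite /star_tri -e -finset.setUA finset.setUid cards2 ik.
Qed.

Lemma star_next i k : k \in star i -> next (star i) k \in star i.
Proof. by rewrite mem_next. Qed.

Lemma star_uniq i : uniq (star i).
Proof. by have [_ _ _ cw _] := reg; case: (cw i). Qed.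

Lemma star_neq0 i : exists k, k \in star i.
Proof.
have [_ _ _ cw _] := reg; have [_ sz _ _ _] := cw i.
by case: (star i) sz => // k s _; exists k; rewrite mem_head.
Qed.

Lemma vtx_Gamma t i : 0 <= t <= T -> Gamma S t (vtx S t i).
Proof. by have [_ v0 _ _ _] := reg; move=> tT; apply: flow_in_Gamma. Qed.

Lemma star_tri_indep t i k : 0 <= t <= T -> k \in star i ->
  aff_indep (@vtx R S D t) (star_tri i k).
Proof.
move=> tT /star_triP[kt _ _ _]; have [_ _ _ _ [tme _ _ _]] := reg.
by have [ind _ _ _] := tme t tT; exact: ind.
Qed.

Lemma star_shape t i k (x := @vtx R S D t) (l := next (star i) k) (d := star_diam t i k) :
  0 <= t <= T -> k \in star i ->
  [/\ 0 < d, d <= h, kap * d ^+ 2 <= enorm (cross (x k - x i) (x l - x i)),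
      enorm (x k - x i) <= d
    & enorm (x l - x i) <= d /\ enorm (x l - x k) <= d].
Proof.
move=> tT ks; have [kt ik kn in_] := star_triP ks.
have ind := star_tri_indep tT ks.
have [_ _ _ _ [_ diam_h _ shape]] := reg.
have kin : k \in star_tri i k by rewrite !inE eqxx orbT.
have iin : i \in star_tri i k by rewrite !inE eqxx.
have lin : l \in star_tri i k by rewrite !inE eqxx !orbT.
have shp := shape_regular ik kn in_ ind gamma_gt0 (shape t _ tT kt).
have ed a b := @edge_le_ediam R _ x (star_tri i k) a b.
have d0 : 0 < d.
  apply: lt_le_trans (ed i k iin kin); rewrite enorm_gt0.
  have := indep_cross ik kn in_ ind; apply: contraNneq => ->.
  by apply/eqP/vec3P; rewrite !vecE; ring.
by split=> //; [exact: diam_h | exact: ed | split; exact: ed].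
Qed.

Lemma star_edge_gt0 t i k : 0 <= t <= T -> k \in star i ->
  0 < enorm (vtx S t k - vtx S t i).
Proof.
move=> tT ks; have [_ ik kn in_] := star_triP ks.
rewrite enorm_gt0; have := indep_cross ik kn in_ (star_tri_indep tT ks).
by apply: contraNneq => ->; apply/eqP/vec3P; rewrite !vecE; ring.
Qed.

Lemma star_edge_ge t i k : 0 <= t <= T -> k \in star i ->
  kap * star_diam t i k <= enorm (vtx S t k - vtx S t i) /\
  kap * star_diam t i k <= enorm (vtx S t (next (star i) k) - vtx S t i).
Proof.
move=> tT ks; have [d0 _ kd e1 [e2 _]] := star_shape tT ks.
have cr := le_trans kd (enorm_cross_le _ _).
split; rewrite -(ler_pM2r d0) -mulrA -expr2; apply: le_trans cr _.
  by rewrite ler_wpM2l ?enorm_ge0.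
by rewrite mulrC ler_wpM2l ?enorm_ge0.
Qed.

Lemma star_diam_next t i k : 0 <= t <= T -> k \in star i ->
  star_diam t i (next (star i) k) <= kap^-1 * star_diam t i k.
Proof.
move=> tT ks; have [h1 _] := star_edge_ge tT (star_next ks).
have [_ _ _ _ [h2 _]] := star_shape tT ks.
by rewrite ler_pdivlMl ?shape_constant_gt0 //; exact: le_trans h2.
Qed.

(** Consecutive triangles share an edge, so each step around the vertex costs a factor kap^-1. The
    bound becomes uniform once the number of triangles in a star is bounded, which follows from
    [star_separated]. *)
Lemma star_diam_le t i k l : 0 <= t <= T -> k \in star i -> l \in star i ->
  star_diam t i l <= kap^-1 ^+ size (star i) * star_diam t i k.
Proof.
move=> tT ks ls; have cn := cycle_next (star_uniq i).
have kl : fconnect (next (star i)) k l by rewrite (fconnect_cycle cn ks).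
have := findex_max kl; rewrite (order_cycle cn (star_uniq i) ks).
rewrite -{2}(iter_findex kl); move: (findex _ k l) => m mle.
have [d0 _ kd e1 [e2 _]] := star_shape tT ks.
have kap1 : 1 <= kap^-1.
  rewrite invf_ge1 ?shape_constant_gt0 // -(ler_pM2r d0) mul1r.
  by apply: le_trans e1; case: (star_edge_ge tT ks).
have d_iter : iter m (next (star i)) k \in star i /\
    star_diam t i (iter m (next (star i)) k) <= kap^-1 ^+ m * star_diam t i k.
  elim: m {mle} => [|m [IH1 IH2]] /=; first by rewrite expr0 mul1r.
  split; first by rewrite mem_next.
  apply: le_trans (star_diam_next tT IH1) _.
  by rewrite exprS -mulrA ler_pM2l // invr_gt0 shape_constant_gt0.
apply: le_trans d_iter.2 _; rewrite ler_pM2r //.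
by rewrite ler_weXn2l // ltnW.
Qed.

Definition edge_dir t i k : vec R :=
  (enorm (vtx S t k - vtx S t i))^-1 *: (vtx S t k - vtx S t i).

Lemma edge_dirE t i k : 0 <= t <= T -> k \in star i ->
  enorm (edge_dir t i k) = 1 /\
  vtx S t k - vtx S t i = enorm (vtx S t k - vtx S t i) *: edge_dir t i k.
Proof.
move=> tT ks; have e0 := star_edge_gt0 tT ks; split; first exact: enorm_normalized.
by rewrite scalerA mulfV ?gt_eqF ?scale1r.
Qed.

Lemma edge_dir_cross t i k : 0 <= t <= T -> k \in star i ->
  kap <= enorm (cross (edge_dir t i k) (edge_dir t i (next (star i) k))).
Proof.
move=> tT ks; have [d0 _ kd e1 [e2 _]] := star_shape tT ks.
have p1 := star_edge_gt0 tT ks; have p2 := star_edge_gt0 tT (star_next ks).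
rewrite crossZl crossZr !enormZ !gtr0_norm ?invr_gt0 //.
rewrite mulrA -invfM [leRHS]mulrC ler_pdivlMr ?mulr_gt0 //.
apply: le_trans kd; rewrite ler_pM2l ?shape_constant_gt0 // expr2 mulrC.
by rewrite ler_pM // ltW.
Qed.

Lemma star_orientation t i k : 0 <= t <= T -> k \in star i ->
  dot (normal S (vtx S t i) t)
    (cross (vtx S t k - vtx S t i) (vtx S t (next (star i) k) - vtx S t i)) < 0.
Proof. by move=> tT ks; have [_ _ _ cw _] := reg; have [_ _ _ _] := cw i; apply. Qed.

End FixedMesh.
End StarGeometry.

(** * Separation of the edges at a vertex *)

Section Sectors.
Variable R : realType.
Implicit Types (e f v nu : vec R).

(** Cramer's rule in the frame e, f, nu. After division by the determinant on the left, the signs of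
    the first two coefficients tell whether v, seen along nu, lies in the sector between e and f. *)
Lemma cramer e f v nu : dot (cross e f) nu *: v =
  dot (cross v f) nu *: e + dot (cross e v) nu *: f + dot (cross e f) v *: nu.
Proof. by apply: vec3P; rewrite !vecE; ring. Qed.

Lemma triple_perturb (u v nu nu' : vec R) (c : R) :
  enorm u = 1 -> enorm v = 1 -> enorm (nu - nu') <= c ->
  dot (cross u v) nu <= dot (cross u v) nu' + c.
Proof.
move=> u1 v1 h; rewrite -lerBlDl -dotBr.
apply: le_trans (ler_norm _) _; apply: le_trans (triple_le _ _ _) _.
by rewrite u1 v1 !mul1r.
Qed.

Lemma triple_perturbl (u u' v nu : vec R) (c : R) :
  enorm v = 1 -> enorm nu = 1 -> enorm (u - u') <= c ->
  dot (cross u v) nu <= dot (cross u' v) nu + c.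
Proof.
move=> v1 n1 h; rewrite -lerBlDl -dotBl -crossBl.
apply: le_trans (ler_norm _) _; apply: le_trans (triple_le _ _ _) _.
by rewrite v1 n1 !mulr1.
Qed.

End Sectors.

Section StarSeparation.
Variables (R : realType) (S : evolving_surface R).
Local Notation T := (Tend S).
Variable gamma : R.
Hypothesis gamma_gt0 : 0 < gamma.
Local Notation kap := (shape_constant gamma).

Section FixedMesh.
Variables (D : discretization R) (h : R).
Hypothesis reg : regular_triangulation S D gamma h.
Implicit Types (i k l m : 'I_(nvert D)) (t : R).

(* Otherwise a point of the edge towards l and a point of the triangle at m lie
   on the same normal line, contradicting the injectivity of the projection. *)
Lemma star_sector r0 t i m l s y rho a b g :
  (forall t x y r, 0 <= t <= T -> nhd S t x -> Gamma S t y ->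
     x = y + r *: normal S y t -> `|r| <= r0 -> surf_proj S x t = y) ->
  0 <= t <= T -> m \in star i -> l \in star i -> l != m -> l != next (star i) m ->
  0 < s <= 1 -> Gamma S t y ->
  vtx S t i + s *: (vtx S t l - vtx S t i) = y + rho *: normal S y t ->
  vtx S t l - vtx S t i = a *: (vtx S t m - vtx S t i)
    + b *: (vtx S t (next (star i) m) - vtx S t i) + g *: normal S y t ->
  0 <= a -> 0 <= b -> s * (a + b) <= 1 -> `|rho| <= r0 -> `|rho - s * g| <= r0 ->
  False.
Proof.
move=> proj tT ms ls lm lnm /andP[s0 s1] Gy xE elE a0 b0 sab rho0 rhog.
have [mt im mn in_] := star_triP reg ms.
have [lt il ln iln] := star_triP reg ls.
set x := vtx S t i + _ in xE; set nu := normal S y t in xE elE.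
pose x' := vtx S t i + (s * a) *: (vtx S t m - vtx S t i)
   + (s * b) *: (vtx S t (next (star i) m) - vtx S t i).
have hx : hull (@vtx R S D t) (star_tri i l) x.
  apply/(hull3P _ _ il ln iln); exists s, 0.
  by split=> //; [exact: ltW | rewrite addr0 | rewrite scale0r addr0].
have hx' : hull (@vtx R S D t) (star_tri i m) x'.
  apply/(hull3P _ _ im mn in_); exists (s * a), (s * b).
  by split=> //; rewrite ?mulr_ge0 ?(ltW s0) // -mulrDr.
have [_ _ _ _ [/(_ t tT)[ind meet sub_nhd [[_ inj _] _ _]] _ _ _]] := reg.
have Ghx : Gamma_h S D t x by exists (star_tri i l).
have Ghx' : Gamma_h S D t x' by exists (star_tri i m).
have x'E : x' = y + (rho - s * g) *: nu.
  rewrite scalerBl addrA -xE /x elE /x'; apply: vec3P; rewrite !mxE; ring.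
have px : surf_proj S x t = y by exact: (proj _ _ _ _ tT (sub_nhd _ Ghx) Gy xE rho0).
have px' : surf_proj S x' t = y by exact: (proj _ _ _ _ tT (sub_nhd _ Ghx') Gy x'E rhog).
have xx' : x = x' by apply: inj; rewrite ?inE // px px'.
(* The common point would lie in the hull of the common vertices, which do not include l; but its
   weight at l is s > 0, and weights are unique by affine independence. *)
have lnot : l \notin star_tri i m.
  by rewrite !inE !negb_or (eq_sym l i) il lm lnm.
have KK : star_tri i l != star_tri i m.
  by apply: contraNneq lnot => <-; rewrite !inE eqxx orbT.
have : hull (@vtx R S D t) (star_tri i l :&: star_tri i m)%SET x.
  by rewrite -(meet _ _ lt mt KK); split=> //; rewrite xx'.
move=> [c [_ c0 c1 cx]].
pose w j := if j == l then s else if j == i then 1 - s else 0 : R.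
have wl : w l = s by rewrite /w eqxx.
have wi : w i = 1 - s by rewrite /w (negPf il) eqxx.
have w0 j : j \notin [set i; l]%SET -> w j = 0.
  by rewrite !inE !negb_or /w => /andP[/negPf -> /negPf ->].
have sum2 (V : nmodType) (F : 'I_(nvert D) -> V) :
    (forall m, m \notin [set i; l]%SET -> F m = 0) -> \sum_m F m = F i + F l.
  move=> F0; rewrite (bigD1 i) //= (bigD1 l) ?(eq_sym l) //= big1 ?addr0 // => p.
  by move=> /andP[pi pl]; apply: F0; rewrite !inE !negb_or pi pl.
have := ind _ lt (fun j => w j - c j) _ _ _ l; rewrite wl.
have -> : c l = 0 by apply: c0; rewrite !inE !negb_and; apply/orP; right; move: lnot; rewrite !inE.
rewrite subr0 => hs; suff s_eq0 : s = 0 by rewrite s_eq0 ltxx in s0.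
apply: hs.
- move=> j jl; rewrite c0 ?subr0; last by rewrite inE negb_and jl.
  by apply: w0; apply: contra jl; rewrite !inE => /orP[] ->; rewrite ?orbT.
- by rewrite sumrB c1 sum2 // wi wl; ring.
- under eq_bigr do rewrite scalerBl.
  rewrite sumrB -cx sum2; last by move=> j /w0 ->; rewrite scale0r.
  by rewrite wi wl /x; apply: vec3P; rewrite !mxE; ring.
Qed.

End FixedMesh.

Lemma frame_normal_star : exists2 C, 0 < C & forall D h t i k y,
  regular_triangulation S D gamma h -> 0 <= t <= T -> k \in star i ->
  Gamma S t y ->
  `|dot (normal S y t) (vtx S t k - vtx S t i)|
    <= C * (enorm (vtx S t i - y) + h) * enorm (@vtx R S D t k - vtx S t i).
Proof.
have [C C0 hC] := normal_estimate S; exists (2 * C); first by rewrite mulr_gt0.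
move=> D h t i k y reg tT ks Gy.
have := hC t t (vtx S t k) (vtx S t i) y tT tT (vtx_Gamma reg k tT) (vtx_Gamma reg i tT) Gy.
rewrite subrr normr0 addr0 => hh; apply: le_trans hh _.
rewrite [leRHS](_ : _ = C * enorm (vtx S t k - vtx S t i) *
  (2 * (enorm (vtx S t i - y) + h))); last by ring.
rewrite ler_wpM2l ?mulr_ge0 ?enorm_ge0 ?(ltW C0) //.
have [_ dh _ e1 _] := star_shape gamma_gt0 reg tT ks.
have := enorm_ge0 (vtx S t k - vtx S t i).
have := enorm_dist3 (vtx S t k) (vtx S t i) y; lra.
Qed.

(** Adjacent directions are separated by shape regularity. If the direction to a non-adjacent l were
    within kap / 8 of that to k, it would point, seen along the normal, into one of the two
    triangles sharing the edge from i to k, and [star_sector] would apply. The sign of one triple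
    product decides which triangle; the other required sign follows from the orientation of
    consecutive edges, since a perturbation by kap / 8 cannot change it. *)
Lemma star_separated : exists h1 c : R, [/\ 0 < h1, 0 < c & forall D h t i k l,
  regular_triangulation S D gamma h -> h < h1 -> 0 <= t <= T ->
  k \in star i -> l \in star i -> k != l ->
  c <= enorm (@edge_dir R S D t i k - edge_dir S t i l)].
Proof.
have kap0 := shape_constant_gt0 gamma_gt0.
have [r0 r00 proj] := surf_proj_unique S.
have [C C0 hC] := frame_normal_star.
pose c := Num.min kap (kap / 8).
(* The bounds serve, in this order, the closeness of triangle normals to surface normals, |rho| <=
   r0, and the displacement along the normal inside the sector. *)
pose h1 := Num.min (Num.min (kap ^+ 2 / (64 * 3 * C)) (r0 / 2)) (r0 / 2 * (kap / 4)).
have h10 : 0 < h1 by rewrite !lt_min !divr_gt0 ?mulr_gt0 ?divr_gt0 ?exprn_gt0.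
exists h1, c; split=> //; first by rewrite lt_min kap0 divr_gt0.
move=> D h t i k l reg; rewrite !lt_min => /andP[/andP[h_1 h_2] h_3] tT ks ls kl.
have edge j : j \in star i -> enorm (edge_dir S t i j) = 1 /\
    vtx S t j - vtx S t i = enorm (vtx S t j - vtx S t i) *: edge_dir S t i j.
  by move=> js; exact: (edge_dirE reg).
have next_far j : j \in star i ->
    kap <= enorm (edge_dir S t i j - edge_dir S t i (next (star i) j)).
  move=> js; apply: le_trans (edge_dir_cross gamma_gt0 reg tT js) _.
  have [j1 _] := edge j js; have [j2 _] := edge _ (star_next js).
  have -> : cross (edge_dir S t i j) (edge_dir S t i (next (star i) j)) =
      cross (edge_dir S t i j) (edge_dir S t i (next (star i) j) - edge_dir S t i j).
    by apply: vec3P; rewrite !vecE; ring.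
  by apply: le_trans (enorm_cross_le _ _) _; rewrite j1 mul1r enormBC.
have [->|lnk] := eqVneq l (next (star i) k).
  by apply: le_trans (next_far k ks); rewrite ge_min lexx.
set km := prev (star i) k.
have kms : km \in star i by rewrite mem_prev.
have kmk : next (star i) km = k by rewrite next_prev ?(star_uniq reg).
have [lkm|lkm] := eqVneq l km.
  rewrite enormBC lkm -[in X in _ - X]kmk; apply: le_trans (next_far km kms).
  by rewrite ge_min lexx.
rewrite leNgt; apply/negP => close.
have {}close : enorm (edge_dir S t i l - edge_dir S t i k) <= kap / 8.
  by rewrite enormBC ltW // (lt_le_trans close) // ge_min lexx orbT.
set kp := next (star i) k in lnk.
have kps : kp \in star i by rewrite mem_next.
have [_ dh _ el_h _] := star_shape gamma_gt0 reg tT ls.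
have {}el_h := le_trans el_h dh.
have h0 : 0 <= h := le_trans (enorm_ge0 _) el_h.
have epos j : j \in star i -> 0 < enorm (vtx S t j - vtx S t i).
  by move=> js; exact: (star_edge_gt0 reg tT js).
(* The point x is taken so close to vertex i that its shadow along the normal stays in the
   neighbouring triangle even if the edges there are short: the coefficients of the direction to l
   are at most 4 / kap. *)
pose mu := Num.min (enorm (vtx S t km - vtx S t i))
  (Num.min (enorm (vtx S t k - vtx S t i)) (enorm (vtx S t kp - vtx S t i))).
have mu0 : 0 < mu by rewrite !lt_min !epos.
have hpos : 0 < h := lt_le_trans (epos l ls) el_h.
pose s := Num.min 1 (kap / 4 * mu / (2 * h)).
have s0 : 0 < s by rewrite lt_min ltr01 divr_gt0 ?mulr_gt0 // divr_gt0.
have s1 : s <= 1 by rewrite ge_min lexx.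
have smu : s * (2 * h) <= kap / 4 * mu.
  by rewrite -ler_pdivlMr ?mulr_gt0 // ge_min lexx orbT.
pose x := vtx S t i + s *: (vtx S t l - vtx S t i).
have nx : nhd S t x.
  have [_ _ _ _ [/(_ t tT)[_ _ sub_nhd _] _ _ _]] := reg.
  apply: sub_nhd; have [lt il ln iln] := star_triP reg ls.
  exists (star_tri i l) => //; apply/(hull3P _ _ il ln iln); exists s, 0.
  by split=> //; [exact: ltW | rewrite addr0 | rewrite scale0r addr0].
have [Gy [rho xE] ymin] := surf_proj_nearest tT nx.
set y := surf_proj S x t in Gy xE ymin.
have [nu1 _ _] := Defs.normalP tT Gy.
have [nu01 _ _] := Defs.normalP tT (vtx_Gamma reg i tT).
have xi : enorm (x - vtx S t i) <= h.
  rewrite /x [_ + s *: _]addrC addrK enormZ gtr0_norm //.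
  by apply: le_trans el_h; rewrite ler_piMl ?enorm_ge0.
have xy : enorm (x - y) <= h by apply: le_trans (ymin _ (vtx_Gamma reg i tT)) xi.
have rho_h : `|rho| <= h.
  by move: xy; rewrite {1}xE [y + _]addrC addrK enormZ nu1 mulr1.
have yi : enorm (vtx S t i - y) <= 2 * h.
  by have := enorm_dist3 (vtx S t i) x y; rewrite (enormBC (vtx S t i) x); move: xi xy; clear -S gamma_gt0; lra.
pose de := 3 * C * h.
have de0 : 0 <= de by rewrite !mulr_ge0 // ltW.
have de_small : 4 / kap * de <= kap / 16.
  have : h * (64 * 3 * C) < kap ^+ 2 by rewrite -ltr_pdivlMr ?mulr_gt0.
  move=> hh; rewrite mulrAC ler_pdivrMr // /de.
  by move: hh; rewrite expr2; clear -S gamma_gt0; lra.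
set nu := normal S y t in nu1 xE; set nu0 := normal S (vtx S t i) t in nu01.
have fn j (z : vec R) : j \in star i -> Gamma S t z -> enorm (vtx S t i - z) <= 2 * h ->
    enorm (normal S z t) = 1 ->
    let n := (enorm (cross (vtx S t j - vtx S t i) (vtx S t (next (star i) j) - vtx S t i)))^-1
       *: cross (vtx S t j - vtx S t i) (vtx S t (next (star i) j) - vtx S t i) in
    (0 <= dot (normal S z t) n -> enorm (normal S z t - n) <= kap / 16) /\
    (dot (normal S z t) n <= 0 -> enorm (normal S z t + n) <= kap / 16).
  move=> js Gz zi z1 n.
  have [d0 dh' kd e1 [e2 _]] := star_shape gamma_gt0 reg tT js.
  have est p : p \in star i -> enorm (vtx S t p - vtx S t i) <= star_diam S t i j ->
      `|dot (normal S z t) (vtx S t p - vtx S t i)| <= de * star_diam S t i j.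
    move=> ps pd; apply: le_trans (hC _ _ _ _ _ _ reg tT ps Gz) _.
    apply: ler_pM; rewrite ?enorm_ge0 ?mulr_ge0 ?addr_ge0 ?enorm_ge0 ?(ltW C0) //.
    by rewrite /de (_ : 3 * C * h = C * (3 * h)); [rewrite ler_pM2l //; move: zi; clear -S gamma_gt0; lra | ring].
  have [f1 f2] := frame_normal kap0 d0 de0 kd e1 e2 z1 (est _ js e1) (est _ (star_next js) e2).
  by split=> [/f1|/f2] /le_trans; apply.
pose nrm j := (enorm (cross (vtx S t j - vtx S t i) (vtx S t (next (star i) j) - vtx S t i)))^-1
       *: cross (vtx S t j - vtx S t i) (vtx S t (next (star i) j) - vtx S t i).
have ii : enorm (vtx S t i - vtx S t i) <= 2 * h by rewrite subrr enorm0 mulr_ge0.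
have crossP j : j \in star i ->
    0 < enorm (cross (vtx S t j - vtx S t i) (vtx S t (next (star i) j) - vtx S t i)).
  move=> js; have [d0 _ kd _ _] := star_shape gamma_gt0 reg tT js.
  by apply: lt_le_trans kd; rewrite mulr_gt0 ?exprn_gt0.
have nu0n j : j \in star i -> enorm (nu0 + nrm j) <= kap / 16.
  move=> js; have [_ n2] := fn j _ js (vtx_Gamma reg i tT) ii nu01; apply: n2.
  rewrite dotZr mulr_ge0_le0 ?invr_ge0 ?(ltW (crossP j js)) //.
  by apply/ltW; exact: (star_orientation reg tT js).
have orient j : j \in star i ->
    dot (cross (edge_dir S t i j) (edge_dir S t i (next (star i) j))) nu0 <= - (kap / 2).
  move=> js; have kW := edge_dir_cross gamma_gt0 reg tT js.
  have [j1 _] := edge j js; have [jn1 _] := edge _ (star_next js).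
  have W1 := enorm_cross_le (edge_dir S t i j) (edge_dir S t i (next (star i) j)).
  rewrite j1 jn1 mulr1 in W1; set W := cross _ _ in kW W1 *.
  have WE : W = enorm W *: nrm j.
    rewrite /W crossZl crossZr !enormZ !gtr0_norm ?invr_gt0 ?epos ?star_next //.
    by rewrite /nrm !scalerA; congr (_ *: _); rewrite !mulrA mulfK ?gt_eqF ?crossP.
  have nn : dot (nrm j) (nrm j) = 1 := dot_normalized (crossP j js).
  have n1 : enorm (nrm j) = 1 := enorm_normalized (crossP j js).
  have dn : dot (nrm j) nu0 <= - 2^-1.
    have -> : dot (nrm j) nu0 = dot (nu0 + nrm j) (nrm j) - 1.
      by rewrite dotDl nn addrK dotC.
    have := le_trans (ler_norm _) (cauchy_schwarz (nu0 + nrm j) (nrm j)).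
    have := nu0n j js; have k1 := le_trans kW W1.
    by rewrite n1 mulr1; move: k1; clear -S gamma_gt0; lra.
  rewrite {1}WE dotZl; move: (enorm W) (dot _ _) kap0 kW W1 dn; clear => p q *; nra.
(* The plane of a triangle fixes the normal at y only up to sign, and both signs give the same
   normal line; [nu'] is the one close to the normal at the vertex. *)
have [nu' [sg sgE nu'E] nu'0] : exists2 nu' : vec R,
    (exists2 sg : R, `|sg| = 1 & nu' = sg *: nu) & enorm (nu' - nu0) <= kap / 8.
  have [f1 f2] := fn k y ks Gy yi nu1; have n0 := nu0n k ks.
  have [s_ge0|s_lt0] := leP 0 (dot nu (nrm k)).
    exists (- nu); first by exists (-1); rewrite ?normrN1 ?scaleN1r.
    have -> : - nu - nu0 = - ((nu - nrm k) + (nu0 + nrm k)).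
      by apply: vec3P; rewrite !mxE; ring.
    rewrite enormN; apply: le_trans (enormD _ _) _.
    have := f1 s_ge0; rewrite -/(nrm k) -/nu; move: n0; clear -S gamma_gt0; lra.
  exists nu; first by exists 1; rewrite ?normr1 ?scale1r.
  have -> : nu - nu0 = (nu + nrm k) - (nu0 + nrm k).
    by apply: vec3P; rewrite !mxE; ring.
  apply: le_trans (enormB _ _) _.
  have := f2 (ltW s_lt0); rewrite -/(nrm k) -/nu; move: n0; clear -S gamma_gt0; lra.
have nu'1 : enorm nu' = 1 by rewrite nu'E enormZ sgE nu1 mulr1.
have orient' j : j \in star i ->
    dot (cross (edge_dir S t i j) (edge_dir S t i (next (star i) j))) nu' <= - (kap / 4).
  move=> js; have [j1 _] := edge j js; have [j2 _] := edge _ (star_next js).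
  have := triple_perturb j1 j2 nu'0; have := orient j js; move: kap0; clear -S gamma_gt0; lra.
have hit j : j \in star i -> l != j -> l != next (star i) j ->
    mu <= enorm (vtx S t j - vtx S t i) ->
    mu <= enorm (vtx S t (next (star i) j) - vtx S t i) ->
    dot (cross (edge_dir S t i l) (edge_dir S t i (next (star i) j))) nu' <= 0 ->
    dot (cross (edge_dir S t i j) (edge_dir S t i l)) nu' <= 0 -> False.
  move=> js lj ljn mu1 mu2 Da Db; have Dj := orient' j js.
  have [j1 jE] := edge j js; have [jn1 jnE] := edge _ (star_next js).
  have [l1 lE] := edge l ls.
  have jp := epos j js; have jnp := epos _ (star_next js); have lp := epos l ls.
  set el := enorm (vtx S t l - vtx S t i) in lE el_h lp.
  set ej := enorm (vtx S t j - vtx S t i) in jE mu1 jp.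
  set en := enorm (vtx S t (next (star i) j) - vtx S t i) in jnE mu2 jnp.
  set wj := edge_dir S t i j in Dj Db j1 jE.
  set wn := edge_dir S t i (next (star i) j) in Dj Da jn1 jnE.
  set wl := edge_dir S t i l in Da Db l1 lE.
  set den := dot (cross wj wn) nu' in Dj.
  have den0 : den < 0 by apply: le_lt_trans Dj _; rewrite oppr_lt0 divr_gt0.
  pose al := dot (cross wl wn) nu' / den; pose be := dot (cross wj wl) nu' / den.
  pose ga := dot (cross wj wn) wl / den.
  have wlE : wl = al *: wj + be *: wn + ga *: nu'.
    have := cramer wj wn wl nu'; rewrite -/den => /(congr1 (fun v : vec R => den^-1 *: v)).
    rewrite scalerA mulVf ?lt_eqF // scale1r !scalerDr !scalerA.
    by rewrite !(mulrC den^-1).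
  have al0 : 0 <= al by rewrite /al mulr_le0 // invr_le0 ltW.
  have be0 : 0 <= be by rewrite /be mulr_le0 // invr_le0 ltW.
  have bound (q : R) : `|q| <= 1 -> `|q / den| <= 4 / kap.
    move=> q1; rewrite normrM normfV (ltr0_norm den0) ler_pdivrMr ?oppr_gt0 //.
    have e4 : 4 / kap * (kap / 4) = 1 by field; rewrite gt_eqF.
    apply: le_trans q1 _; apply: (@le_trans _ _ (4 / kap * (kap / 4))); first by rewrite e4.
    by rewrite ler_pM2l ?divr_gt0 // lerNr.
  have tl u v w : enorm u = 1 -> enorm v = 1 -> enorm w = 1 -> `|dot (cross u v) w| <= 1.
    by move=> u1 v1 w1; apply: le_trans (triple_le _ _ _) _; rewrite u1 v1 w1 !mulr1.
  have al1 : al <= 4 / kap by apply: le_trans (ler_norm _) _; apply: bound; exact: tl.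
  have be1 : be <= 4 / kap by apply: le_trans (ler_norm _) _; apply: bound; exact: tl.
  have ga1 : `|ga| <= 4 / kap by apply: bound; exact: tl.
  apply: (@star_sector D h reg r0 t i j l s y rho (el / ej * al) (el / en * be) (el * ga * sg)) => //.
  - by rewrite s0 s1.
  - rewrite lE jE jnE wlE nu'E -/nu; move: jp jnp lp; clear -S gamma_gt0 => *.
    by apply: vec3P; rewrite !mxE; field; rewrite !gt_eqF.
  - by rewrite mulr_ge0 // divr_ge0 // ltW.
  - by rewrite mulr_ge0 // divr_ge0 // ltW.
  - have coef (p q : R) : mu <= p -> 0 <= q -> q <= 4 / kap -> s * (el / p * q) <= 2^-1.
      move=> mup q0 q1; have p0 : 0 < p by apply: lt_le_trans mup.
      apply: (@le_trans _ _ (s * (h / mu * (4 / kap)))).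
        rewrite ler_pM2l //; apply: ler_pM => //; first by rewrite divr_ge0 // ltW.
        by apply: ler_pM; rewrite ?invr_ge0 ?lef_pV2 ?posrE ?(ltW lp) ?(ltW p0).
      rewrite (_ : _ * _ = s * (2 * h) * (2 / kap) / mu); last by field; rewrite !gt_eqF.
      rewrite ler_pdivrMr //; apply: (@le_trans _ _ (kap / 4 * mu * (2 / kap))).
        by rewrite ler_pM2r // divr_gt0.
      by rewrite (_ : _ * _ = 2^-1 * mu) //; field; rewrite gt_eqF.
    have := coef ej al mu1 al0 al1; have := coef en be mu2 be0 be1.
    by rewrite mulrDr; clear -S gamma_gt0; lra.
  - by apply: le_trans rho_h _; apply: ltW; apply: lt_trans h_2 _; move: r00; clear -S gamma_gt0; lra.
  - apply: le_trans (ler_normB _ _) _.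
    have hsg : `|s * (el * ga * sg)| <= h * (4 / kap).
      rewrite [leLHS](_ : _ = s * el * `|ga|); last first.
        by rewrite !normrM sgE mulr1 (gtr0_norm s0) (gtr0_norm lp); ring.
      have sel : s * el <= h by apply: le_trans el_h; rewrite ler_piMl // ltW.
      have sel0 : 0 <= s * el by rewrite mulr_ge0 // ltW.
      exact: (ler_pM sel0 (normr_ge0 _) sel ga1).
    have h4 : h * (4 / kap) <= r0 / 2.
      by rewrite mulrA ler_pdivrMr //; move: h_3; clear -S gamma_gt0; lra.
    by have := lerD rho_h hsg; move: h4 h_2; clear -S gamma_gt0; lra.
have Dclose (u : vec R) : enorm u = 1 ->
    dot (cross (edge_dir S t i l) u) nu' <= dot (cross (edge_dir S t i k) u) nu' + kap / 8.
  by move=> u1; exact: triple_perturbl.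
have [k1 _] := edge k ks; have [kp1 _] := edge kp kps; have [km1 _] := edge km kms.
have swap (u v : vec R) : dot (cross u v) nu' = - dot (cross v u) nu'.
  by rewrite crossC dotNl.
(* In clockwise order the triple products of consecutive edges are negative: a nonpositive sign
   places l between k and its successor, a positive one between the predecessor of k and k. *)
have [sgn|sgn] := leP (dot (cross (edge_dir S t i k) (edge_dir S t i l)) nu') 0.
  apply: (hit k) => //; first by rewrite eq_sym.
  - by rewrite /mu !ge_min lexx orbT.
  - by rewrite /mu !ge_min lexx !orbT.
  have := Dclose _ kp1; have := orient' k ks; rewrite -/kp; move: kap0; clear -S gamma_gt0; lra.
apply: (hit km) => //; rewrite ?kmk //; first by rewrite eq_sym.
- by rewrite /mu ge_min lexx.
- by rewrite /mu !ge_min lexx orbT.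
- by rewrite swap oppr_le0 ltW.
have := Dclose _ km1; have := orient' km kms; rewrite kmk.
rewrite (swap (edge_dir S t i km) (edge_dir S t i l)) (swap (edge_dir S t i km)).
have : dot (cross (edge_dir S t i km) (edge_dir S t i l)) nu' <=
    dot (cross (edge_dir S t i km) (edge_dir S t i k)) nu' + kap / 8.
  rewrite crossC (crossC (edge_dir S t i km)) !dotNl.
  have := @triple_perturbl R _ _ _ _ _ km1 nu'1 (_ : enorm (edge_dir S t i k - edge_dir S t i l) <= kap / 8).
  rewrite enormBC => /(_ close); clear -S gamma_gt0; lra.
rewrite (swap (edge_dir S t i km) (edge_dir S t i l)) (swap (edge_dir S t i km)); move: kap0; clear -S gamma_gt0; lra.
Qed.

End StarSeparation.

(** * Finite volumes *)

Section StarComparability.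
Variables (R : realType) (S : evolving_surface R).
Local Notation T := (Tend S).
Variable gamma : R.
Hypothesis gamma_gt0 : 0 < gamma.
Local Notation kap := (shape_constant gamma).

(** Unit directions separated by c are at most N in number, so [star_diam_le] applies with a fixed
    exponent; the maximum with 1 makes the powers monotone. *)
Lemma star_comparable : exists h1 L : R, [/\ 0 < h1, 0 < L & forall D h t i k l,
  regular_triangulation S D gamma h -> h < h1 -> 0 <= t <= T ->
  k \in star i -> l \in star i ->
  @star_diam R S D t i l <= L * star_diam S t i k].
Proof.
have kap0 := shape_constant_gt0 gamma_gt0.
have [h1 [c [h10 c0 sep]]] := star_separated S gamma_gt0.
have [N hN] := separated_bounded c0.
pose M := Num.max 1 kap^-1; have M1 : 1 <= M by rewrite le_max lexx.
exists h1, (M ^+ N); split=> //; first by rewrite exprn_gt0 // (lt_le_trans ltr01).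
move=> D h t i k l reg hh tT ks ls.
apply: le_trans (star_diam_le gamma_gt0 reg tT ks ls) _.
have [d0 _ _ _ _] := star_shape gamma_gt0 reg tT ks.
rewrite ler_pM2r //; apply: (@le_trans _ _ (M ^+ size (star i))).
  have kM : kap^-1 <= M by rewrite le_max lexx orbT.
  have k0 : 0 <= kap^-1 by rewrite invr_ge0 ltW.
  by apply: lerXn2r => //; rewrite nnegrE //; exact: le_trans kM.
apply: ler_weXn2l => //; apply: (hN _ _ (edge_dir S t i)).
- exact: (star_uniq reg).
- by move=> j js; have [-> _] := edge_dirE reg tT js.
- by move=> j m js ms jm; exact: (sep _ _ _ _ _ _ reg hh tT js ms jm).
Qed.

End StarComparability.

Section TriangleGradient.
Variables (R : realType) (M : nat) (X : 'I_M -> vec R).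

(** [tri_grad] is a choice with default 0, so an in-plane gradient has to be exhibited first; the
    vector g0 of an affine function may have a component normal to the triangle. *)
Lemma tri_grad_spec (i j k : 'I_M) (f : vec R -> R) :
  i != j -> j != k -> i != k -> cross (X j - X i) (X k - X i) != 0 ->
  affine_on X [set i; j; k] f ->
  let g := tri_grad X [set i; j; k] f in
  [/\ dot g (cross (X j - X i) (X k - X i)) = 0,
      dot g (X j - X i) = f (X j) - f (X i)
    & dot g (X k - X i) = f (X k) - f (X i)].
Proof.
move=> ij jk ik N0 [g0 [c0 fE]].
have hv m : m \in [set i; j; k]%SET -> hull X [set i; j; k] (X m) by exact: hull_vertex.
have hi := hv i _; have hj := hv j _; have hk := hv k _.
rewrite !inE !eqxx ?orbT in hi hj hk.
have {}hi := hi isT; have {}hj := hj isT; have {}hk := hk isT.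
have [g [[a [b gE]] g1 g2]] := span_expansion (dot g0 (X j - X i)) (dot g0 (X k - X i)) N0.
have ex : exists g, direction X [set i; j; k] g /\ forall x y,
    hull X [set i; j; k] x -> hull X [set i; j; k] y -> f x - f y = dot g (x - y).
  exists g; split.
    by apply/(lin_combP X 0 _ ij jk ik); exists a, b; rewrite scale0r add0r.
  move=> x y hx hy; rewrite !fE //.
  have /(hull3P X _ ij jk ik)[b1 [c1 [_ _ _ ->]]] := hx.
  have /(hull3P X _ ij jk ik)[b2 [c2 [_ _ _ ->]]] := hy.
  set e := X j - X i in g1 g2 *; set h := X k - X i in g1 g2 *.
  have -> : X i + b1 *: e + c1 *: h - (X i + b2 *: e + c2 *: h) = (b1 - b2) *: e + (c1 - c2) *: h.
    by clearbody e h; apply: vec3P; rewrite !mxE; ring.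
  rewrite (dotDr _ _ g) !(dotZr _ _ g) g1 g2; clearbody e h.
  by rewrite !dotDr !dotZr; ring.
have [/(lin_combP X 0 _ ij jk ik)[a' [b' g'E]] gf] := xgetPex 0 ex.
move=> g'; rewrite -/(tri_grad X [set i; j; k] f) -/g' scale0r add0r in g'E gf.
split; [|by rewrite gf|by rewrite gf].
by rewrite g'E dotDl !dotZl (dotC (X j - X i)) (dotC (X k - X i)) cross_dotl cross_dotr !mulr0 addr0.
Qed.

End TriangleGradient.

Section Volumes.
Variables (R : realType) (S : evolving_surface R).
Local Notation T := (Tend S).
Variables (gamma h : R) (D : discretization R) (n : nat).
Hypothesis gamma_gt0 : 0 < gamma.
Hypothesis reg : regular_triangulation S D gamma h.
Hypothesis tT : 0 <= tgrid D n <= T.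
Local Notation kap := (shape_constant gamma).
Local Notation t := (tgrid D n).
Implicit Types (i k l : 'I_(nvert D)).

(** Tangent of half the angle at i ([half_tan]). By [star_volumes] the areas and face lengths of the
    volume are d^2 and d times such tangents, which serve as the weights of the scheme. *)
Definition star_tan i k : R :=
  enorm (cross (edge_dir S t i k) (edge_dir S t i (next (star i) k)))
    / (1 + dot (edge_dir S t i k) (edge_dir S t i (next (star i) k))).

Lemma star_cross_neq0 i k : k \in star i ->
  cross (vtxn S n k - vtxn S n i) (vtxn S n (next (star i) k) - vtxn S n i) != 0.
Proof.
move=> ks; have [_ ik kn in_] := star_triP reg ks.
exact: indep_cross ik kn in_ (star_tri_indep reg tT ks).
Qed.

Lemma vol_dist_ge i c : (forall k, k \in star i -> c <= contact S n i k) ->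
  c <= vol_dist S n i.
Proof.
move=> hc; apply: lb_le_inf.
  by have [k ks] := star_neq0 reg i; exists (contact S n i k), k.
by move=> _ [k ks <-]; exact: hc.
Qed.

(** d is an infimum over all triangles of the star, so it is compared with the diameter of one
    triangle through the comparability constant L. *)
Lemma vol_dist_lower i k L : 0 < L -> k \in star i ->
  (forall l, l \in star i -> star_diam S t i k <= L * star_diam S t i l) ->
  kap ^+ 2 / (6 * L) * star_diam S t i k <= vol_dist S n i.
Proof.
move=> L0 ks hL; have kap0 := shape_constant_gt0 gamma_gt0.
apply: vol_dist_ge => l ls; have [lt il ln iln] := star_triP reg ls.
have [d0 _ kd e1 [e2 e3]] := star_shape gamma_gt0 reg tT ls.
apply: le_trans (contact_dist_ge il ln iln kap0 d0 kd e1 e2 e3).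
rewrite (_ : kap ^+ 2 / (6 * L) * _ = kap ^+ 2 / 6 * (star_diam S t i k / L)); last first.
  by field; rewrite gt_eqF.
have c0 : 0 < kap ^+ 2 / 6 by rewrite divr_gt0 ?exprn_gt0.
rewrite (ler_pM2l c0) ler_pdivrMr // mulrC; exact: hL.
Qed.

Lemma star_volumes i k : k \in star i -> 0 <= vol_dist S n i ->
  [/\ 0 < star_tan i k, vol_part S n i k = vol_dist S n i ^+ 2 * star_tan i k,
      hR S n i k = vol_dist S n i * star_tan i k
    & hL S n i k = vol_dist S n i * star_tan i (prev (star i) k)].
Proof.
move=> ks d0; have [_ ik kn in_] := star_triP reg ks.
have [[a1 b1 ab0] area r1 _] := kite (vol_dist S n i) ik kn in_ (star_cross_neq0 ks).
have ps : prev (star i) k \in star i by rewrite mem_prev.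
have [_ ip pn ipn] := star_triP reg ps.
have [_ _ _ r2] := kite (vol_dist S n i) ip pn ipn (star_cross_neq0 ps).
have [_ t0 _ _] := half_tan a1 b1 ab0.
rewrite (next_prev (star_uniq reg i)) in r2.
split=> //; first by rewrite /hR r1 ger0_norm.
rewrite /hL r2 ger0_norm // /star_tan; congr (_ * _).
by rewrite (next_prev (star_uniq reg i)).
Qed.

Lemma big_next (V : nmodType) i (F : 'I_(nvert D) -> V) :
  \sum_(k <- star i) F (next (star i) k) = \sum_(k <- star i) F k.
Proof.
have us := star_uniq reg i; rewrite -(big_map (next (star i)) xpredT F).
apply: perm_big; apply: uniq_perm => //.
  by rewrite map_inj_in_uniq // => k l _ _; exact: (can_inj (prev_next us)).
move=> k; apply/mapP/idP => [[l ls ->]|ks]; first by rewrite mem_next.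
by exists (prev (star i) k); rewrite ?mem_prev ?next_prev.
Qed.

(* The discrete fluxes telescope around the vertex up to the deviation eta of the
   triangle normals from nu. *)
Lemma flux_bound i (p nu : vec R) (eta : R) : 0 <= eta ->
  (forall k, k \in star i -> enorm (nu +
     (enorm (cross (edge_dir S t i k) (edge_dir S t i (next (star i) k))))^-1 *:
      cross (edge_dir S t i k) (edge_dir S t i (next (star i) k))) <= eta) ->
  `|\sum_(k <- star i) dot p (edge_dir S t i k) * (star_tan i (prev (star i) k) + star_tan i k)|
   <= 2 * eta * enorm p * \sum_(k <- star i) star_tan i k.
Proof.
move=> eta0 hn; have us := star_uniq reg i.
have -> : \sum_(k <- star i) dot p (edge_dir S t i k) *
    (star_tan i (prev (star i) k) + star_tan i k) =
    \sum_(k <- star i) dot p (star_tan i k *: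
      (edge_dir S t i k + edge_dir S t i (next (star i) k))).
  under eq_bigr do rewrite mulrDr.
  rewrite big_split /= -(big_next i (fun k => dot p (edge_dir S t i k) * star_tan i (prev (star i) k))).
  rewrite -big_split /=; apply: eq_bigr => k _.
  by rewrite (prev_next us) dotZr dotDr; ring.
(* The added terms are differences of successive values around the vertex and sum to zero. By
   [half_tan] they turn the vector paired with p into (nu + n_k) x (w_k - w_(k+1)), where w_k is the
   direction of edge k and n_k the unit normal; its length is at most 2 eta times the tangent. *)
have -> : \sum_(k <- star i) dot p (star_tan i k *:
      (edge_dir S t i k + edge_dir S t i (next (star i) k))) =
   \sum_(k <- star i) dot p (star_tan i k *:
      (edge_dir S t i k + edge_dir S t i (next (star i) k)) +
      cross nu (edge_dir S t i k - edge_dir S t i (next (star i) k))).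
  under [RHS]eq_bigr do rewrite dotDr crossBr dotBr.
  rewrite big_split /= sumrB.
  by rewrite (big_next i (fun k => dot p (cross nu (edge_dir S t i k)))) subrr addr0.
have bound k : k \in star i -> `|dot p (star_tan i k *:
      (edge_dir S t i k + edge_dir S t i (next (star i) k)) +
      cross nu (edge_dir S t i k - edge_dir S t i (next (star i) k)))|
    <= 2 * eta * enorm p * star_tan i k.
  move=> ks; have [a1 _] := edge_dirE reg tT ks; have [b1 _] := edge_dirE reg tT (star_next ks).
  have ab0 : cross (edge_dir S t i k) (edge_dir S t i (next (star i) k)) != 0.
    rewrite -enorm_gt0.
    exact: (lt_le_trans (shape_constant_gt0 gamma_gt0) (edge_dir_cross gamma_gt0 reg tT ks)).
  have [_ t0 le2 ->] := half_tan a1 b1 ab0.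
  rewrite -/(star_tan i k) in t0 le2; rewrite -crossDl addrC.
  apply: le_trans (cauchy_schwarz _ _) _.
  rewrite (_ : 2 * eta * enorm p * _ = enorm p * (eta * (2 * star_tan i k))); last by ring.
  rewrite ler_wpM2l ?enorm_ge0 //; apply: le_trans (enorm_cross_le _ _) _.
  by apply: ler_pM; rewrite ?enorm_ge0 // [X in enorm X]addrC addrC hn.
rewrite mulr_sumr !big_seq; apply: le_trans (ler_norm_sum _ _ _) _.
by apply: ler_sum.
Qed.

End Volumes.

(** * Nodal basis *)

Section NodalBasis.
Variables (R : realType) (S : evolving_surface R).
Local Notation T := (Tend S).
Variables (gamma h : R) (D : discretization R) (t : R).
Hypothesis reg : regular_triangulation S D gamma h.
Hypothesis tT : 0 <= t <= T.
Implicit Types (i j k m : 'I_(nvert D)) (K : {set 'I_(nvert D)}) (l : 'I_(nvert D) -> R).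
Local Notation X := (@vtx R S D t).

Definition barycentric K l (x : vec R) :=
  [/\ forall i, 0 <= l i, forall i, i \notin K -> l i = 0, \sum_i l i = 1
    & x = \sum_i l i *: X i].

Let mesh : [/\ forall K, K \in tris D -> aff_indep X K
  & forall K K', K \in tris D -> K' \in tris D -> K != K' ->
      hull X K `&` hull X K' = hull X (K :&: K')%SET].
Proof. by have [_ _ _ _ [/(_ t tT)[]]] := reg. Qed.

Lemma barycentric_eq K l l' x : aff_indep X K ->
  barycentric K l x -> barycentric K l' x -> l = l'.
Proof.
move=> ind [_ l0 l1 lx] [_ l'0 l'1 l'x]; apply/funext => i; apply/eqP.
rewrite -subr_eq0; apply/eqP; apply: (ind (fun i => l i - l' i)).
- by move=> m mK; rewrite l0 // l'0 // subrr.
- by rewrite sumrB l1 l'1 subrr.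
- under eq_bigr do rewrite scalerBl.
  by rewrite sumrB -lx -l'x subrr.
Qed.

Lemma barycentric_sub K K' l x : K \subset K' -> barycentric K l x -> barycentric K' l x.
Proof.
move=> KK' [l_ge l0 l1 lx]; split=> // i iK'; apply: l0.
by apply: contra iK'; exact: (fintype.subsetP KK' i).
Qed.

(** A point of two triangles lies in the hull of their common vertices, and its weights there are
    its weights in both. Hence a function read off from barycentric weights is well defined across
    triangles. *)
Lemma barycentric_unique K K' l l' x : K \in tris D -> K' \in tris D ->
  barycentric K l x -> barycentric K' l' x -> l = l'.
Proof.
have [ind meet] := mesh; move=> KT K'T lK l'K'.
have [KK'|KK'] := eqVneq K K'.
  by rewrite -KK' in l'K'; exact: (barycentric_eq (ind _ KT) lK l'K').
have : hull X (K :&: K')%SET x by rewrite -meet //; split; [exists l | exists l'].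
move=> [m mx]; have mK : barycentric K m x by apply: barycentric_sub mx; exact: finset.subsetIl.
have mK' : barycentric K' m x by apply: barycentric_sub mx; exact: finset.subsetIr.
rewrite (barycentric_eq (ind _ KT) lK mK).
exact: (barycentric_eq (ind _ K'T) mK' l'K').
Qed.

Lemma tris_star K : K \in tris D -> exists i k, k \in star i /\ K = star_tri i k.
Proof.
move=> KT; have [_ _ card3 cw _] := reg.
have /set0Pn[i iK] : K != finset.set0.
  by apply/eqP => e; have := card3 K KT; rewrite e cards0.
have [_ _ _ triP _] := cw i; exists i.
by have [|k ks ->] := (triP K).1; [rewrite KT | exists k].
Qed.

Lemma tris_vertices K : K \in tris D -> exists i j k,
  [/\ i != j, j != k, i != k, cross (X j - X i) (X k - X i) != 0 & K = [set i; j; k]%SET].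
Proof.
move=> KT; have [i [k [ks KE]]] := tris_star KT.
have [_ ik kn in_] := star_triP reg ks.
exists i, k, (next (star i) k); split=> //.
exact: indep_cross ik kn in_ (star_tri_indep reg tT ks).
Qed.

Lemma vertex_in_tris i : exists2 K, K \in tris D & i \in K.
Proof.
have [k ks] := star_neq0 reg i; have [kt _ _ _] := star_triP reg ks.
by exists (star_tri i k); rewrite // !inE eqxx.
Qed.

Lemma vtx_Gamma_h i : Gamma_h S D t (X i).
Proof.
by have [K KT iK] := vertex_in_tris i; exists K => //; exact: hull_vertex.
Qed.

Lemma affine_on_hull K f l x : affine_on X K f -> barycentric K l x ->
  f x = \sum_i l i * f (X i).
Proof.
move=> [g [c fE]] lK; have [l_ge l0 l1 xE] := lK.
have hx : hull X K x by exists l.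
rewrite fE // xE (_ : c = \sum_i l i * c); last by rewrite -mulr_suml l1 mul1r.
have -> : dot g (\sum_i l i *: X i) = \sum_i l i * dot g (X i).
  by elim/big_rec2: _ => [|i y z _ <-]; rewrite ?dot0r // dotDr dotZr.
rewrite -big_split /=; apply: eq_bigr => i _.
have [iK|/l0 ->] := boolP (i \in K); last by rewrite !mul0r addr0.
by rewrite fE ?mulrDr //; exact: hull_vertex.
Qed.

Lemma affine_from_barycentric K f (v : 'I_(nvert D) -> R) : K \in tris D ->
  (forall l x, barycentric K l x -> f x = \sum_i l i * v i) -> affine_on X K f.
Proof.
move=> KT fE; have [i [j [k [ij jk ik N0 KE]]]] := tris_vertices KT.
have [g [_ g1 g2]] := span_expansion (v j - v i) (v k - v i) N0.
exists g, (v i - dot g (X i)) => x [l lK]; rewrite (fE l) //.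
have [l_ge l0 l1 ->] := lK; rewrite KE in l0.
have s3 (V : nmodType) (F : 'I_(nvert D) -> V) :=
  @sum_support3 _ V F i j k ij jk ik.
rewrite s3 => [|m /l0 ->]; last by rewrite mul0r.
rewrite s3 => [|m /l0 ->]; last by rewrite scale0r.
have {}l1 : l i = 1 - l j - l k.
  by move: l1; rewrite s3 // => <-; ring.
have vj : v j = v i + (dot g (X j) - dot g (X i)) by rewrite -dotBr g1 addrC subrK.
have vk : v k = v i + (dot g (X k) - dot g (X i)) by rewrite -dotBr g2 addrC subrK.
by rewrite vj vk !dotDr !dotZr l1; ring.
Qed.

Lemma hull_closed K : K \in tris D -> closed (hull X K).
Proof.
move=> KT; have [i [j [k [ij jk ik N0 KE]]]] := tris_vertices KT.
apply: compact_closed; first exact: norm_hausdorff.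
set e := X j - X i; set f := X k - X i.
(* The triangle is the image of the unit square under (b, c) -> X i + b (1 - c) e + b c f, which
   collapses the side b = 0 to a vertex. *)
have -> : hull X K = (fun p : R * R => X i + (p.1 * (1 - p.2)) *: e + (p.1 * p.2) *: f) @`
    (`[0, 1]%classic `*` `[0, 1]%classic).
  apply/seteqP; split=> [x|x [[b c] [/=]]].
    rewrite KE => /(hull3P X x ij jk ik)[b [c [b0 c0 bc ->]]].
    have [bc0|bc0] := eqVneq (b + c) 0.
      exists (0, 0); first by split; rewrite /= in_itv /= lexx ler01.
      have [-> ->] : b = 0 /\ c = 0 by split; lra.
      by rewrite /= !mul0r.
    have bcp : 0 < b + c by rewrite lt_neqAle eq_sym bc0 addr_ge0.
    exists (b + c, c / (b + c)).
      split; rewrite /= in_itv /=; first by rewrite addr_ge0.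
      by rewrite divr_ge0 ?addr_ge0 // ler_pdivrMr // mul1r lerDr.
    by rewrite /= -/e -/f; congr (_ + _ *: _ + _ *: _); field.
  rewrite !in_itv /= => /andP[b0 b1] /andP[c0 c1] <-.
  rewrite KE; apply/(hull3P X _ ij jk ik); exists (b * (1 - c)), (b * c).
  by split=> //; rewrite ?mulr_ge0 ?subr_ge0 // -mulrDr subrK mulr1.
apply: continuous_compact; last by apply: compact_setX; exact: segment_compact.
apply: continuous_subspaceT => p.
have d1 (q : R * R) : differentiable (fst : R * R -> R) q.
  by apply: linear_differentiable => y; exact: cvg_fst.
have d2 (q : R * R) : differentiable (snd : R * R -> R) q.
  by apply: linear_differentiable => y; exact: cvg_snd.
have c1 : {for p, continuous (fun p : R * R => p.1 * (1 - p.2))}.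
  apply: differentiable_continuous; apply: differentiableM => //.
  exact: differentiableB.
have c2 : {for p, continuous (fun p : R * R => p.1 * p.2)}.
  by apply: differentiable_continuous; apply: differentiableM.
have cc (v : vec R) : {for p, continuous (fun _ : R * R => v)} by exact: cvg_cst.
have z1 := continuousZ c1 (cc e); have z2 := continuousZ c2 (cc f).
exact: (continuousD (continuousD (cc (X i)) z1) z2).
Qed.

(* The affine pieces live on finitely many closed sets, so they paste continuously. *)
Lemma fe_space_affine f : (forall K, K \in tris D -> affine_on X K f) ->
  fe_space S D t f.
Proof.
move=> fK; split=> //; apply/subspace_continuousP => x [K0 K0T hx0].
apply/cvgrPdist_lt => e e0; rewrite /prop_near1 /within /=.
have near_r : \forall r \near 0^'+, forall K, K \in tris D -> forall y,
    `|x - y| < r -> hull X K y -> `|f x - f y| < e.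
  apply: filter_forall => K.
  suff [d d0 hd] : exists2 d, 0 < d & K \in tris D -> forall y,
      `|x - y| < d -> hull X K y -> `|f x - f y| < e.
    near=> r => KT y hy; apply: hd => //; apply: lt_le_trans hy _.
    by near: r; exact: nbhs_right_le.
  have [KT|KT] := boolP (K \in tris D); last by exists 1.
  have [hx|hx] := pselect (hull X K x); last first.
    have oC : open (~` hull X K) by apply: closed_openC; exact: hull_closed.
    have /nbhs_ballP[d /= d0 hd] := open_nbhs_nbhs (conj oC hx).
    by exists d => // _ y hy /hd[]; rewrite -ball_normE.
  have [g [c fE]] := fK K KT.
  have g0 : 0 < enorm g + 1 by rewrite ltr_wpDl ?enorm_ge0.
  exists (e / (2 * (enorm g + 1))); first by rewrite divr_gt0 // mulr_gt0.
  move=> _ y hxy hy; rewrite !fE // opprD addrACA subrr addr0 -dotBr.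
  apply: le_lt_trans (cauchy_schwarz _ _) _.
  apply: (@le_lt_trans _ _ ((enorm g + 1) * (2 * `|x - y|))).
    by apply: ler_pM; rewrite ?enorm_ge0 ?enorm_le_norm // lerDl.
  by move: hxy; rewrite ltr_pdivlMr ?mulr_gt0 //; lra.
have [r [r0 hr]] := filter_ex (filterI (nbhs_right_gt 0) near_r).
apply/nbhs_ballP; exists r => //= y; rewrite -ball_normE => hy [K KT hKy].
exact: hr hy hKy.
Unshelve. all: by end_near. Qed.

(** The hat function at i reads off the barycentric weight of i in any triangle containing the
    point. This existence proof is what gives the chosen [nodal_basis] its properties. *)
Lemma nodal_basisP i : fe_space S D t (nodal_basis S t i) /\
  forall j, nodal_basis S t i (X j) = (j == i)%:R.
Proof.
apply: (@xgetPex _ (fun=> 0) [set f | fe_space S D t f /\ forall j, f (X j) = (j == i)%:R]).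
pose P x := [set l | exists2 K, K \in tris D & barycentric K l x].
pose f x := xget (fun=> 0) (P x) i.
have fE K l x : K \in tris D -> barycentric K l x -> f x = l i.
  move=> KT lK; have [K' K'T l'K'] := @xgetPex _ (fun=> 0) (P x) (ex_intro _ l (ex_intro2 _ _ K KT lK)).
  by rewrite /f (barycentric_unique K'T KT l'K' lK).
have fv j : f (X j) = (j == i)%:R.
  have [K KT jK] := vertex_in_tris j.
  rewrite (fE K (fun m => (m == j)%:R)) ?(eq_sym i) //.
  split.
  - by move=> m; rewrite ler0n.
  - by move=> m mK; case: eqP => // e; rewrite e jK in mK.
  - by rewrite (bigD1 j) //= eqxx big1 ?addr0 // => m /negPf ->.
  - rewrite (bigD1 j) //= eqxx scale1r big1 ?addr0 // => m /negPf ->.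
    by rewrite scale0r.
exists f; split=> //; apply: fe_space_affine => K KT.
apply: (@affine_from_barycentric K f (fun j => (j == i)%:R) KT) => l x lK.
rewrite (fE K l) // (bigD1 i) //= eqxx mulr1 big1 ?addr0 // => m /negPf ->.
by rewrite mulr0.
Qed.

Definition interpolant (v : 'I_(nvert D) -> R) : vec R -> R :=
  fun x => \sum_i v i * nodal_basis S t i x.

Lemma interpolant_vtx v j : interpolant v (X j) = v j.
Proof.
rewrite /interpolant (bigD1 j) //= (nodal_basisP j).2 eqxx mulr1 big1 ?addr0 // => m mj.
by rewrite (nodal_basisP m).2 eq_sym (negPf mj) mulr0.
Qed.

Lemma interpolant_affine v K : K \in tris D -> affine_on X K (interpolant v).
Proof.
move=> KT; apply: (@affine_from_barycentric K _ v KT) => l x lK; rewrite /interpolant.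
apply: eq_bigr => i _; rewrite (affine_on_hull ((nodal_basisP i).1.2 K KT) lK) mulrC.
congr (_ * _); rewrite (bigD1 i) //= (nodal_basisP i).2 eqxx mulr1 big1 ?addr0 // => m mi.
by rewrite (nodal_basisP i).2 (negPf mi) mulr0.
Qed.

Lemma interpolant_fe_space v : fe_space S D t (interpolant v).
Proof. by apply: fe_space_affine => K KT; exact: interpolant_affine. Qed.

Lemma interpolant_le v w : (forall i, v i <= w i) ->
  forall x, Gamma_h S D t x -> interpolant v x <= interpolant w x.
Proof.
move=> vw x [K KT [l lK]].
rewrite (affine_on_hull (interpolant_affine v KT) lK).
rewrite (affine_on_hull (interpolant_affine w KT) lK).
apply: ler_sum => i _; rewrite !interpolant_vtx ler_wpM2l //.
by case: lK.
Qed.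

End NodalBasis.

(** * Consistency of the scheme *)

Section Consistency.
Variables (R : realType) (S : evolving_surface R).
Local Notation T := (Tend S).
Variable gamma : R.
Hypothesis gamma_gt0 : 0 < gamma.
Local Notation kap := (shape_constant gamma).

Definition eps_bound (C1 : R) (D : discretization R) := forall n i, (n < nstep D)%N ->
  0 < eps (d:=D) n i <= C1 * \big[Num.max/0]_(k <- star i) tri_diam S n i k.

Lemma grid_range (D : discretization R) n : time_partition S D -> (n <= nstep D)%N ->
  0 <= tgrid D n <= T.
Proof.
move=> [t0 tN lt_t] nN.
have mono m k : (m + k <= nstep D)%N -> tgrid D m <= tgrid D (m + k)%N.
  elim: k => [|k IH]; first by rewrite addn0.
  rewrite addnS => h; apply: le_trans (IH (ltnW h)) _.
  by apply: ltW; exact: lt_t.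
rewrite -t0 -tN; apply/andP; split.
  by have := mono 0%N n; rewrite add0n; exact.
by have := mono n (nstep D - n)%N; rewrite subnKC //; apply.
Qed.

(** The mesh condition bounds eps by the largest triangle of the star, while d is the smallest
    contact distance; comparability within the star closes the gap. The ratio eps / d scales the
    diffusion term. *)
Lemma eps_vol_dist (C1 : R) : 0 < C1 -> exists h1 Ce : R, [/\ 0 < h1, 0 < Ce &
  forall D h n i, regular_triangulation S D gamma h -> h < h1 ->
    time_partition S D -> eps_bound C1 D -> (n < nstep D)%N ->
    0 < vol_dist S n i /\ eps (d:=D) n i <= Ce * vol_dist S n i].
Proof.
move=> C10; have kap0 := shape_constant_gt0 gamma_gt0.
have [h1 [L [h10 L0 comp]]] := star_comparable S gamma_gt0.
have Le : 0 < 6 * L / kap ^+ 2 by rewrite divr_gt0 ?mulr_gt0 ?exprn_gt0.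
exists h1, (C1 * L * (6 * L / kap ^+ 2)); split=> //.
  exact: (mulr_gt0 (mulr_gt0 C10 L0) Le).
move=> D h n i reg hh tp epsb nN; have tT := grid_range tp (ltnW nN).
have [k ks] := star_neq0 reg i.
have [d0 _ _ _ _] := star_shape gamma_gt0 reg tT ks.
have low := vol_dist_lower gamma_gt0 reg tT L0 ks
  (fun l ls => comp D h _ i l k reg hh tT ls ks).
have c0 : 0 < kap ^+ 2 / (6 * L) by rewrite divr_gt0 ?mulr_gt0 ?exprn_gt0.
split; first by apply: lt_le_trans low; rewrite mulr_gt0.
have /andP[_ e1] := epsb n i nN; apply: le_trans e1 _.
rewrite [leRHS](_ : _ = C1 * (L * (6 * L / kap ^+ 2 * vol_dist S n i))); last by ring.
rewrite ler_pM2l //.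
have maxle : \big[Num.max/0]_(k <- star i) tri_diam S n i k <= L * star_diam S (tgrid D n) i k.
  rewrite big_seq; apply: bigmax_le => [|l ls]; first by rewrite mulr_ge0 // ltW.
  exact: (comp _ _ _ _ _ _ reg hh tT ks ls).
apply: le_trans maxle _; rewrite ler_pM2l //.
rewrite [leLHS](_ : _ = 6 * L / kap ^+ 2 *
   (kap ^+ 2 / (6 * L) * star_diam S (tgrid D n) i k)); last first.
  by field; rewrite !gt_eqF.
by rewrite (ler_pM2l Le).
Qed.

(** [frame_normal] is applied with D = 1 to the unit edge directions. The plus sign reflects the
    clockwise order: the normalized cross products approximate the inward normal. *)
Lemma vertex_normal_close : exists2 C, 0 < C & forall D h t i k,
  regular_triangulation S D gamma h -> 0 <= t <= T -> k \in star i ->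
  enorm (normal S (@vtx R S D t i) t +
   (enorm (cross (edge_dir S t i k) (edge_dir S t i (next (star i) k))))^-1 *:
      cross (edge_dir S t i k) (edge_dir S t i (next (star i) k))) <= C * h.
Proof.
have kap0 := shape_constant_gt0 gamma_gt0.
have [C C0 hC] := frame_normal_star S gamma_gt0.
exists (4 / kap * C); first by rewrite mulr_gt0 // divr_gt0.
have eqW (a b : R) : a = b -> a <= b by move=> ->.
move=> D h t i k reg tT ks; have Gi := vtx_Gamma reg i tT.
have [nu1 _ _] := Defs.normalP tT Gi; set nu := normal S _ t in nu1 *.
have [dk dh _ _ _] := star_shape gamma_gt0 reg tT ks; have h0 := ltW (lt_le_trans dk dh).
have est p : p \in star i -> `|dot nu (edge_dir S t i p)| <= C * h * 1.
  move=> ps; have e0 := star_edge_gt0 reg tT ps.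
  have := hC D h t i p (vtx S t i) reg tT ps Gi; rewrite subrr enorm0 add0r.
  rewrite -ler_pdivrMr // mulr1 /edge_dir -/nu dotZr normrM gtr0_norm ?invr_gt0 //.
  by rewrite mulrC.
have [p1 _] := edge_dirE reg tT ks; have [p2 _] := edge_dirE reg tT (star_next ks).
have kd : kap * 1 ^+ 2 <= enorm (cross (edge_dir S t i k) (edge_dir S t i (next (star i) k))).
  by rewrite expr1n mulr1; exact: (edge_dir_cross gamma_gt0 reg tT ks).
have [_] := frame_normal kap0 ltr01 (mulr_ge0 (ltW C0) h0) kd (eqW _ _ p1) (eqW _ _ p2)
  nu1 (est _ ks) (est _ (star_next ks)).
rewrite -[4 / kap * C * h]mulrA; apply.
rewrite dotZr mulr_ge0_le0 ?invr_ge0 ?enorm_ge0 //.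
rewrite crossZl crossZr !dotZr !mulr_ge0_le0 ?invr_ge0 ?enorm_ge0 //.
by apply: ltW; exact: (star_orientation reg tT ks).
Qed.

End Consistency.

(** * The scheme as an operator on nodal values *)

Section SchemeOperator.
Variables (R : realType) (S : evolving_surface R).
Local Notation T := (Tend S).
Variable gamma : R.
Hypothesis gamma_gt0 : 0 < gamma.
Local Notation kap := (shape_constant gamma).
Variables (L1 L2 : R) (H : vec R * R -> vec R -> R).
Hypothesis hH : hamiltonian S L1 L2 H.
Variable C1 : R.
Hypothesis C1_gt0 : 0 < C1.

(** The braces of the scheme as a function of nodal values, so that one step is a_i - tau op(a)_i
    ([scheme_coefE]). *)
Definition scheme_op (D : discretization R) n (a : 'I_(nvert D) -> R) i : R :=
  \sum_(k <- star i) vol_part S n i k / vol S n i *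
     H (vtxn S n i, tgrid D n) (tri_grad (vtxn S n) (star_tri i k) (interpolant S (tgrid D n) a))
  - eps n i / vol S n i *
    \sum_(k <- star i) (a k - a i) / edge_len (vtxn S n) i k * (hL S n i k + hR S n i k).

Lemma scheme_coefE (D : discretization R) h n (a : 'I_(nvert D) -> R) i :
  regular_triangulation S D gamma h -> 0 <= tgrid D n <= T ->
  scheme_coef S H n (interpolant S (tgrid D n) a) i = a i - tau D n * scheme_op n a i.
Proof.
move=> reg tT; rewrite /scheme_coef /scheme_op.
have e k : interpolant S (tgrid D n) a (vtxn S n k) = a k := interpolant_vtx reg tT a k.
by under [X in _ - eps n i / _ * X]eq_bigr do rewrite !e; rewrite e.
Qed.

Section AtVertex.
Variables (D : discretization R) (h : R) (n : nat) (i : 'I_(nvert D)).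
Hypothesis reg : regular_triangulation S D gamma h.
Hypothesis tT : 0 <= tgrid D n <= T.
Hypothesis vd_gt0 : 0 < vol_dist S n i.
Local Notation t := (tgrid D n).
Local Notation d := (vol_dist S n i).

Let Theta := \sum_(k <- star i) star_tan S n i k.

Let star_tan_gt0 k : k \in star i -> 0 < star_tan S n i k.
Proof. by move=> ks; have [] := star_volumes reg tT ks (ltW vd_gt0). Qed.

Let Theta_gt0 : 0 < Theta.
Proof.
have [k ks] := star_neq0 reg i; rewrite /Theta (big_rem k) //=.
apply: ltr_pwDl; first exact: star_tan_gt0.
by rewrite big_seq; apply: sumr_ge0 => l /mem_rem ls; apply: ltW; exact: star_tan_gt0.
Qed.

Let volE : vol S n i = d ^+ 2 * Theta.
Proof.
rewrite /vol /Theta mulr_sumr !big_seq; apply: eq_bigr => k ks.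
by have [_ ->] := star_volumes reg tT ks (ltW vd_gt0).
Qed.

(** The weights are the shares of one volume, positive with sum 1, so a bound on each triangle
    passes to the average. *)
Lemma hamiltonian_average (F : 'I_(nvert D) -> R) (Hb E : R) :
  (forall k, k \in star i -> `|F k - Hb| <= E) ->
  `|\sum_(k <- star i) vol_part S n i k / vol S n i * F k - Hb| <= E.
Proof.
move=> hF; have w k : k \in star i ->
    vol_part S n i k / vol S n i = star_tan S n i k / Theta.
  move=> ks; have [_ -> _ _] := star_volumes reg tT ks (ltW vd_gt0).
  by rewrite volE; field; rewrite !gt_eqF.
rewrite big_seq; under eq_bigr => k ks do rewrite w //; rewrite -big_seq.
have s1 : \sum_(k <- star i) star_tan S n i k / Theta = 1.
  by rewrite -mulr_suml divff // gt_eqF.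
rewrite -[Hb]mul1r -s1 mulr_suml -sumrB.
apply: le_trans (ler_norm_sum _ _ _) _; rewrite -[leRHS]mul1r -s1 mulr_suml.
rewrite !big_seq; apply: ler_sum => k ks.
have c0 : 0 <= star_tan S n i k / Theta by rewrite divr_ge0 // ltW // star_tan_gt0.
by rewrite -mulrBr normrM (ger0_norm c0); apply: ler_wpM2l => //; exact: hF.
Qed.

(** The area of the volume is d^2 times the sum of the tangents and the face lengths carry one
    factor d, so the prefactor is eps / d, bounded by [Ce]. *)
Lemma diffusion_le Ce (g : 'I_(nvert D) -> R) (E : R) : 0 <= Ce -> 0 < eps n i ->
  eps n i <= Ce * d ->
  `|\sum_(k <- star i) g k * (star_tan S n i (prev (star i) k) + star_tan S n i k)|
     <= E * Theta ->
  `|eps n i / vol S n i * \sum_(k <- star i) g k * (hL S n i k + hR S n i k)| <= Ce * E.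
Proof.
move=> Ce0 eps0 epsC hg.
have -> : \sum_(k <- star i) g k * (hL S n i k + hR S n i k) =
   d * \sum_(k <- star i) g k * (star_tan S n i (prev (star i) k) + star_tan S n i k).
  rewrite mulr_sumr !big_seq; apply: eq_bigr => k ks.
  by have [_ _ -> ->] := star_volumes reg tT ks (ltW vd_gt0); ring.
have V0 : 0 < d ^+ 2 * Theta by rewrite mulr_gt0 // exprn_gt0.
have c0 : 0 <= eps n i / (d ^+ 2 * Theta) by rewrite divr_ge0 // ltW.
rewrite volE normrM (ger0_norm c0) normrM (gtr0_norm vd_gt0).
apply: (@le_trans _ _ (Ce * d / (d ^+ 2 * Theta) * (d * (E * Theta)))).
  apply: ler_pM => //.
  - by rewrite mulr_ge0 // ltW.
  - by rewrite ler_pM2r // invr_gt0.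
  - by rewrite ler_pM2l.
by rewrite [leLHS](_ : _ = Ce * E) //; field; rewrite !gt_eqF.
Qed.

Lemma star_tan_sum_le (g : 'I_(nvert D) -> R) (E : R) :
  (forall k, k \in star i -> `|g k| <= E) ->
  `|\sum_(k <- star i) g k * (star_tan S n i (prev (star i) k) + star_tan S n i k)|
     <= 2 * E * Theta.
Proof.
move=> hg; have us := star_uniq reg i.
have -> : 2 * E * Theta =
    \sum_(k <- star i) E * (star_tan S n i (prev (star i) k) + star_tan S n i k).
  have e : \sum_(k <- star i) star_tan S n i (prev (star i) k) = Theta.
    rewrite -(big_next reg i (fun k => star_tan S n i (prev (star i) k))).
    by apply: eq_bigr => k _; rewrite (prev_next us).
  by rewrite -mulr_sumr big_split /= e -/Theta; ring.
apply: le_trans (ler_norm_sum _ _ _) _; rewrite !big_seq; apply: ler_sum => k ks.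
have p0 : 0 < star_tan S n i (prev (star i) k) by apply: star_tan_gt0; rewrite mem_prev.
have t0 := star_tan_gt0 ks.
rewrite normrM (ger0_norm (addr_ge0 (ltW p0) (ltW t0))).
by apply: ler_wpM2r; [rewrite addr_ge0 // ltW | exact: hg].
Qed.

Lemma interpolant_grad a k : k \in star i ->
  let q := tri_grad (vtxn S n) (star_tri i k) (interpolant S t a) in
  let l := next (star i) k in
  [/\ dot q (cross (vtxn S n k - vtxn S n i) (vtxn S n l - vtxn S n i)) = 0,
      dot q (vtxn S n k - vtxn S n i) = a k - a i
    & dot q (vtxn S n l - vtxn S n i) = a l - a i].
Proof.
move=> ks; have [kt ik kn in_] := star_triP reg ks.
have aff := interpolant_affine reg tT a kt.
have := tri_grad_spec ik kn in_ (star_cross_neq0 reg tT ks) aff.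
by rewrite !(interpolant_vtx reg tT).
Qed.

End AtVertex.

Let L10 : 0 < L1. Proof. by have [] := hH. Qed.
Let L20 : 0 < L2. Proof. by have [] := hH. Qed.

Lemma hamiltonian_bounded : exists2 M, 0 < M & forall z q, STbar S z ->
  `|H z q| <= M + L2 * enorm q.
Proof.
have [_ _ lipz lipq] := hH; have [X0 G0] := Gamma0_neq0 S.
have T0 := Tend_gt0 S; have TT : 0 <= (0 : R) <= T by rewrite lexx ltW.
have [N N0 hN] := flow_lipschitz S.
have [B B0 hB] := @compact_bounded R (vec R) (fun x : vec R => `|x|) _
  (@Gamma0_compact _ S) (@norm_continuous _ _).
pose z0 := (flow S X0 0, 0 : R).
pose M := `|H z0 0| + L1 * (N * (4 * B + T) + T) + 1.
exists M.
  rewrite ltr_wpDl // addr_ge0 //.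
  by rewrite mulr_ge0 ?(ltW L10) // addr_ge0 ?mulr_ge0 ?addr_ge0 ?mulr_ge0 ?(ltW N0) ?(ltW B0) ?(ltW T0).
move=> [x t] q Sx; have [tT [X GX xE]] := STbar_flow Sx.
have S0 : STbar S z0 by exact: flow_STbar.
have h1 := lipz _ _ _ _ 0 Sx S0; have h2 := lipq _ _ q 0 Sx.
have XX : enorm (X - X0) <= 4 * B.
  apply: le_trans (enorm_le_norm _) _; apply: le_trans (ler_wpM2l _ (ler_normB _ _)) _ => //.
  have := hB X GX; have := hB X0 G0; rewrite /= !normr_id.
  by move: `|X0| `|X| => v w; lra.
have t0T : `|t - 0| <= T by rewrite subr0 ger0_norm; case/andP: tT.
have xx : enorm (x - flow S X0 0) <= N * (4 * B + T).
  rewrite -xE; apply: le_trans (hN X X0 t 0 GX G0 tT TT) _.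
  by rewrite ler_pM2l // lerD.
rewrite enorm0 addr0 mulr1 in h1; rewrite subr0 in h2.
have h3 : L1 * (enorm (x - flow S X0 0) + `|t - 0|) <= L1 * (N * (4 * B + T) + T).
  by rewrite ler_pM2l // lerD.
have n1 : `|H (x, t) q| <= `|H (x, t) q - H (x, t) 0| + `|H (x, t) 0|.
  by rewrite -{1}(subrK (H (x, t) 0) (H (x, t) q)) ler_normD.
have n2 : `|H (x, t) 0| <= `|H (x, t) 0 - H z0 0| + `|H z0 0|.
  by rewrite -{1}(subrK (H z0 0) (H (x, t) 0)) ler_normD.
rewrite /M; apply: le_trans n1 _; apply: le_trans (lerD h2 n2) _.
have := le_trans h1 h3; rewrite -/z0; move: `|_ - H z0 0| `|H z0 0| => u v; lra.
Qed.

(** Feeds the discrete barrier, whose nodal values are merely Lipschitz: triangle gradients are at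
    most 2 L / kap and the diffusion quotients at most L. *)
Lemma scheme_stability : exists h1 K : R, [/\ 0 < h1, 0 < K &
  forall D h n i (a : 'I_(nvert D) -> R) L, regular_triangulation S D gamma h -> h < h1 ->
    time_partition S D -> eps_bound S C1 D -> (n < nstep D)%N -> 0 <= L ->
    (forall k, k \in star i -> `|a k - a i| <= L * enorm (vtxn S n k - vtxn S n i)) ->
    `|scheme_op n a i| <= K * (1 + L)].
Proof.
have kap0 := shape_constant_gt0 gamma_gt0.
have [h1 [Ce [h10 Ce0 hCe]]] := eps_vol_dist S gamma_gt0 C1_gt0.
have [M M0 hM] := hamiltonian_bounded.
exists h1, (M + L2 * (2 / kap) + Ce * 2); split=> //.
  have c1 : 0 < 2 / kap by rewrite divr_gt0.
  have c2 := mulr_gt0 L20 c1; have c3 : 0 < Ce * 2 by rewrite mulr_gt0.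
  by rewrite addr_gt0 // addr_gt0.
move=> D h n i a L reg hh tp epsb nN Lge ha; have tT := grid_range tp (ltnW nN).
have [vd0 epsC] := hCe D h n i reg hh tp epsb nN.
have /andP[eps0 _] := epsb n i nN.
have zS : STbar S (vtxn S n i, tgrid D n) by split=> //=; exact: (vtx_Gamma reg i tT).
have b1 : `|\sum_(k <- star i) vol_part S n i k / vol S n i *
     H (vtxn S n i, tgrid D n) (tri_grad (vtxn S n) (star_tri i k) (interpolant S (tgrid D n) a)) - 0|
     <= M + L2 * (2 / kap * L).
  apply: (hamiltonian_average reg tT vd0) => k ks; rewrite subr0.
  apply: le_trans (hM _ _ zS) _; rewrite lerD2l ler_pM2l //.
  have [q0 q1 q2] := interpolant_grad reg tT a ks.
  have [dk _ kd e1 [e2 _]] := star_shape gamma_gt0 reg tT ks.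
  apply: (frame_bound kap0 dk kd e1 e2 q0).
  - by rewrite q1; apply: le_trans (ha _ ks) _; rewrite ler_wpM2l.
  - by rewrite q2; apply: le_trans (ha _ (star_next ks)) _; rewrite ler_wpM2l.
have b2 : `|eps n i / vol S n i * \sum_(k <- star i) (a k - a i) / edge_len (vtxn S n) i k *
    (hL S n i k + hR S n i k)| <= Ce * (2 * L).
  apply: (diffusion_le reg tT vd0 (ltW Ce0) eps0 epsC).
  apply: (star_tan_sum_le reg tT vd0) => k ks.
  have e0 := star_edge_gt0 reg tT ks.
  by rewrite normrM normfV (gtr0_norm e0) ler_pdivrMr //; exact: ha.
rewrite subr0 in b1; apply: le_trans (ler_normB _ _) _; apply: le_trans (lerD b1 b2) _.
rewrite -subr_ge0 (_ : _ - _ = M * L + L2 * (2 / kap) + Ce * 2); last by ring.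
have k0 : 0 < kap^-1 by rewrite invr_gt0.
by rewrite !addr_ge0 ?mulr_ge0 ?(ltW M0) ?(ltW L20) ?(ltW k0) ?(ltW Ce0).
Qed.

(** On a triangle the gradient of the interpolant differs from the tangential part of p by O(|p| (de
    + h) + |A| h) ([frame_gradient]). In the diffusion term the linear part of the increments
    telescopes up to O(|p| h) and the quadratic part is O(|A| h). H is taken at (xb, s) and not at
    the vertex, because the viscosity inequality holds there; the shift costs (1 + |p|) de. *)
Lemma scheme_consistency : exists h1 K : R, [/\ 0 < h1, 0 < K &
  forall D h n (i : 'I_(nvert D)) X s (A c : R), regular_triangulation S D gamma h -> h < h1 ->
    time_partition S D -> eps_bound S C1 D -> (n < nstep D)%N ->
    Gamma0 S X -> 0 <= s <= T ->
    let xb := flow S X s in let nu := normal S xb s in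
    let de := enorm (vtxn S n i - xb) + `|tgrid D n - s| in
    let p := (2 * A) *: (vtxn S n i - xb) in de <= h1 ->
    `|scheme_op n (fun k => A * dot (vtxn S n k - xb) (vtxn S n k - xb) + c) i
       - H (xb, s) (p - dot nu p *: nu)|
     <= K * ((1 + enorm p) * (de + h) + `|A| * h)].
Proof.
have [_ _ lipz lipq] := hH.
have kap0 := shape_constant_gt0 gamma_gt0.
have [h1 [Ce [h10 Ce0 hCe]]] := eps_vol_dist S gamma_gt0 C1_gt0.
have [Cn Cn0 hCn] := normal_estimate S.
have [Cv Cv0 hCv] := vertex_normal_close S gamma_gt0.
pose m := Num.min (kap / 8) 1; have m0 : 0 < m by rewrite lt_min divr_gt0 //=.
pose h2 := Num.min h1 (m / (4 * Cn)).
pose G := 4 / kap + 16 / kap ^+ 2.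
have k20 : 0 < kap ^+ 2 by rewrite exprn_gt0.
have G0 : 0 < G by rewrite addr_gt0 // divr_gt0.
exists h2, (L2 * G * (2 * Cn + 1) + 2 * L1 + Ce * 2 * (Cv + 1)); split.
- by rewrite lt_min h10 divr_gt0 // mulr_gt0.
- have c1 : 0 < L2 * G * (2 * Cn + 1).
    by rewrite mulr_gt0 ?(mulr_gt0 L20 G0) // addr_gt0 // mulr_gt0.
  have c2 : 0 < 2 * L1 by rewrite mulr_gt0.
  have c3 : 0 < Ce * 2 * (Cv + 1) by rewrite !mulr_gt0 // addr_gt0.
  by rewrite addr_gt0 // addr_gt0.
move=> D h n i X s A c reg; rewrite lt_min => /andP[hh1 hh2] tp epsb nN GX sT xb nu de p.
rewrite le_min => /andP[_ deh2]; have tT := grid_range tp (ltnW nN).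
have [vd0 epsC] := hCe D h n i reg hh1 tp epsb nN.
have /andP[eps0 _] := epsb n i nN.
have zS : STbar S (vtxn S n i, tgrid D n) by split=> //=; exact: (vtx_Gamma reg i tT).
have bS : STbar S (xb, s) by exact: flow_STbar.
have [nu1 _ _] := Defs.normalP sT (flow_in_Gamma s GX); rewrite -/xb -/nu in nu1.
have [k0 k0s] := star_neq0 reg i.
have [dk0 dkh _ _ _] := star_shape gamma_gt0 reg tT k0s.
have h0 : 0 < h := lt_le_trans dk0 dkh.
have de0 : 0 <= de by rewrite addr_ge0 ?enorm_ge0.
have p0 := enorm_ge0 p; have A0 := normr_ge0 A.
set a := fun k => _.
have aE k : a k - a i = dot p (vtxn S n k - vtxn S n i)
    + A * dot (vtxn S n k - vtxn S n i) (vtxn S n k - vtxn S n i).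
  have gen (y z w : vec R) : A * dot (y - w) (y - w) + c - (A * dot (z - w) (z - w) + c) =
      dot ((2 * A) *: (z - w)) (y - z) + A * dot (y - z) (y - z).
    by rewrite !dotE !mxE; ring.
  exact: gen.
(* Tilt of the edges against the normal at xb. The bounds on h and de make it at most the minimum of
   kap / 8 and 1, as [frame_gradient] requires. *)
pose de' := 2 * Cn * (de + h).
have dh0 : 0 <= de + h by rewrite addr_ge0 // ltW.
have Cn2 : 0 <= 2 * Cn by rewrite mulr_ge0 // ltW.
have de'0 : 0 <= de' by rewrite /de' mulr_ge0.
have de'm : de' <= m.
  have := ltW hh2; move: deh2; rewrite !ler_pdivlMr ?mulr_gt0 // /de'; clear -S gamma_gt0 hH C1_gt0; lra.
have /andP[de'k de'1] : (de' <= kap / 8) && (de' <= 1) by move: de'm; rewrite /m le_min.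
have nuE k : k \in star i -> `|dot nu (vtxn S n k - vtxn S n i)| <=
    de' * enorm (vtxn S n k - vtxn S n i).
  move=> ks; have := hCn _ s _ _ xb tT sT (vtx_Gamma reg k tT) (vtx_Gamma reg i tT) (flow_in_Gamma s GX).
  have [_ dh _ e1 _] := star_shape gamma_gt0 reg tT ks.
  move=> hh; apply: le_trans hh _; rewrite mulrAC ler_wpM2r ?enorm_ge0 //.
  rewrite /de' (_ : 2 * Cn * _ = Cn * (2 * (de + h))); last by ring.
  rewrite ler_pM2l // /de.
  have := enorm_dist3 (vtxn S n k) (vtxn S n i) xb; have := normr_ge0 (tgrid D n - s).
  have := le_trans e1 dh; rewrite -/(vtxn S n k) -/(vtxn S n i); move: h0; clear -S gamma_gt0 hH C1_gt0; lra.
have npn : enorm (p - dot nu p *: nu) <= 2 * enorm p.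
  apply: le_trans (enormB _ _) _; rewrite enormZ nu1 mulr1.
  by have := cauchy_schwarz nu p; rewrite nu1 mul1r; clear -S gamma_gt0 hH C1_gt0; lra.
have b1 : `|\sum_(k <- star i) vol_part S n i k / vol S n i *
     H (vtxn S n i, tgrid D n) (tri_grad (vtxn S n) (star_tri i k) (interpolant S (tgrid D n) a))
     - H (xb, s) (p - dot nu p *: nu)|
     <= L2 * (G * (enorm p * de' + `|A| * h)) + L1 * de * (1 + 2 * enorm p).
  apply: (hamiltonian_average reg tT vd0) => k ks.
  have [q0 q1 q2] := interpolant_grad reg tT a ks.
  have [dk dh kd e1 [e2 _]] := star_shape gamma_gt0 reg tT ks.
  set q := tri_grad _ _ _ in q0 q1 q2 *.
  have gr : enorm (q - (p - dot nu p *: nu)) <= G * (enorm p * de' + `|A| * h).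
    rewrite !aE in q1 q2.
    have n1 := le_trans (nuE _ ks) (ler_wpM2l de'0 e1).
    have n2 := le_trans (nuE _ (star_next ks)) (ler_wpM2l de'0 e2).
    have := frame_gradient kap0 dk de'0 kd e1 e2 nu1 n1 n2 de'k de'1 q0 q1 q2.
    move=> hg; apply: le_trans hg _; rewrite ler_pM2l // lerD2l.
    by rewrite ler_wpM2l.
  rewrite -(subrKA (H (vtxn S n i, tgrid D n) (p - dot nu p *: nu))).
  apply: le_trans (ler_normD _ _) _; apply: lerD.
    by apply: le_trans (lipq _ _ _ _ zS) _; rewrite ler_pM2l.
  apply: le_trans (lipz _ _ _ _ _ zS bS) _.
  by rewrite ler_wpM2l ?mulr_ge0 ?(ltW L10) // lerD2l.
have b2 : `|eps n i / vol S n i * \sum_(k <- star i) (a k - a i) / edge_len (vtxn S n) i k *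
    (hL S n i k + hR S n i k)| <= Ce * (2 * (Cv * h) * enorm p + 2 * (`|A| * h)).
  apply: (diffusion_le reg tT vd0 (ltW Ce0) eps0 epsC).
  (* The quotients split into a linear part, which goes to [flux_bound], and A times the edge
     length, which is bounded term by term. *)
  have -> : \sum_(k <- star i) (a k - a i) / edge_len (vtxn S n) i k *
      (star_tan S n i (prev (star i) k) + star_tan S n i k) =
    \sum_(k <- star i) dot p (edge_dir S (tgrid D n) i k) *
      (star_tan S n i (prev (star i) k) + star_tan S n i k) +
    \sum_(k <- star i) (A * enorm (vtxn S n k - vtxn S n i)) *
      (star_tan S n i (prev (star i) k) + star_tan S n i k).
    rewrite -big_split /= !big_seq; apply: eq_bigr => k ks.
    rewrite -mulrDl; congr (_ * _); rewrite aE.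
    have e0 := star_edge_gt0 reg tT ks.
    rewrite /edge_len /edge_dir dotZr -/(vtxn S n k) -/(vtxn S n i) -enorm2.
    by field; rewrite gt_eqF.
  apply: le_trans (ler_normD _ _) _; rewrite mulrDl; apply: lerD.
    apply: (flux_bound gamma_gt0 reg tT); first by rewrite mulr_ge0 // ltW.
    by move=> k ks; exact: (hCv _ _ _ _ _ reg tT ks).
  apply: (star_tan_sum_le reg tT vd0) => k ks.
  have [_ dh _ e1 _] := star_shape gamma_gt0 reg tT ks.
  by rewrite normrM (ger0_norm (enorm_ge0 _)) ler_wpM2l // (le_trans e1).
rewrite /scheme_op addrAC; apply: le_trans (ler_normB _ _) _; apply: le_trans (lerD b1 b2) _.
set P := enorm p in p0 *; set B := `|A| in A0 *; pose W := (1 + P) * (de + h) + B * h.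
clearbody P B.
have Ph : 0 <= P * h by rewrite mulr_ge0 // ltW.
have Pe : 0 <= P * de by rewrite mulr_ge0.
have Bh : 0 <= B * h by rewrite mulr_ge0 // ltW.
have W1 : P * (de + h) <= W by rewrite /W; move: Ph Pe Bh de0 h0; clear -S gamma_gt0 hH C1_gt0; lra.
have W2 : B * h <= W by rewrite /W; move: Ph Pe Bh de0 h0; clear -S gamma_gt0 hH C1_gt0; lra.
have W3 : de * (1 + 2 * P) <= 2 * W by rewrite /W; move: Ph Pe Bh de0 h0; clear -S gamma_gt0 hH C1_gt0; lra.
have W4 : P * h <= W by rewrite /W; move: Ph Pe Bh de0 h0; clear -S gamma_gt0 hH C1_gt0; lra.
have T1 : L2 * (G * (P * de' + B * h)) <= L2 * G * (2 * Cn + 1) * W.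
  rewrite -[leRHS]mulrA [leLHS]mulrA (ler_pM2l (mulr_gt0 L20 G0)) mulrDl mul1r lerD //.
  by rewrite /de' mulrCA; apply: ler_wpM2l.
have T2 : L1 * de * (1 + 2 * P) <= 2 * L1 * W.
  by rewrite [leRHS](_ : _ = L1 * (2 * W)) -1?[leLHS]mulrA ?(ler_pM2l L10) //; ring.
have T3 : Ce * (2 * (Cv * h) * P + 2 * (B * h)) <= Ce * 2 * (Cv + 1) * W.
  have e1 : Ce * (2 * (Cv * h) * P + 2 * (B * h)) = Ce * 2 * (Cv * (P * h) + B * h) by ring.
  have Ce2 : 0 < Ce * 2 by rewrite mulr_gt0.
  rewrite e1 -[leRHS]mulrA (ler_pM2l Ce2) mulrDl mul1r lerD //.
  by rewrite (ler_pM2l Cv0).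
by have := lerD (lerD T1 T2) T3; rewrite -!mulrDl.
Qed.

End SchemeOperator.

(** * Doubling of variables *)

Section OneSidedEstimate.
Variables (R : realType) (S : evolving_surface R).
Local Notation T := (Tend S).
Variables (gamma hs Ct L2 LU : R).
Variables (H : vec R * R -> vec R -> R) (u : vec R * R -> R).
Variable D : R -> discretization R.
Variable op : forall D : discretization R, nat -> ('I_(nvert D) -> R) -> 'I_(nvert D) -> R.
Variable U : forall h : R, nat -> 'I_(nvert (D h)) -> R.

Hypothesis Ct_gt0 : 0 < Ct.
Hypothesis L2_gt0 : 0 < L2.
Hypothesis LU_gt0 : 0 < LU.

Hypothesis H_lip : forall x t p q, STbar S (x, t) ->
  `|H (x, t) p - H (x, t) q| <= L2 * enorm (p - q).

Hypothesis u_lip : forall x t y s, STbar S (x, t) -> STbar S (y, s) ->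
  `|u (x, t) - u (y, s)| <= LU * (enorm (x - y) + `|t - s|).

(** Only quadratic test functions and global maxima occur. In this form the property is also what a
    supersolution provides for its negative and the Hamiltonian - H(z, - p), so the section can be
    used twice. *)
Hypothesis u_sub : forall A a b c X t, Gamma0 S X -> 0 < t <= T ->
  let x := flow S X t in let nu := normal S x t in let p := (2 * A) *: (x - a) in
  (forall w, STbar S w ->
     u w - quadratic A a b c w <= u (x, t) - quadratic A a b c (x, t)) ->
  2 * A * dot (x - a) (vel S (x, t)) + 2 * A * (t - b) + c
    + H (x, t) (p - dot nu p *: nu) <= 0.

Hypothesis reg : forall h, 0 < h < hs -> regular_triangulation S (D h) gamma h.
Hypothesis part : forall h, 0 < h < hs -> time_partition S (D h).
Hypothesis tau_le : forall h n, 0 < h < hs -> (n < nstep (D h))%N -> tau (D h) n <= Ct * h.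

Hypothesis op_mono : forall h n (a b : 'I_(nvert (D h)) -> R), 0 < h < hs -> (n < nstep (D h))%N ->
  (forall k, a k <= b k) ->
  forall i, a i - tau (D h) n * op n a i <= b i - tau (D h) n * op n b i.

Variables (h1 K : R).
Hypothesis h1_gt0 : 0 < h1.
Hypothesis K_gt0 : 0 < K.

Hypothesis op_cons : forall h n (i : 'I_(nvert (D h))) X s A c, 0 < h < hs -> h < h1 ->
  (n < nstep (D h))%N -> Gamma0 S X -> 0 <= s <= T ->
  let xb := flow S X s in let nu := normal S xb s in
  let de := enorm (vtxn S n i - xb) + `|tgrid (D h) n - s| in
  let p := (2 * A) *: (vtxn S n i - xb) in de <= h1 ->
  `|op n (fun k => A * dot (vtxn S n k - xb) (vtxn S n k - xb) + c) i
     - H (xb, s) (p - dot nu p *: nu)|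
   <= K * ((1 + enorm p) * (de + h) + `|A| * h).

Hypothesis op_stab : forall h n (i : 'I_(nvert (D h))) (a : 'I_(nvert (D h)) -> R) L,
  0 < h < hs -> h < h1 -> (n < nstep (D h))%N -> 0 <= L ->
  (forall k, k \in star i -> `|a k - a i| <= L * enorm (vtxn S n k - vtxn S n i)) ->
  `|op n a i| <= K * (1 + L).

Hypothesis U_init : forall h (i : 'I_(nvert (D h))), 0 < h < hs -> @U h 0%N i = u (vtx S 0 i, 0).
Hypothesis U_step : forall h n (i : 'I_(nvert (D h))), 0 < h < hs -> (n < nstep (D h))%N ->
  @U h n.+1 i = @U h n i - tau (D h) n * op n (@U h n) i.

(** The values u(x_k^0, 0) - Kb t^n have difference quotients on the moving mesh bounded
    independently of n, by [flow_lipschitz] and [flow_expansive]. Stability then bounds the operator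
    on them by Kb, and monotonicity propagates the inequality from step to step. *)
Lemma discrete_barrier : exists2 Kb, 0 < Kb & forall h n (i : 'I_(nvert (D h))),
  0 < h < hs -> h < h1 -> (n <= nstep (D h))%N ->
  u (vtx S 0 i, 0) - Kb * tgrid (D h) n <= @U h n i.
Proof.
have [C C0 hC] := flow_expansive S; have [N N0 hN] := flow_lipschitz S.
have T0 := Tend_gt0 S; have TT : 0 <= (0 : R) <= T by rewrite lexx ltW.
have LC : 0 <= LU * (N * C) by rewrite !mulr_ge0 // ltW.
exists (K * (1 + LU * (N * C))); first by rewrite mulr_gt0 // ltr_pwDl.
set Kb := K * _; move=> h n i hh hh1; elim: n i => [|n IH] i nN.
  by have [-> _ _] := part hh; rewrite mulr0 subr0 U_init.
rewrite U_step //; have tn := grid_range (part hh) (ltnW nN).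
pose V (k : 'I_(nvert (D h))) := u (vtx S 0 k, 0) - Kb * tgrid (D h) n.
have := op_mono hh nN (fun k => IH k (ltnW nN)) i; rewrite -/V; apply: le_trans.
have tau0 : 0 < tau (D h) n by rewrite subr_gt0; have [_ _] := part hh; apply.
have : `|op n V i| <= Kb.
  apply: op_stab => // k ks; rewrite /V opprB addrA subrK.
  have [_ v0 _ _ _] := reg hh.
  have S0 (j : 'I_(nvert (D h))) : STbar S (vtx S 0 j, 0) by apply: flow_STbar; [exact: v0|].
  apply: le_trans (u_lip (S0 _) (S0 _)) _; rewrite subrr normr0 addr0 -mulrA ler_pM2l //.
  apply: le_trans (hN _ _ _ _ (v0 k) (v0 i) TT TT) _.
  rewrite subrr normr0 addr0 -mulrA ler_pM2l //.
  exact: hC (v0 k) (v0 i) tn.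
rewrite ler_norml => /andP[_ opV].
have -> : tgrid (D h) n.+1 = tgrid (D h) n + tau (D h) n by rewrite /tau addrC subrK.
have := ler_wpM2l (ltW tau0) opV; rewrite /V; lra.
Qed.

(** For each of the finitely many pairs (i, n) the function is continuous on the compact [STbar];
    the best of these maxima is taken. [i0] witnesses that there is a vertex. *)
Lemma doubling_maximum h lam (A := (Num.sqrt h)^-1)
    (Phi := fun (z : vec R * R) (i : 'I_(nvert (D h))) (n : nat) =>
      u z - @U h n i - A * dot (z.1 - vtxn S n i) (z.1 - vtxn S n i)
        - A * (z.2 - tgrid (D h) n) ^+ 2 - lam * (z.2 + tgrid (D h) n)) :
  forall i0 : 'I_(nvert (D h)), exists X t i n,
    [/\ Gamma0 S X, 0 <= t <= T, (n <= nstep (D h))%N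
      & forall z j m, STbar S z -> (m <= nstep (D h))%N ->
          Phi z j m <= Phi (flow S X t, t) i n].
Proof.
move=> i0; have [X0 G0] := Gamma0_neq0 S; have T0 := Tend_gt0 S.
have nonempty : STbar S !=set0.
  by exists (flow S X0 0, 0); apply: flow_STbar => //; rewrite lexx ltW.
have maxz (q : 'I_(nvert (D h)) * 'I_(nstep (D h)).+1) : exists z, STbar S z /\
    forall w, STbar S w -> Phi w q.1 q.2 <= Phi z q.1 q.2.
  have [|z Sz hz] := @compact_EVT_max _ R (fun z => Phi z q.1 q.2) (STbar S) nonempty (@STbar_compact R S).
    apply/subspace_continuousP => z Sz.
    have uc : u w @[w --> within (STbar S) (nbhs z)] --> u z.
      apply/cvgrPdist_lt => e e0; rewrite /prop_near1 /within /=.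
      apply/nbhs_ballP; exists (e / (3 * LU)) => /=; first by rewrite divr_gt0 // mulr_gt0.
      move=> w; rewrite -ball_normE /= ltr_pdivlMr ?mulr_gt0 // => hw Sw.
      case: z w Sz Sw hw => [x t] [y s] Sz Sw hw.
      apply: le_lt_trans (u_lip Sz Sw) _; apply: le_lt_trans hw.
      have h3 : enorm (x - y) <= 2 * `|(x, t) - (y, s)|.
        apply: le_trans (enorm_le_norm _) _; rewrite ler_pM2l //.
        by rewrite prod_normE le_max lexx.
      have h4 : `|t - s| <= `|(x, t) - (y, s)| by rewrite prod_normE le_max lexx orbT.
      rewrite (_ : `|(x, t) - (y, s)| * (3 * LU) = LU * (2 * `|(x, t) - (y, s)| + `|(x, t) - (y, s)|)); last by ring.
      by rewrite ler_pM2l // lerD.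
    pose phi := quadratic A (vtxn S q.2 q.1) (tgrid (D h) q.2) lam.
    have pc : phi w @[w --> within (STbar S) (nbhs z)] --> phi z.
      apply: cvg_within_filter; apply: differentiable_continuous.
      exact: quadratic_differentiable.
    have -> : (fun z => Phi z q.1 q.2) =
        (fun z => u z - phi z + (- @U h q.2 q.1 - lam * tgrid (D h) q.2)).
      by apply/funext => w; rewrite /Phi /phi /quadratic; ring.
    by apply: cvgD; [exact: cvgB | exact: cvg_cst].
  exists z; split; first by move: Sz; rewrite inE.
  by move=> w Sw; apply: hz; rewrite inE.
have [zm hzm] := choice maxz.
have [q hq] : exists q, forall q', Phi (zm q') q'.1 q'.2 <= Phi (zm q) q.1 q.2.
  have [q _ hq] := @arg_maxP _ R _ (i0, ord0 : 'I_(nstep (D h)).+1) xpredT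
     (fun q => Phi (zm q) q.1 q.2) isT.
  by exists q => q'; exact: hq.
have [Sq _] := hzm q; case E : (zm q) Sq => [x t] Sq.
have [tT [X GX xE]] := STbar_flow Sq.
exists X, t, q.1, (val q.2); split=> //; first by rewrite -ltnS ltn_ord.
move=> z j m Sz mN; rewrite xE -E.
have mN' : (m < (nstep (D h)).+1)%N by rewrite ltnS.
apply: le_trans (hq (j, Ordinal mN')).
exact: ((hzm (j, Ordinal mN')).2 z Sz).
Qed.

(** The viscosity inequality at (xb, t) and the discrete inequality at step m each contribute one
    lam. Adding them cancels the terms 2A (t - t^(m+1)) up to A tau, the velocity terms up to the
    Lipschitz bound of the velocity, and the Hamiltonians up to the consistency error and a shift of
    the gradient; every leftover is O(s), s = h^(1/2). *)
Lemma interior_estimate (N Cv B : R) :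
  0 < N -> 0 < Cv -> 0 < B ->
  (forall X Y t s, Gamma0 S X -> Gamma0 S Y -> 0 <= t <= T -> 0 <= s <= T ->
     enorm (flow S X t - flow S Y s) <= N * (enorm (X - Y) + `|t - s|)) ->
  [/\ forall X t s, Gamma0 S X -> 0 <= t <= T -> 0 <= s <= T ->
        enorm (flow S X s - flow S X t - (s - t) *: vel S (flow S X t, t))
          <= Cv * `|s - t| ^+ 2,
      forall X Y t s, Gamma0 S X -> Gamma0 S Y -> 0 <= t <= T -> 0 <= s <= T ->
        enorm (vel S (flow S X t, t) - vel S (flow S Y s, s))
          <= Cv * (enorm (flow S X t - flow S Y s) + `|t - s|)
    & forall X t, Gamma0 S X -> 0 <= t <= T -> enorm (vel S (flow S X t, t)) <= Cv] ->
  let B1 := B + (N + 1) * Ct in let P2 := 2 * (B + N * Ct) in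
  forall h lam X t (i : 'I_(nvert (D h))) m, 0 < h < hs -> h < h1 ->
  let s := Num.sqrt h in let A := s^-1 in s <= 1 -> B1 * s <= h1 ->
  Gamma0 S X -> 0 < t <= T -> (m < nstep (D h))%N ->
  (forall w, STbar S w ->
     u w - quadratic A (vtxn S m.+1 i) (tgrid (D h) m.+1) lam w
       <= u (flow S X t, t) - quadratic A (vtxn S m.+1 i) (tgrid (D h) m.+1) lam (flow S X t, t)) ->
  (forall k : 'I_(nvert (D h)), - U m k - A * dot (flow S X t - vtxn S m k) (flow S X t - vtxn S m k)
        - A * (t - tgrid (D h) m) ^+ 2 - lam * tgrid (D h) m
     <= - U m.+1 i - A * dot (flow S X t - vtxn S m.+1 i) (flow S X t - vtxn S m.+1 i)
        - A * (t - tgrid (D h) m.+1) ^+ 2 - lam * tgrid (D h) m.+1) ->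
  enorm (flow S X t - vtxn S m.+1 i) + `|t - tgrid (D h) m.+1| <= B * s ->
  2 * lam <= (Ct + 2 * B * Cv * (B + Ct) + Ct * N ^+ 2 + 4 * L2 * N * Ct
              + K * ((1 + P2) * (B1 + 1) + 1)) * s.
Proof.
move=> N0 Cv0 B0 hN [vel1 vel2 _] B1 P2 h lam X t i m hh hh1 s A s1 B1s GX /andP[t0 tT] mN.
move=> maxu maxU close.
have h0 : 0 < h by case/andP: hh.
have s0 : 0 < s by rewrite sqrtr_gt0.
have ss : s ^+ 2 = h by rewrite sqr_sqrtr // ltW.
have A0 : 0 < A by rewrite invr_gt0.
have As : A * s = 1 by rewrite mulVf // gt_eqF.
have tT' : 0 <= t <= T by rewrite ltW.
have [_ v0 _ _ _] := reg hh.
set tau_ := tau (D h) m.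
have tau0 : 0 < tau_ by rewrite subr_gt0; have [_ _] := part hh; apply.
have taule : tau_ <= Ct * s ^+ 2 by rewrite ss; exact: tau_le.
have Atau : A * tau_ <= Ct * s.
  apply: le_trans (ler_wpM2l (ltW A0) taule) _.
  by rewrite expr2 mulrCA (mulrA A) As mul1r.
have taus : tau_ <= Ct * s.
  by apply: le_trans taule _; rewrite expr2 ler_pM2l // ler_piMl // ltW.
have tm := grid_range (part hh) (ltnW mN); have tm1 := grid_range (part hh) mN.
set t_m := tgrid (D h) m in tm maxU *; set t_m1 := tgrid (D h) m.+1 in tm1 maxu maxU close *.
have tE : t_m1 - t_m = tau_ by [].
set xm := vtxn S m i; set xm1 := vtxn S m.+1 i in maxu maxU close *.
set xb := flow S X t in maxu maxU close *.
set nu := normal S xb t.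
have nu1 : enorm nu = 1 by have [] := Defs.normalP tT' (flow_in_Gamma t GX).
have dx : enorm (xm1 - xm) <= N * tau_.
  have := hN _ _ _ _ (v0 i) (v0 i) tm1 tm.
  by rewrite subrr enorm0 add0r tE gtr0_norm.
have e1 : enorm (xb - xm1) <= B * s.
  by apply: le_trans close; rewrite lerDl.
have e2 : `|t - t_m1| <= B * s.
  by apply: le_trans close; rewrite lerDr enorm_ge0.
(* [p1] is the gradient of the viscosity test function, centred at the vertex at step m+1; [p2] is
   that of the discrete quadratic at the vertex at step m. They differ by the motion of the vertex
   in one step. *)
pose p1 := (2 * A) *: (xb - xm1); pose p2 := (2 * - A) *: (xm - xb).
have bS : STbar S (xb, t) by exact: flow_STbar.
have visc := u_sub GX (introT andP (conj t0 tT)) maxu.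
rewrite -/xb -/nu -/p1 in visc.
(* With this constant, [a] <= U at step m is exactly the maximum property against the vertices at
   step m. *)
pose c := U m.+1 i + A * dot (xb - xm1) (xb - xm1) + A * (t - t_m1) ^+ 2
  - A * (t - t_m) ^+ 2 + lam * (t_m1 - t_m).
pose a (k : 'I_(nvert (D h))) := - A * dot (vtxn S m k - xb) (vtxn S m k - xb) + c.
have aU (k : 'I_(nvert (D h))) : a k <= U m k.
  rewrite /a -opprB dotNl dotNr opprK /c.
  by have := maxU k; rewrite -/xb; lra.
have step := op_mono hh mN aU i; rewrite -U_step // -/tau_ in step.
set de := enorm (xm - xb) + `|t_m - t|.
have xmb : enorm (xm - xb) <= B * s + N * tau_.
  by rewrite (enormBC xm xb); exact: (le_trans (enorm_dist3 xb xm1 xm) (lerD e1 dx)).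
have tmb : `|t_m - t| <= `|t - t_m1| + tau_.
  have -> : t_m - t = - ((t - t_m1) + tau_) by rewrite -tE; ring.
  by rewrite normrN; apply: le_trans (ler_normD _ _) _; rewrite (gtr0_norm tau0).
have de_le : de <= B1 * s.
  have dd : de <= enorm (xb - xm1) + `|t - t_m1| + (N + 1) * tau_.
    have : enorm (xm - xb) <= enorm (xb - xm1) + N * tau_.
      by rewrite (enormBC xm xb); exact: (le_trans (enorm_dist3 xb xm1 xm) (lerD (lexx _) dx)).
    by rewrite /de; move: tmb; lra.
  apply: le_trans dd _; rewrite /B1 [leRHS]mulrDl; apply: lerD => //.
  by rewrite -mulrA ler_pM2l // addr_gt0.
have cons := op_cons (- A) c hh hh1 mN GX tT' (le_trans de_le B1s).
rewrite -/xb -/nu -/xm -/t_m -/de -/p2 normrN (gtr0_norm A0) in cons.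
have p2_le : enorm p2 <= P2.
  rewrite enormZ normrM normrN normr_nat (gtr0_norm A0) /P2 -mulrA ler_pM2l //.
  apply: le_trans (ler_wpM2l (ltW A0) xmb) _.
  rewrite mulrDr (mulrCA A B) As mulr1 lerD2l (mulrCA A N) ler_pM2l //.
  by apply: le_trans Atau _; rewrite ler_piMr // ltW.
have cons_le : K * ((1 + enorm p2) * (de + h) + A * h) <= K * ((1 + P2) * (B1 + 1) + 1) * s.
  rewrite -[leRHS]mulrA ler_pM2l // [leRHS]mulrDl mul1r; apply: lerD.
    rewrite -[leRHS]mulrA; apply: ler_pM; rewrite ?addr_ge0 ?enorm_ge0 ?(ltW h0) //.
      by rewrite lerD2l.
    rewrite [leRHS]mulrDl mul1r; apply: lerD => //.
    by rewrite -ss expr2 ler_piMl // ltW.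
  by rewrite -ss expr2 mulrA As mul1r.
have Hdiff : `|H (xb, t) (p1 - dot nu p1 *: nu) - H (xb, t) (p2 - dot nu p2 *: nu)|
    <= 4 * L2 * N * Ct * s.
  apply: le_trans (H_lip _ _ bS) _.
  have -> : p1 - dot nu p1 *: nu - (p2 - dot nu p2 *: nu) =
      (p1 - p2) - dot nu (p1 - p2) *: nu.
    by rewrite dotBr scalerBl; apply: vec3P; rewrite !mxE; ring.
  have p12 : enorm (p1 - p2) <= 2 * (Ct * s) * N.
    have -> : p1 - p2 = (2 * A) *: (xm - xm1).
      by rewrite /p1 /p2; apply: vec3P; rewrite !mxE; ring.
    rewrite enormZ normrM normr_nat (gtr0_norm A0) enormBC.
    apply: le_trans (ler_wpM2l _ dx) _; first by rewrite mulr_ge0 // ltW.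
    rewrite (_ : 2 * A * (N * tau_) = 2 * (A * tau_) * N); last by ring.
    by rewrite ler_pM2r // ler_pM2l.
  have : enorm (p1 - p2 - dot nu (p1 - p2) *: nu) <= 2 * enorm (p1 - p2).
    apply: le_trans (enormB _ _) _; rewrite enormZ nu1 mulr1.
    by have := cauchy_schwarz nu (p1 - p2); rewrite nu1 mul1r; lra.
  move=> h12; have h13 := le_trans h12 (ler_wpM2l (ler0n _ 2) p12).
  apply: le_trans (ler_wpM2l (ltW L2_gt0) h13) _.
  by rewrite [leRHS](_ : _ = L2 * (2 * (2 * (Ct * s) * N))) //; ring.
(* w is the mean velocity of the vertex during the step and v the velocity of the surface at xb;
   they differ by O(s), since the two space-time points are O(s) apart. *)
pose w := tau_^-1 *: (xm1 - xm); pose v := vel S (xb, t).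
have wE : xm1 - xm = tau_ *: w by rewrite scalerA mulfV ?gt_eqF ?scale1r.
have wN : enorm w <= N.
  by rewrite enormZ gtr0_norm ?invr_gt0 // mulrC ler_pdivrMr.
clearbody w.
have vw : enorm (v - w) <= Cv * (B + Ct) * s.
  have h2 := vel2 _ _ _ _ GX (v0 i) tT' tm1; rewrite -/xb -/v in h2.
  have h3 : enorm (vel S (flow S (vtx0 i) t_m1, t_m1) - w) <= Cv * tau_.
    have := vel1 _ _ _ (v0 i) tm1 tm.
    have -> : flow S (vtx0 i) t_m - flow S (vtx0 i) t_m1 -
        (t_m - t_m1) *: vel S (flow S (vtx0 i) t_m1, t_m1) =
        tau_ *: (vel S (flow S (vtx0 i) t_m1, t_m1) - w).
      have tN : t_m - t_m1 = - tau_ by rewrite -tE opprB.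
      by rewrite scalerBr -wE tN scaleNr opprK opprB addrC.
    rewrite enormZ (gtr0_norm tau0) -normrN opprB tE (gtr0_norm tau0) expr2.
    by rewrite mulrCA ler_pM2l.
  have := enorm_dist3 v (vel S (flow S (vtx0 i) t_m1, t_m1)) w.
  have h4 : Cv * (enorm (xb - xm1) + `|t - t_m1|) <= Cv * (B * s) by rewrite ler_pM2l.
  have h5 : Cv * tau_ <= Cv * (Ct * s) by rewrite ler_pM2l.
  have h6 : enorm (v - vel S (flow S (vtx0 i) t_m1, t_m1)) <= Cv * (B * s) := le_trans h2 h4.
  by move=> h7; have := le_trans h7 (lerD h6 (le_trans h3 h5)); rewrite -mulrDr -mulrDl mulrA.
have T1 : `|2 * A * dot (xm1 - xb) (v - w)| <= 2 * B * Cv * (B + Ct) * s.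
  rewrite normrM normrM normr_nat (gtr0_norm A0).
  apply: le_trans (ler_wpM2l _ (cauchy_schwarz _ _)) _; first by rewrite mulr_ge0 // ltW.
  rewrite (enormBC xm1) (_ : 2 * A * _ = 2 * (A * enorm (xb - xm1)) * enorm (v - w)); last by ring.
  have h2 : A * enorm (xb - xm1) <= B.
    by apply: le_trans (ler_wpM2l (ltW A0) e1) _; rewrite mulrCA As mulr1.
  rewrite [leRHS](_ : _ = 2 * B * (Cv * (B + Ct) * s)); last by ring.
  apply: ler_pM; rewrite ?enorm_ge0 ?mulr_ge0 ?enorm_ge0 ?(ltW A0) //.
  by rewrite ler_pM2l.
have T2 : A * tau_ * dot w w <= Ct * N ^+ 2 * s.
  rewrite [leRHS](_ : _ = Ct * s * N ^+ 2); last by ring.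
  apply: ler_pM; rewrite ?dot_ge0 ?mulr_ge0 ?(ltW A0) ?(ltW tau0) // -enorm2.
  by rewrite ler_sqr ?nnegrE ?enorm_ge0 // ltW.
(* Monotonicity with U^m replaced by [a], divided by tau; the differences of squares in space and
   time are factored. *)
have opa : lam + A * dot w (xm1 + xm - 2 *: xb) + A * (t_m1 + t_m - 2 * t) <= op m a i.
  rewrite -(ler_pM2l tau0) -subr_ge0.
  have -> : tau_ * op m a i - tau_ * (lam + A * dot w (xm1 + xm - 2 *: xb) +
     A * (t_m1 + t_m - 2 * t)) = U m.+1 i - (a i - tau_ * op m a i).
    rewrite /a -/xm /c.
    have e3 : tau_ * dot w (xm1 + xm - 2 *: xb) = dot (xm1 - xm) (xm1 + xm - 2 *: xb).
      by rewrite wE dotZl.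
    rewrite !mulrDr (mulrCA tau_ A (dot _ _)) e3 -tE.
    by rewrite !dotE !mxE; ring.
  by rewrite subr_ge0.
have key : A * dot w (xm1 + xm - 2 *: xb) =
    2 * A * dot (xm1 - xb) w - A * tau_ * dot w w.
  have -> : xm1 + xm - 2 *: xb = 2 *: (xm1 - xb) - tau_ *: w.
    by rewrite -wE; apply: vec3P; rewrite !mxE; ring.
  by rewrite dotBr !dotZr (dotC w); ring.
have v1 : 2 * A * dot (xb - xm1) v = - (2 * A * dot (xm1 - xb) v).
  by rewrite -(opprB xm1) dotNl; ring.
have T3 : 2 * A * dot (xm1 - xb) (v - w) = 2 * A * dot (xm1 - xb) v - 2 * A * dot (xm1 - xb) w.
  by rewrite dotBr; ring.
rewrite -/v v1 in visc; rewrite key in opa; rewrite T3 in T1.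
have T4 : A * (t_m1 + t_m - 2 * t) = - (2 * A * (t - t_m1)) - A * tau_ by rewrite -tE; ring.
rewrite T4 in opa.
move: T1 Hdiff cons; rewrite !ler_norml => /andP[_ T1] /andP[Hdiff _] /andP[_ cons].
have := le_trans cons cons_le.
move: visc opa T1 T2 Hdiff Atau; rewrite !mulrDl.
move: (H (xb, t) _) (H (xb, t) _) (op m a i) => H1 H2 o.
move: (2 * A * dot (xm1 - xb) v) (2 * A * dot (xm1 - xb) w) (A * tau_ * dot w w) => z1 z2 z3.
move: (2 * A * (t - t_m1)) (A * tau_) => z4 z5.
lra.
Qed.

(** With lam = Q s and Q the constant of [interior_estimate], a maximum with t > 0 and n > 0 would
    give 2 lam <= Q s = lam, which is impossible. *)
Lemma one_sided_bound : exists h0 C : R, [/\ 0 < h0, 0 < C &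
  forall h, 0 < h < hs -> h < h0 -> forall (i : 'I_(nvert (D h))) n,
    (n <= nstep (D h))%N ->
    u (vtxn S n i, tgrid (D h) n) - U n i <= C * Num.sqrt h].
Proof.
have [N N0 hN] := flow_lipschitz S; have [Cv Cv0 hv] := flow_velocity S.
have [Kb Kb0 barrier] := discrete_barrier.
(* Comparing the maximum with the pair in which (x, t) is replaced by (x_i^n, t^n) gives A (a^2 +
   b^2) <= (LU + 1) (a + b) for the distances a in space and b in time, lam <= 1 being used. *)
pose B := 2 * (LU + 1); have B0 : 0 < B by rewrite mulr_gt0 // addr_gt0.
pose B1 := B + (N + 1) * Ct; pose P2 := 2 * (B + N * Ct).
have NCt : 0 < N * Ct by rewrite mulr_gt0.
have B10 : 0 < B1 by rewrite addr_gt0 // mulr_gt0 // addr_gt0.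
have P20 : 0 < P2 by rewrite mulr_gt0 // addr_gt0.
pose Q := Ct + 2 * B * Cv * (B + Ct) + Ct * N ^+ 2 + 4 * L2 * N * Ct
              + K * ((1 + P2) * (B1 + 1) + 1).
have Q0 : 0 < Q.
  have q1 : 0 < 2 * B * Cv * (B + Ct) by rewrite !mulr_gt0 // addr_gt0.
  have q2 : 0 < Ct * N ^+ 2 by rewrite mulr_gt0 // exprn_gt0.
  have q3 : 0 < 4 * L2 * N * Ct by rewrite !mulr_gt0.
  have q4 : 0 < K * ((1 + P2) * (B1 + 1) + 1).
    by rewrite mulr_gt0 // addr_gt0 // mulr_gt0 // addr_gt0.
  by rewrite /Q !addr_gt0.
(* Upper bound for s = h^(1/2): it gives s <= 1, puts the distances in the range h1 of the
   consistency estimate, and gives lam = Q s <= 1. *)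
pose m0 := Num.min (Num.min 1 (h1 / B1)) Q^-1.
have m00 : 0 < m0 by rewrite !lt_min ltr01 divr_gt0 // invr_gt0.
(* The three terms come from a maximum with n = 0, from one with t = 0, and from the term with lam,
   which costs at most 2 lam T. *)
pose C := LU * B + ((LU * (1 + N) + Kb) * B) + 2 * Q * T.
have T0 := Tend_gt0 S.
have LUN : 0 < LU * (1 + N) + Kb by rewrite addr_gt0 // mulr_gt0 // addr_gt0.
have QT : 0 < 2 * Q * T by rewrite mulr_gt0 // mulr_gt0.
have C0 : 0 < C by rewrite /C addr_gt0 // addr_gt0 // mulr_gt0.
exists (Num.min h1 (m0 ^+ 2)), C; split=> //.
  by rewrite lt_min h1_gt0 exprn_gt0.
move=> h hh; rewrite lt_min => /andP[hh1 hm] i0 n0 n0N.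
have h0 : 0 < h by case/andP: hh.
set s := Num.sqrt h; have s0 : 0 < s by rewrite sqrtr_gt0.
have ss : s ^+ 2 = h by rewrite sqr_sqrtr // ltW.
have sm : s <= m0 by rewrite -ler_sqr ?nnegrE ?(ltW s0) ?(ltW m00) // ss ltW.
move: sm; rewrite !le_min => /andP[/andP[s1 sB1] sQ].
have {}sB1 : B1 * s <= h1 by rewrite mulrC -ler_pdivlMr.
have {}sQ : Q * s <= 1 by rewrite mulrC -ler_pdivlMr // mul1r.
pose A := s^-1; have A0 : 0 < A by rewrite invr_gt0.
have As : A * s = 1 by rewrite mulVf // gt_eqF.
pose lam := Q * s; have lam0 : 0 < lam by rewrite mulr_gt0.
have [X [t [i [n [GX tT nN hmax]]]]] := doubling_maximum lam i0.
have tn := grid_range (part hh) nN; have tn0 := grid_range (part hh) n0N.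
have [_ v0 _ _ _] := reg hh.
have vS (j : 'I_(nvert (D h))) m : (m <= nstep (D h))%N -> STbar S (vtxn S m j, tgrid (D h) m).
  by move=> mN; apply: flow_STbar; [exact: v0 | exact: grid_range (part hh) mN].
have zS : STbar S (flow S X t, t) by exact: flow_STbar.
rewrite -/s -/A in hmax; set x := flow S X t in hmax zS.
set s1' := enorm (x - vtxn S n i); set s2' := `|t - tgrid (D h) n|.
have s10 : 0 <= s1' := enorm_ge0 _. have s20 : 0 <= s2' := normr_ge0 _.
have close : s1' + s2' <= B * s.
  have := hmax (vtxn S n i, tgrid (D h) n) i n (vS i n nN) nN => /=.
  rewrite !subrr dot0l expr0n /= !mulr0 !subr0 -enorm2 -/s1'.
  have -> : (t - tgrid (D h) n) ^+ 2 = s2' ^+ 2 by rewrite /s2' real_normK ?num_real.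
  have := u_lip zS (vS i n nN); rewrite -/s1' -/s2' ler_norml => /andP[_ ul].
  have tl : tgrid (D h) n - t <= s2' by rewrite /s2' distrC ler_norm.
  move=> hm'; have h2 : A * (s1' ^+ 2 + s2' ^+ 2) <= (LU + 1) * (s1' + s2').
    have := ler_wpM2l (ltW lam0) tl; have := ler_wpM2r s20 sQ; rewrite -/lam mul1r.
    by move: hm' ul; lra.
  have h3 : (s1' + s2') ^+ 2 <= (s1' + s2') * (B * s).
    apply: (@le_trans _ _ (2 * (s1' ^+ 2 + s2' ^+ 2))).
      by have := sqr_ge0 (s1' - s2'); rewrite sqrrB sqrrD; lra.
    have sA : s * A = 1 by rewrite mulrC.
    have := ler_wpM2l (ltW s0) h2; rewrite (mulrA s A) sA mul1r /B.
    by move: (s1' ^+ 2 + s2' ^+ 2) => y; lra.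
  have [e|e] := eqVneq (s1' + s2') 0; first by rewrite e mulr_ge0 // ltW.
  have p : 0 < s1' + s2' by rewrite lt_neqAle eq_sym e addr_ge0.
  by rewrite -(ler_pM2l p) -expr2.
have LB : LU * (s1' + s2') <= LU * (B * s) by rewrite ler_pM2l.
have Bs : 0 <= B * s by rewrite mulr_ge0 // ltW.
have ge0 : 0 <= LU * (B * s) by rewrite mulr_ge0 // ltW.
have ge0' : 0 <= (LU * (1 + N) + Kb) * (B * s) by rewrite mulr_ge0 // ltW.
have maxval : u (x, t) - U n i <= LU * (B * s) + (LU * (1 + N) + Kb) * (B * s) \/
    (0 < t /\ (0 < n)%N).
  have [n_gt0|] := ltnP 0 n; last first.
    rewrite leqn0 => /eqP n_eq0; left.
    have [tg0 _ _] := part hh.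
    have := u_lip zS (vS i n nN); rewrite -/s1' -/s2' ler_norml => /andP[_ ul].
    have -> : U n i = u (vtxn S n i, tgrid (D h) n).
      by move: (n) n_eq0 => n' ->; rewrite U_init // /vtxn tg0.
    lra.
  have [t_gt0|t_le0] := ltP 0 t; first by right.
  (* At t = 0 the time t^n is itself the distance [s2'] = O(s), so the barrier loses only O(s). *)
  left; have t_eq0 : t = 0 by apply/eqP; rewrite eq_le t_le0; case/andP: tT.
  have s2E : s2' = tgrid (D h) n.
    by rewrite /s2' t_eq0 sub0r normrN ger0_norm //; case/andP: tn.
  have bar := barrier h n i hh hh1 nN.
  have TT : 0 <= (0 : R) <= T by rewrite lexx ltW.
  have S0 : STbar S (vtx S 0 i, 0) by apply: flow_STbar; [exact: v0|].
  have := u_lip zS S0; rewrite t_eq0 subrr normr0 addr0 ler_norml => /andP[_ ul].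
  have d0 : enorm (x - vtx S 0 i) <= s1' + N * s2'.
    apply: le_trans (enorm_dist3 _ (vtxn S n i) _) _; rewrite lerD2l s2E.
    have := hN _ _ _ _ (v0 i) (v0 i) tn TT.
    by rewrite subrr enorm0 add0r subr0 ger0_norm //; case/andP: tn.
  have := ler_wpM2l (ltW LU_gt0) d0; move: bar; rewrite -s2E.
  have h2 : LU * (s1' + N * s2') + Kb * s2' <= (LU * (1 + N) + Kb) * (B * s).
    apply: (@le_trans _ _ ((LU * (1 + N) + Kb) * (s1' + s2'))); last by rewrite ler_pM2l.
    rewrite -subr_ge0 (_ : _ - _ = LU * N * s1' + LU * s2' + Kb * s1'); last by ring.
    by rewrite !addr_ge0 ?mulr_ge0 ?(ltW LU_gt0) ?(ltW N0) ?(ltW Kb0).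
  lra.
have u_le : u (vtxn S n0 i0, tgrid (D h) n0) - U n0 i0 <=
    u (x, t) - U n i + lam * (2 * T).
  have := hmax (vtxn S n0 i0, tgrid (D h) n0) i0 n0 (vS i0 n0 n0N) n0N => /=.
  rewrite !subrr dot0l expr0n /= !mulr0 !subr0 -enorm2.
  have a1 := mulr_ge0 (ltW A0) (sqr_ge0 s1').
  have a2 := mulr_ge0 (ltW A0) (sqr_ge0 (t - tgrid (D h) n)).
  have a3 : 0 <= lam * (t + tgrid (D h) n).
    by rewrite mulr_ge0 ?(ltW lam0) // addr_ge0 //; [case/andP: tT | case/andP: tn].
  have a4 : lam * (tgrid (D h) n0 + tgrid (D h) n0) <= lam * (2 * T).
    by rewrite ler_pM2l //; case/andP: tn0; lra.
  by move: a1 a2 a3 a4; rewrite -/s1'; lra.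
case: maxval => [maxval|[t_gt0 n_gt0]].
  apply: le_trans u_le _; rewrite /lam /C; apply: le_trans (lerD maxval (lexx _)) _.
  by rewrite [leRHS](_ : _ = LU * (B * s) + (LU * (1 + N) + Kb) * (B * s) + Q * s * (2 * T)) //; ring.
exfalso; case: n n_gt0 => // m _ in nN hmax tn s1' s2' s10 s20 close LB u_le *.
have tT0 : 0 < t <= T by rewrite t_gt0; case/andP: tT.
suff contra : 2 * lam <= lam by move: lam0 contra; lra.
apply: (@interior_estimate N Cv B N0 Cv0 B0 hN hv h lam X t i m hh hh1 s1 sB1 GX tT0 nN).
- move=> w Sw; have := hmax w i m.+1 Sw nN; rewrite /quadratic -/x /=.
  by rewrite -/s -/A; lra.
- by move=> k; have := hmax (x, t) k m zS (ltnW nN); rewrite /= -/x -/s -/A; lra.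
- exact: close.
Qed.

End OneSidedEstimate.

(** * The two one-sided bounds for the concrete scheme *)

Section Convergence.
Variables (R : realType) (S : evolving_surface R).
Variables (LH1 LH2 : R) (H : vec R * R -> vec R -> R).
Hypothesis hH : hamiltonian S LH1 LH2 H.
Variables (gamma hstar : R) (D : R -> discretization R).
Hypothesis gamma_gt0 : 0 < gamma.
Hypothesis hD : forall h, 0 < h < hstar -> admissible S (D h) gamma h.
Variables C0 C1 C2 : R.
Hypothesis hC : monotonicity_constants S gamma LH2 hstar C0 C1 C2.
Variable u0 : vec R -> R.
Variable u : vec R * R -> R.
Hypothesis hu : viscosity_solution S H u0 u.
Hypothesis hmesh : forall h, 0 < h < hstar -> mesh_condition S (D h) C0 C1 C2.

Let C1_gt0 : 0 < C1. Proof. by have [] := hC. Qed.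
Let C2_gt0 : 0 < C2. Proof. by have [] := hC. Qed.

Let reg h : 0 < h < hstar -> regular_triangulation S (D h) gamma h.
Proof. by move=> /hD[]. Qed.

Let part h : 0 < h < hstar -> time_partition S (D h).
Proof. by move=> /hD[]. Qed.

Let grid h n : 0 < h < hstar -> (n <= nstep (D h))%N -> 0 <= tgrid (D h) n <= Tend S.
Proof. by move=> /part; exact: grid_range. Qed.

Let mesh_eps h : 0 < h < hstar -> eps_bound S C1 (D h).
Proof.
move=> hh n i nN; have [_ _ /(_ n i nN) ->] := hD hh.
by have [/(_ i)/andP[]] := hmesh hh nN.
Qed.

Let tau_le h n : 0 < h < hstar -> (n < nstep (D h))%N -> tau (D h) n <= C2 * h.
Proof.
move=> hh nN; have r := reg hh.
(* The mesh condition bounds tau through edges, so some edge has to be exhibited. *)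
have [_ _ _ _ [_ _ [t [K [_ KT _]]] _]] := r.
have [i [k [ks _]]] := tris_star r KT.
have [_ /(_ i k ks)/le_trans] := hmesh hh nN; apply.
have [_ dh _ ed _] := star_shape gamma_gt0 r (grid hh (ltnW nN)) ks.
by apply: ler_wpM2l; [exact: ltW|exact: le_trans ed dh].
Qed.

Local Notation op := (scheme_op S H).

Let coefE h n (a : 'I_(nvert (D h)) -> R) i : 0 < h < hstar -> (n <= nstep (D h))%N ->
  scheme_coef S H n (interpolant S (tgrid (D h) n) a) i = a i - tau (D h) n * op n a i.
Proof. by move=> hh nN; exact: (scheme_coefE H a i (reg hh) (grid hh nN)). Qed.

(** Monotonicity between nodal values: interpolation preserves order, and the new function takes its
    coefficient as value at each vertex. *)
Let op_mono h n (a b : 'I_(nvert (D h)) -> R) :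
  0 < h < hstar -> (n < nstep (D h))%N -> (forall k, a k <= b k) ->
  forall i, a i - tau (D h) n * op n a i <= b i - tau (D h) n * op n b i.
Proof.
move=> hh nN ab i; have r := reg hh.
have tn := grid hh (ltnW nN); have tn1 := grid hh nN.
have [_ _ _ mono] := hC.
have := mono LH1 H hH h (D h) hh (hD hh) (hmesh hh) n _ _ nN
  (interpolant_fe_space r tn a) (interpolant_fe_space r tn b)
  (fun x => @interpolant_le _ _ _ _ _ _ r tn _ _ ab x)
  _ (vtx_Gamma_h (tgrid (D h) n.+1) r i).
rewrite -!(coefE _ _ hh (ltnW nN)).
have e v : @scheme R S (D h) H n v (vtx S (tgrid (D h) n.+1) i) = scheme_coef S H n v i.
  exact: (interpolant_vtx r tn1 (scheme_coef S H n v) i).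
by rewrite !e.
Qed.

Let U h n (i : 'I_(nvert (D h))) : R := fe_solution S (D h) H u0 n (vtxn S n i).

Let U_interpolant h n : 0 < h < hstar -> (n <= nstep (D h))%N ->
  fe_solution S (D h) H u0 n = interpolant S (tgrid (D h) n) (@U h n).
Proof.
move=> hh nN; have r := reg hh; have tn := grid hh nN.
have [v e] : exists v : 'I_(nvert (D h)) -> R, fe_solution S (D h)
    H u0 n = interpolant S (tgrid (D h) n) v.
  case: n {nN tn} => [|n]; first by exists (u0 \o @vtx0 R (D h)).
  by exists (scheme_coef S H n (fe_solution S (D h) H u0 n)).
suff -> : @U h n = v by [].
by apply/funext => i; rewrite /U e (interpolant_vtx r tn).
Qed.

Let U_init h (i : 'I_(nvert (D h))) : 0 < h < hstar -> U 0 i = u (vtx S 0 i, 0).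
Proof.
move=> hh; have r := reg hh; have [t0 _ _] := part hh.
have tn := grid hh (leq0n _).
have -> : U 0 i = u0 (vtx0 i).
  exact: (interpolant_vtx r tn (u0 \o @vtx0 R (D h)) i).
have [_ /(_ i) G0 _ _ _] := r.
have f0 : vtx S 0 i = vtx0 i by exact: flow0.
have G : Gamma S 0 (vtx0 i) by exists (vtx0 i) => //; exact: flow0.
have [[_ _ /(_ _ G) le _] [_ _ /(_ _ G) ge _]] := hu.
by rewrite f0; apply/eqP; rewrite eq_le le ge.
Qed.

Let U_step h n (i : 'I_(nvert (D h))) : 0 < h < hstar -> (n < nstep (D h))%N ->
  U n.+1 i = U n i - tau (D h) n * op n (@U h n) i.
Proof.
move=> hh nN; rewrite -(coefE _ _ hh (ltnW nN)) -(U_interpolant hh (ltnW nN)).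
exact: (interpolant_vtx (reg hh) (grid hh nN) (scheme_coef S H n (fe_solution S (D h) H u0 n)) i).
Qed.

Let u_sub A (a : vec R) b c X t : Gamma0 S X -> 0 < t <= Tend S ->
  let x := flow S X t in let nu := normal S x t in let p := (2 * A) *: (x - a) in
  (forall w, STbar S w ->
    u w - quadratic A a b c w <= u (x, t) - quadratic A a b c (x, t)) ->
  2 * A * dot (x - a) (vel S (x, t)) + 2 * A * (t - b) + c + H (x, t) (p - dot nu p *: nu) <= 0.
Proof.
move=> GX tT x nu p mx; have [[_ _ _ /(_ _ (quadratic_C1 A a b c) X t GX tT) sub] _] := hu.
have tT' : 0 <= t <= Tend S by case/andP: tT => /ltW -> ->.
rewrite -(tan_grad_quadratic S A a b c x t) -mat_deriv_quadratic //; apply: sub.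
by rewrite near_withinE; apply: filterE => w /mx.
Qed.

(** The supersolution property is tested with minus the quadratic, so A and c change sign; the
    result is the subsolution inequality of - u for - H(z, - p). *)
Let u_super A (a : vec R) b c X t : Gamma0 S X -> 0 < t <= Tend S ->
  let x := flow S X t in let nu := normal S x t in let p := (2 * A) *: (x - a) in
  (forall w, STbar S w ->
    - u w - quadratic A a b c w <= - u (x, t) - quadratic A a b c (x, t)) ->
  2 * A * dot (x - a) (vel S (x, t)) + 2 * A * (t - b) + c
    - H (x, t) (- (p - dot nu p *: nu)) <= 0.
Proof.
move=> GX tT x nu p mx.
have [_ [_ _ _ /(_ _ (quadratic_C1 (- A) a b (- c)) X t GX tT) super]] := hu.
have tT' : 0 <= t <= Tend S by case/andP: tT => /ltW -> ->.
have qN w : quadratic (- A) a b (- c) w = - quadratic A a b c w.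
  by rewrite /quadratic; ring.
move: super => /=; rewrite mat_deriv_quadratic // tan_grad_quadratic -/x -/nu.
have -> : (2 * - A) *: (x - a) = - p by rewrite mulrN scaleNr.
have -> : - p - dot nu (- p) *: nu = - (p - dot nu p *: nu).
  by rewrite dotNr scaleNr opprK opprB addrC.
move=> super; rewrite -oppr_ge0.
have -> : forall d v k : R, - (2 * A * d + 2 * A * v + c - k)
  = 2 * - A * d + 2 * - A * v + - c + k by move=> *; ring.
apply: super; rewrite near_withinE; apply: filterE => w /mx.
by rewrite !qN -lerN2 !opprD !opprK.
Qed.

Variable LU : R.
Hypothesis LU_gt0 : 0 < LU.
Hypothesis u_lip : forall x t y s, STbar S (x, t) -> STbar S (y, s) ->
  `|u (x, t) - u (y, s)| <= LU * (enorm (x - y) + `|t - s|).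

Let upper : exists h0 C, [/\ 0 < h0, 0 < C & forall h, 0 < h < hstar -> h < h0 ->
  forall (i : 'I_(nvert (D h))) n, (n <= nstep (D h))%N ->
  u (vtxn S n i, tgrid (D h) n) - U n i <= C * Num.sqrt h].
Proof.
have [_ L2_gt0 _ H_lip] := hH.
have [h1 [K [h1_gt0 K_gt0 cons]]] := scheme_consistency gamma_gt0 hH C1_gt0.
have [h2 [K' [h2_gt0 K'_gt0 stab]]] := scheme_stability gamma_gt0 hH C1_gt0.
apply: (one_sided_bound (Ct := C2) (H := H) (op := @scheme_op R S H)
  (h1 := Num.min h1 h2) (K := Num.max K K') C2_gt0 L2_gt0 LU_gt0 H_lip u_lip u_sub reg part
  tau_le op_mono) => //.
- by rewrite lt_min h1_gt0.
- by rewrite lt_max K_gt0.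
- move=> h n i X s A c hh; rewrite lt_min => /andP[hh1 _] nN GX sT /=.
  rewrite le_min => /andP[de1 _].
  apply: le_trans (cons _ _ _ _ _ _ A c (reg hh) hh1 (part hh) (mesh_eps hh) nN GX sT de1) _.
  apply: ler_wpM2r; last by rewrite le_max lexx.
  have [/andP[h_gt0 _]] := hh; have h0 := ltW h_gt0.
  by rewrite !(addr_ge0, mulr_ge0, enorm_ge0, normr_ge0).
- move=> h n i a L hh; rewrite lt_min => /andP[_ hh2] nN L0 aL.
  apply: le_trans (stab _ _ _ _ _ _ (reg hh) hh2 (part hh) (mesh_eps hh) nN L0 aL) _.
  by apply: ler_wpM2r; [exact: addr_ge0|rewrite le_max lexx orbT].
Qed.

Let lower : exists h0 C, [/\ 0 < h0, 0 < C & forall h, 0 < h < hstar -> h < h0 ->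
  forall (i : 'I_(nvert (D h))) n, (n <= nstep (D h))%N ->
  - u (vtxn S n i, tgrid (D h) n) - - U n i <= C * Num.sqrt h].
Proof.
have [_ L2_gt0 _ H_lip] := hH.
have [h1 [K [h1_gt0 K_gt0 cons]]] := scheme_consistency gamma_gt0 hH C1_gt0.
have [h2 [K' [h2_gt0 K'_gt0 stab]]] := scheme_stability gamma_gt0 hH C1_gt0.
(* Reflection turns the operator into a -> - op(- a), again monotone, consistent with - H(z, - p)
   and stable with the same constants. *)
apply: (one_sided_bound (Ct := C2) (H := fun z p => - H z (- p))
  (u := fun z => - u z) (U := fun h n i => - @U h n i)
  (op := fun D' n a i => - scheme_op S H (D := D') n (fun k => - a k) i)
  (h1 := Num.min h1 h2) (K := Num.max K K') C2_gt0 L2_gt0 LU_gt0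
  _ _ u_super reg part tau_le _) => //.
- move=> x t p q z; rewrite -opprD normrN; apply: le_trans (H_lip _ _ _ _ z) _.
  by rewrite -opprD enormN.
- by move=> x t y s zx zy; rewrite -opprD normrN; exact: u_lip.
- move=> h n a b hh nN ab i.
  have := op_mono hh nN (fun k => _ : - b k <= - a k) i.
  rewrite !mulrN !opprK => /(_ (fun k => _)) le.
  rewrite -lerN2 !opprD; apply: le => k; by rewrite lerN2.
- by rewrite lt_min h1_gt0.
- by rewrite lt_max K_gt0.
- move=> h n i X s A c hh; rewrite lt_min => /andP[hh1 _] nN GX sT.
  move=> xb nu de p; rewrite le_min => /andP[de1 _].
  have := cons _ _ _ _ _ _ (- A) (- c) (reg hh) hh1 (part hh) (mesh_eps hh) nN GX sT de1.
  rewrite -/xb -/nu -/de.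
  have -> : (2 * - A) *: (vtxn S n i - xb) = - p by rewrite mulrN scaleNr.
  have -> : - p - dot nu (- p) *: nu = - (p - dot nu p *: nu).
    by rewrite dotNr scaleNr opprK opprB addrC.
  rewrite enormN normrN -opprD normrN => e.
  have -> : (fun k : 'I_(nvert (D h)) => - (A * dot (vtxn S n k - xb) (vtxn S n k - xb) + c))
    = (fun k => - A * dot (vtxn S n k - xb) (vtxn S n k - xb) - c).
    by apply/funext => k; rewrite mulNr opprD.
  apply: le_trans e _.
  apply: ler_wpM2r; last by rewrite le_max lexx.
  have [/andP[h_gt0 _]] := hh; have h0 := ltW h_gt0.
  by rewrite !(addr_ge0, mulr_ge0, enorm_ge0, normr_ge0).
- move=> h n i a L hh; rewrite lt_min => /andP[_ hh2] nN L0 aL; rewrite normrN.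
  have aL' k : k \in star i -> `|- a k - - a i| <= L * enorm (vtxn S n k - vtxn S n i).
    by move=> ks; rewrite -opprD normrN; exact: aL.
  apply: le_trans (stab _ _ _ _ _ _ (reg hh) hh2 (part hh) (mesh_eps hh) nN L0 aL') _.
  by apply: ler_wpM2r; [exact: addr_ge0|rewrite le_max lexx orbT].
- by move=> h i hh; rewrite U_init.
- move=> h n i hh nN; rewrite U_step // opprD opprK mulrN opprK.
  have -> : (fun k => - - @U h n k) = @U h n by apply/funext => k; exact: opprK.
  by [].

Qed.

Lemma convergence_rate : exists h0 C, [/\ 0 < h0, 0 < C & forall h, 0 < h < hstar -> h < h0 ->
  forall (i : 'I_(nvert (D h))) n, (n <= nstep (D h))%N ->
  `|u (vtxn S n i, tgrid (D h) n) - fe_solution S (D h) H u0 n (vtxn S n i)| <= C * Num.sqrt h].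
Proof.
have [h1 [C [h1_gt0 C_gt0 up]]] := upper; have [h2 [C' [h2_gt0 C'_gt0 lo]]] := lower.
exists (Num.min h1 h2), (C + C'); split; [by rewrite lt_min h1_gt0|exact: addr_gt0|].
move=> h hh; rewrite lt_min => /andP[hh1 hh2] i n nN.
have := up h hh hh1 i n nN; have := lo h hh hh2 i n nN.
have sC : 0 <= C * Num.sqrt h by rewrite mulr_ge0 ?sqrtr_ge0 // ltW.
have sC' : 0 <= C' * Num.sqrt h by rewrite mulr_ge0 ?sqrtr_ge0 // ltW.
by rewrite -/(U n i) mulrDl => l1 l2; rewrite ler_norml; apply/andP; split; lra.
Qed.

End Convergence.

Theorem theorem6p1 (R : realType) (S : evolving_surface R)
  (LH1 LH2 : R) (H : 'rV[R]_3 * R -> 'rV[R]_3 -> R)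
  (hH : hamiltonian S LH1 LH2 H)
  (gamma hstar : R) (gamma_gt0 : 0 < gamma) (hstar_gt0 : 0 < hstar)
  (D : R -> discretization R)
  (hD : forall h : R, 0 < h < hstar -> admissible S (D h) gamma h)
  (C0 C1 C2 : R)
  (hC : monotonicity_constants S gamma LH2 hstar C0 C1 C2)
  (u0 : 'rV[R]_3 -> R) (u0_cont : {within Gamma S 0, continuous u0})
  (u : 'rV[R]_3 * R -> R) (hu : viscosity_solution S H u0 u)
  (LU : R) (LU_gt0 : 0 < LU)
  (u_lip : forall x t y s, STbar S (x, t) -> STbar S (y, s) ->
     `|u (x, t) - u (y, s)| <= LU * (enorm (x - y) + `|t - s|))
  (hmesh : forall h : R, 0 < h < hstar -> mesh_condition S (D h) C0 C1 C2) :
  exists h0 C : R, [/\ 0 < h0, h0 <= hstar, 0 < C &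
    forall h : R, 0 < h < h0 ->
    forall (i : 'I_(nvert (D h))) (n : nat), (n <= nstep (D h))%N ->
      `|u (vtxn S n i, tgrid (D h) n) - fe_solution S (D h) H u0 n (vtxn S n i)|
        <= C * Num.sqrt h].
Proof.
have [h0 [C [h0_gt0 C_gt0 rate]]] := convergence_rate hH gamma_gt0 hD hC hu hmesh LU_gt0 u_lip.
exists (Num.min h0 hstar), C; split => //; first by rewrite lt_min h0_gt0.
  by rewrite ge_min lexx orbT.
move=> h; rewrite lt_min => /and3P[h_gt0 hh0 hhs] i n nN.
by apply: rate => //; rewrite h_gt0.
Qed.
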